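(* The following hold. (1) For every $\vartheta>0$, $$\lim_{n\to\infty}\sqrt n\sup_{k\in\{0,\dots,n\}}\left|\frac{\genfrac{[}{]}{0pt}{}{n}{k}(\vartheta n)^k}{S_n(\vartheta n)}-\frac{1}{\sqrt{2\pi n}\,\sigma_1(\vartheta)}\exp\left\{-\frac{(k-\mu_1(\vartheta)n)^2}{2\sigma_1^2(\vartheta)n}\right\}\right|=0.$$ (2) For every $\vartheta>0$, $$\lim_{n\to\infty}\sqrt n\sup_{k\in\{0,\dots,n\}}\left|\frac{\genfrac{\{}{\}}{0pt}{}{n}{k}(\vartheta n)^k}{T_n(\vartheta n)}-\frac{1}{\sqrt{2\pi n}\,\sigma_2(\vartheta)}\exp\left\{-\frac{(k-\mu_2(\vartheta)n)^2}{2\sigma_2^2(\vartheta)n}\right\}\right|=0.$$ (3) For every $\vartheta\ge 1$, $$\lim_{n\to\infty}\sqrt n\sup_{k\in\{0,\dots,n\}}\left|\genfrac{\{}{\}}{0pt}{}{n}{k}\frac{(\vartheta n)^{\underline{k}}}{(\vartheta n)^n}-\frac{1}{\sqrt{2\pi n}\,\sigma_3(\vartheta)}\exp\left\{-\frac{(k-\mu_3(\vartheta)n)^2}{2\sigma_3^2(\vartheta)n}\right\}\right|=0.$$ Moreover, the convergence is uniform in $\vartheta$ as long as $\vartheta$ stays in any compact subset of $(0,\infty)$ in (1) and (2), respectively of $[1,\infty)$ in (3).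
   Context: $\genfrac{[}{]}{0pt}{}{n}{k}$ and $\genfrac{\{}{\}}{0pt}{}{n}{k}$ are the (unsigned) Stirling numbers of the first and second kind; $S_n(x)=x(x+1)\cdots(x+n-1)=\sum_{k=1}^n\genfrac{[}{]}{0pt}{}{n}{k}x^k$; $T_n(x)=\sum_{k=1}^n\genfrac{\{}{\}}{0pt}{}{n}{k}x^k$; $(\theta)^{\underline k}=\theta(\theta-1)\cdots(\theta-k+1)$. $W_0:(-1/e,\infty)\to(-1,\infty)$ is the principal branch of the Lambert function, i.e. the inverse of $w\mapsto we^w$. For $\vartheta>0$ put $$\mu_1(\vartheta)=\vartheta\log(1+1/\vartheta),\quad \sigma_1^2(\vartheta)=\vartheta\log(1+1/\vartheta)-\frac{\vartheta}{1+\vartheta},$$ $$\mu_2(\vartheta)=\frac{1}{W_0(1/\vartheta)}-\vartheta,\quad \sigma_2^2(\vartheta)=\frac{1}{W_0(1/\vartheta)(1+W_0(1/\vartheta))}-\vartheta,$$ $$\mu_3(\vartheta)=\vartheta(1-e^{-1/\vartheta}),\quad \sigma_3^2(\vartheta)=\vartheta e^{-1/\vartheta}\left(1-e^{-1/\vartheta}-\tfrac1\vartheta e^{-1/\vartheta}\right),$$ all $\sigma_i^2(\vartheta)$ being positive, and $\sigma_i(\vartheta)>0$ the square root. *)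

(* Defs.v *)
From HB Require Import structures.
From mathcomp Require Import all_boot all_order all_algebra.
From mathcomp Require Import all_classical all_reals all_analysis.
From mathcomp Require Import ring.

Set Implicit Arguments.
Unset Strict Implicit.
Unset Printing Implicit Defensive.

Import Order.TTheory GRing.Theory Num.Theory.
Import numFieldNormedType.Exports.

Local Open Scope classical_set_scope.
Local Open Scope ring_scope.

(* Unsigned Stirling numbers of the first kind; see [risingE]. *)
Fixpoint stirling1 (n k : nat) : nat :=
  match n, k with
  | 0, 0 => 1
  | 0, _.+1 => 0
  | _.+1, 0 => 0
  | n'.+1, k'.+1 => n' * stirling1 n' k'.+1 + stirling1 n' k'
  end%N.

(* Stirling numbers of the second kind; see [exprn_falling]. *)
Fixpoint stirling2 (n k : nat) : nat :=
  match n, k with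
  | 0, 0 => 1
  | 0, _.+1 => 0
  | _.+1, 0 => 0
  | n'.+1, k'.+1 => k'.+1 * stirling2 n' k'.+1 + stirling2 n' k'
  end%N.

Section Polynomials.
Variable R : comNzRingType.
Implicit Types (x : R) (n k : nat).

(* S_n(x) *)
Definition rising n x : R := \prod_(i < n) (x + i%:R).

(* T_n(x) *)
Definition touchard n x : R := \sum_(1 <= k < n.+1) (stirling2 n k)%:R * x ^+ k.

Definition falling x k : R := \prod_(i < k) (x - i%:R).

Lemma stirling1_gt n k : (n < k)%N -> stirling1 n k = 0%N.
Proof.
elim: n k => [|n IH] [|k] //= nk.
by rewrite !IH ?muln0 // ltnW.
Qed.

Lemma stirling2_gt n k : (n < k)%N -> stirling2 n k = 0%N.
Proof.
elim: n k => [|n IH] [|k] //= nk.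
by rewrite !IH ?muln0 // ltnW.
Qed.

Lemma risingE_ord n x : rising n x = \sum_(k < n.+1) (stirling1 n k)%:R * x ^+ k.
Proof.
elim: n => [|n IH].
  by rewrite /rising big_ord0 big_ord1 mulr1.
rewrite /rising big_ord_recr /= -/(rising n x) IH [RHS]big_ord_recl /=.
rewrite mul0r add0r.
under [RHS]eq_bigr => i _ do rewrite /bump /= add1n natrD natrM mulrDl.
rewrite big_split /= [X in _ = X + _]big_ord_recr /= stirling1_gt //.
rewrite mulr0 mul0r addr0.
have -> : \sum_(i < n) n%:R * (stirling1 n i.+1)%:R * x ^+ i.+1
  = \sum_(i < n.+1) n%:R * (stirling1 n i)%:R * x ^+ i.
  rewrite [RHS]big_ord_recl /=.
  have -> : n%:R * (stirling1 n 0)%:R = 0 :> R.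
    by case: n {IH} => [|n]; rewrite ?mul0r ?mulr0.
  by rewrite mul0r add0r.
rewrite mulr_suml -big_split /=; apply: eq_bigr => i _.
by rewrite exprS; ring.
Qed.

Lemma risingE n x : (0 < n)%N ->
  rising n x = \sum_(1 <= k < n.+1) (stirling1 n k)%:R * x ^+ k.
Proof.
case: n => // n _; rewrite risingE_ord.
by rewrite -(big_mkord xpredT (fun k => (stirling1 n.+1 k)%:R * x ^+ k))
           big_ltn //= mul0r add0r.
Qed.

Lemma exprn_falling n x :
  x ^+ n = \sum_(k < n.+1) (stirling2 n k)%:R * falling x k.
Proof.
elim: n => [|n IH].
  by rewrite /falling big_ord1 big_ord0 mulr1.
rewrite exprSr IH [RHS]big_ord_recl /= mul0r add0r.
under [RHS]eq_bigr => i _ do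
  rewrite /bump /= add1n /= natrD natrM mulrDl.
rewrite big_split /= [X in _ = X + _]big_ord_recr /= stirling2_gt //.
rewrite mulr0 mul0r addr0.
have -> : \sum_(i < n) (i.+1)%:R * (stirling2 n i.+1)%:R * falling x i.+1
  = \sum_(i < n.+1) i%:R * (stirling2 n i)%:R * falling x i.
  rewrite [RHS]big_ord_recl /= !mul0r add0r.
  by apply: eq_bigr => i _; rewrite /bump /= add1n.
rewrite mulr_suml -big_split /=; apply: eq_bigr => i _.
rewrite [falling x i.+1]/falling big_ord_recr /= -/(falling x i).
by ring.
Qed.

End Polynomials.

Section LocalLimit.
Variable R : realType.
Implicit Types (t y : R) (n : nat).

(* Principal branch of the Lambert function: the inverse of
   w |-> w * e^w on ]-1, +oo[ (with value 0 outside of ]-1/e, +oo[). *)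
Definition lambertW0 : R -> R :=
  'pinv_(fun=> 0) `]-1, +oo[ (fun w : R => w * expR w).

Lemma lambertW0P y : 0 < y ->
  -1 < lambertW0 y /\ lambertW0 y * expR (lambertW0 y) = y.
Proof.
move=> y0; set f := fun w : R => w * expR w.
have yf : y \in f @` `]-1, +oo[.
  have e1 : 1 <= expR y by rewrite -expR0 ler_expR ltW.
  have ye : y <= y * expR y by rewrite ler_peMr // ltW.
  have [w] : exists2 w, w \in `[0, y] & f w = y.
    apply: IVT; first exact: ltW.
    - apply: continuous_subspaceT => x; apply: cvgM; first exact: cvg_id.
      exact: continuous_expR.
    - by rewrite /f mul0r ge_min le_max (ltW y0) ye orbT.
  rewrite in_itv /= => /andP[w0 _] fw; apply/mem_set; exists w => //=.
  by rewrite in_itv /= andbT (lt_le_trans _ w0).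
split; last exact: (@pinvK _ _ (fun=> 0) `]-1, +oo[ f y yf).
have : lambertW0 y \in `]-1, +oo[%classic.
  apply: mem_set; apply: (@surjpinv_image_sub _ _ (fun=> 0) `]-1, +oo[ [set y] f).
    by move=> _ ->; apply: set_mem.
  by exists y.
by rewrite inE /= in_itv /= andbT.
Qed.

Definition mu1 t : R := t * ln (1 + t^-1).
Definition var1 t : R := t * ln (1 + t^-1) - t / (1 + t).

Definition mu2 t : R := (lambertW0 t^-1)^-1 - t.
Definition var2 t : R := (lambertW0 t^-1 * (1 + lambertW0 t^-1))^-1 - t.

Definition mu3 t : R := t * (1 - expR (- t^-1)).
Definition var3 t : R :=
  t * expR (- t^-1) * (1 - expR (- t^-1) - t^-1 * expR (- t^-1)).

(* The density at k of the normal law with mean m * n and variance v * n. *)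
Definition gauss (m v : R) n (k : nat) : R :=
  (Num.sqrt (2 * pi * n%:R) * Num.sqrt v)^-1
  * expR (- ((k%:R - m * n%:R) ^+ 2 / (2 * v * n%:R))).

(* sqrt n * sup_{0 <= k <= n} |p k - q k|; the neutral element 0 is harmless
   since all the terms are nonnegative. *)
Definition llt_error (p q : nat -> R) n : R :=
  Num.sqrt n%:R * \big[Num.max/0]_(k < n.+1) `|p k - q k|.

Definition pmf1 t n (k : nat) : R :=
  (stirling1 n k)%:R * (t * n%:R) ^+ k / rising n (t * n%:R).
Definition pmf2 t n (k : nat) : R :=
  (stirling2 n k)%:R * (t * n%:R) ^+ k / touchard n (t * n%:R).
Definition pmf3 t n (k : nat) : R :=
  (stirling2 n k)%:R * (falling (t * n%:R) k / (t * n%:R) ^+ n).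

Definition error1 n t : R := llt_error (pmf1 t n) (gauss (mu1 t) (var1 t) n) n.
Definition error2 n t : R := llt_error (pmf2 t n) (gauss (mu2 t) (var2 t) n) n.
Definition error3 n t : R := llt_error (pmf3 t n) (gauss (mu3 t) (var3 t) n) n.

End LocalLimit.

(* Main.v *)
Require Import Defs.
From mathcomp Require Import all_boot all_order all_algebra.
From mathcomp Require Import all_classical all_reals all_analysis.
From mathcomp Require Import ring lra zify.
Set Implicit Arguments.
Unset Strict Implicit.
Unset Printing Implicit Defensive.
Import Order.TTheory GRing.Theory Num.Theory.
Import numFieldNormedType.Exports.
Local Open Scope classical_set_scope.
Local Open Scope ring_scope.

(* All three laws have the shape p(k) = B w(k) P(Y_1 + ... + Y_k = n), where the
   Y_i are independent with a fixed law on the positive integers (logarithmic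
   with parameter 1/(1+t) in the first case, zero-truncated Poisson with
   parameter W_0(1/t), resp. 1/t, in the other two) and w is an explicit weight
   with w(k+1)/w(k) = (m + b(m-k))/(k+1), b = 0 or b = exp(1/t) - 1.  The
   parameter is chosen so that m E(Y) = n.  No Fourier analysis is used: since
   E(Y_1 | sum = i) = i/k, a Taylor expansion of the law of the sum gives a
   discrete Stein equation with an error O(n^(-3/2)), provided the second
   differences of that law are O(n^(-3/2)), and these are small because Y has
   the Bernoulli component c(X + X^2).  Hence p(k+1) - p(k) = -((k-m)/V) p(k) +
   O(n^(-3/2)) for |k-m| = O(sqrt n), so that p(k) exp((k-m)^2/2V) is almost
   constant there; the constant is found by comparing the total mass with the
   Gaussian integral, the tails being controlled by the log-concavity of w. *)

(** * Smoothness of convolution powers *)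

(** The Stein equation shows that the law is a multiple of the Gaussian, up to an additive error of
    order [1/n]; the factor stays unknown. Dividing by the total mass is harmless only if that mass
    stays away from zero, so a central coefficient of order [n^(-1/2)] must be exhibited: Chebyshev
    and pigeonhole give a large coefficient of [Q^k] somewhere near n, and the Stein equation in the
    value of the sum, for fixed k, carries it to n itself. Everything is finite: the law of Y cut at
    n is a polynomial [Q], probabilities are coefficients of its powers, [1 - X] is the difference
    operator and [X d/dX] multiplication by the index. The order [n^(-3/2)] of second differences
    comes from cutting [Q^k] into three powers, each worth [n^(-1/2)]. The factor B is never
    evaluated, since each law is divided by its own sum. In the third family w is a generalised
    binomial weight [C(tn,k) (e^(1/t) - 1)^k], positive for all k up to n because [t >= 1]. Every
    constant depends on the data only through the bounds [c] and [C] of [regular], whence the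
    uniformity. *)

Section Domination.
Variable R : rcfType.
Implicit Types (p q r P Q : {poly R}) (a b c : R).

Definition nnegp p := forall i, 0 <= p`_i.

(** This bounds the l1 norm of the coefficients. The majorant [r] turns a sum of absolute values
    into the evaluation [r.[1]], so that sums and products reduce to [hornerD] and [hornerM]. *)
Definition l1le p a := exists2 r : {poly R}, (forall i, `|p`_i| <= r`_i) & r.[1] <= a.

Lemma horner1_coef p n : (size p <= n)%N -> p.[1] = \sum_(i < n) p`_i.
Proof.
move=> pn; rewrite (horner_coef_wide 1 pn).
by apply: eq_bigr => i _; rewrite expr1n mulr1.
Qed.

Lemma coef_le_horner1 p i : nnegp p -> p`_i <= p.[1].
Proof.
move=> p0; have [ip|ip] := ltnP i (size p); last first.
  rewrite nth_default // (@horner1_coef _ (size p)) //.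
  by rewrite sumr_ge0 // => j _; exact: p0.
rewrite (@horner1_coef _ (size p)) // (bigD1 (Ordinal ip)) //= lerDl.
by rewrite sumr_ge0 // => j _; exact: p0.
Qed.

Lemma nnegp_horner1 p : nnegp p -> 0 <= p.[1].
Proof. by move=> p0; apply: le_trans (p0 0%N) (coef_le_horner1 _ p0). Qed.

Lemma nnegpM p q : nnegp p -> nnegp q -> nnegp (p * q).
Proof. by move=> p0 q0 i; rewrite coefM sumr_ge0 // => j _; rewrite mulr_ge0. Qed.

Lemma nnegpX p n : nnegp p -> nnegp (p ^+ n).
Proof.
move=> p0; elim: n => [|n IH]; last by rewrite exprS; exact: nnegpM.
by move=> i; rewrite expr0 coef1 ler0n.
Qed.

Lemma l1le_nneg p a : nnegp p -> p.[1] <= a -> l1le p a.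
Proof. by move=> p0 pa; exists p => // i; rewrite ger0_norm. Qed.

Lemma l1le_trans p a b : l1le p a -> a <= b -> l1le p b.
Proof. by move=> [r pr ra] ab; exists r => //; exact: le_trans ab. Qed.

Lemma l1le_ge0 p a : l1le p a -> 0 <= a.
Proof.
move=> [r pr]; apply: le_trans; apply: nnegp_horner1 => i.
exact: le_trans (pr i).
Qed.

Lemma l1leD p q a b : l1le p a -> l1le q b -> l1le (p + q) (a + b).
Proof.
move=> [r pr ra] [r' qr rb]; exists (r + r'); last by rewrite hornerD lerD.
by move=> i; rewrite !coefD (le_trans (ler_normD _ _)) // lerD.
Qed.

Lemma l1leM p q a b : l1le p a -> l1le q b -> l1le (p * q) (a * b).
Proof.
move=> [r pr ra] [r' qr rb]; exists (r * r').
  move=> i; rewrite !coefM (le_trans (ler_norm_sum _ _ _)) //.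
  by apply: ler_sum => j _; rewrite normrM ler_pM.
rewrite hornerM ler_pM //; apply: nnegp_horner1 => i;
  exact: le_trans (normr_ge0 _) _.
Qed.

Lemma l1le_sum (I : Type) (s : seq I) (F : I -> {poly R}) (G : I -> R) :
  (forall i, l1le (F i) (G i)) -> l1le (\sum_(i <- s) F i) (\sum_(i <- s) G i).
Proof.
move=> FG; elim: s => [|i s IH]; last by rewrite !big_cons; exact: l1leD.
by rewrite !big_nil; exists 0; [move=> i; rewrite coef0 normr0|rewrite horner0].
Qed.

Lemma l1leC c : l1le c%:P `|c|.
Proof.
exists `|c|%:P; last by rewrite hornerC.
by move=> i; rewrite !coefC; case: eqP; rewrite ?normr0.
Qed.

Lemma l1leZ c p a : l1le p a -> l1le (c *: p) (`|c| * a).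
Proof. by rewrite -mul_polyC => pa; apply: l1leM pa; exact: l1leC. Qed.

Lemma l1leX p a n : l1le p a -> l1le (p ^+ n) (a ^+ n).
Proof.
move=> pa; elim: n => [|n IH]; last by rewrite !exprS; exact: l1leM.
by rewrite !expr0; have := l1leC 1; rewrite normr1.
Qed.

(** Young's inequality: convolution with an l1 sequence multiplies the sup norm by at most the l1
    norm. *)
Lemma l1le_coefM p q a b i : l1le p a -> (forall j, `|q`_j| <= b) ->
  `|(p * q)`_i| <= a * b.
Proof.
move=> [r pr ra] qb.
have r0 : nnegp r by move=> j; apply: le_trans (pr j).
have b0 : 0 <= b by apply: le_trans (qb 0%N).
rewrite coefM (le_trans (ler_norm_sum _ _ _)) //.
apply: (@le_trans _ _ (\sum_(j < i.+1) r`_j * b)).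
  by apply: ler_sum => j _; rewrite normrM ler_pM.
rewrite -mulr_suml ler_wpM2r // (le_trans _ ra) //.
rewrite (@horner1_coef r (maxn (size r) i.+1)) ?leq_maxl //.
rewrite -!(big_mkord xpredT (fun j => r`_j)).
rewrite (@big_cat_nat _ _ _ i.+1 0 (maxn (size r) i.+1)) ?leq_maxr //= lerDl.
by rewrite sumr_ge0.
Qed.

Lemma coef_partial_sum p i : p`_i = \sum_(j < i.+1) ((1 - 'X) * p)`_j.
Proof.
elim: i => [|i IH]; rewrite big_ord_recr /= ?big_ord0 -?IH;
  by rewrite mulrBl mul1r coefB coefXM /= ?subr0 ?add0r // addrC subrK.
Qed.

(** Multiplication by [1 - X] takes backward differences, so each coefficient is a partial sum of
    differences and the total variation dominates the sup norm. *)
Lemma l1le_diff_coef p a i : l1le ((1 - 'X) * p) a -> `|p`_i| <= a.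
Proof.
move=> [r pr ra].
have r0 : nnegp r by move=> j; apply: le_trans (pr j).
rewrite coef_partial_sum (le_trans (ler_norm_sum _ _ _)) //.
apply: (@le_trans _ _ (\sum_(j < i.+1) r`_j)); first exact: ler_sum.
rewrite (le_trans _ ra) //.
rewrite (@horner1_coef r (maxn (size r) i.+1)) ?leq_maxl //.
rewrite -!(big_mkord xpredT (fun j => r`_j)).
rewrite (@big_cat_nat _ _ _ i.+1 0 (maxn (size r) i.+1)) ?leq_maxr //= lerDl.
by rewrite sumr_ge0.
Qed.

Lemma coef_theta p i : ('X * p^`())`_i = i%:R * p`_i.
Proof.
rewrite coefXM; case: i => [|i] /=; first by rewrite mul0r.
by rewrite coef_deriv mulr_natl.
Qed.

(* AM-GM replaces Cauchy-Schwarz: |J - 2i| <= (sqrt J + (J - 2i)^2 / sqrt J) / 2,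
   and the last term sums to the variance of the binomial law. *)
Lemma l1le_diff_binomial j :
  l1le ((1 - 'X) * (1 + 'X) ^+ j) (2 ^+ j * (2 / Num.sqrt j.+1%:R)).
Proof.
set J : R := j.+1%:R; set s := Num.sqrt J.
have J0 : 0 < J by rewrite ltr0n.
have s0 : 0 < s by rewrite sqrtr_gt0.
have s2 : s ^+ 2 = J by rewrite sqr_sqrtr // ltW.
set P : {poly R} := (1 + 'X) ^+ j.+1.
have P0 : nnegp P.
  by apply: nnegpX => i; rewrite coefD coef1 coefX -natrD.
(* The operator [J - 2 X d/dX] multiplies the i-th coefficient by [J - 2i]. On [P = (1 + X)^J] it
   gives [J (1 - X) (1 + X)^j]; applied once more it gives the squares required by AM-GM, and
   [B.[1]] is J times the total mass [2^J]. *)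
pose A : {poly R} := J%:P * P - 'X * P^`() *+ 2.
pose B : {poly R} := J%:P * A - 'X * A^`() *+ 2.
have Ai i : A`_i = (J - 2 * i%:R) * P`_i.
  by rewrite coefB coefCM coefMn coef_theta; ring.
have Bi i : B`_i = (J - 2 * i%:R) ^+ 2 * P`_i.
  by rewrite coefB coefCM coefMn coef_theta Ai; ring.
have AE : A = J%:P * ((1 - 'X) * (1 + 'X) ^+ j).
  rewrite /A /P deriv_exp derivD derivC derivX add0r mul1r /= exprS.
  by rewrite /J polyC_natr; ring.
exists ((2 * J)^-1 *: (s *: P + s^-1 *: B)).
  move=> i; rewrite coefZ coefD !coefZ Bi.
  have -> : ((1 - 'X) * (1 + 'X) ^+ j) = J^-1 *: A.
    by rewrite AE mul_polyC scalerA mulVf ?scale1r // gt_eqF.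
  rewrite coefZ Ai !normrM (ger0_norm (P0 i)) ger0_norm ?invr_ge0 ?(ltW J0) //.
  set y := J - _; rewrite mulrA mulrDr.
  have -> : (2 * J)^-1 * (s * P`_i) + (2 * J)^-1 * (s^-1 * (y ^+ 2 * P`_i))
     = J^-1 * ((s + y ^+ 2 / s) / 2) * P`_i.
    by field; rewrite (gt_eqF s0) nat1r pnatr_eq0.
  rewrite ler_wpM2r // ler_wpM2l ?invr_ge0 ?(ltW J0) //.
  rewrite -subr_ge0 -(real_normK (num_real y)).
  have -> : (s + `|y| ^+ 2 / s) / 2 - `|y| = (s - `|y|) ^+ 2 / (2 * s).
    by field; rewrite gt_eqF.
  by rewrite divr_ge0 ?sqr_ge0 // mulr_ge0 // ltW.
rewrite hornerZ hornerD !hornerZ.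
have -> : P.[1] = 2 * 2 ^+ j by rewrite /P horner_exp hornerD hornerX hornerC exprS.
have -> : B.[1] = J * (2 * 2 ^+ j).
  rewrite /B AE derivM derivC mul0r add0r derivM derivB derivC derivX.
  by rewrite !hornerE /=; ring.
rewrite -s2 le_eqVlt; apply/orP; left; apply/eqP; field.
by rewrite gt_eqF.
Qed.

(** By absorption, [C(k,i)/(i+1) = C(k+1,i+1)/(k+1)], the left side is the expansion of
    [(p + q)^(k+1)] without its first term, divided by [p (k+1)]. *)
Lemma sum_binomial_inv (p q : R) k : 0 < p -> 0 <= q -> p + q = 1 ->
  \sum_(i < k.+1) ('C(k, i)%:R * q ^+ (k - i) * p ^+ i) / i.+1%:R
  <= (p * k.+1%:R)^-1.
Proof.
move=> p0 q0 pq.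
have -> : (p * k.+1%:R)^-1
   = (p * k.+1%:R)^-1 * \sum_(i < k.+2) q ^+ (k.+1 - i) * p ^+ i *+ 'C(k.+1, i).
  by rewrite -exprDn addrC pq expr1n mulr1.
rewrite [X in _ <= _ * X]big_ord_recl mulrDr ler_wpDl //.
  rewrite mulr_ge0 ?invr_ge0 ?mulr_ge0 ?ler0n ?mulrn_wge0 ?mulr_ge0 ?exprn_ge0 //;
  by rewrite ltW.
rewrite mulr_sumr ler_sum // => i _; rewrite lift0 subSS exprS.
rewrite le_eqVlt; apply/orP; left; apply/eqP.
rewrite -mulr_natl.
have : k.+1%:R * 'C(k, i)%:R = i.+1%:R * 'C(k.+1, i.+1)%:R :> R.
  by rewrite -!natrM mul_bin_diag.
move=> E; apply: (@mulfI _ (k.+1%:R * i.+1%:R)); first by rewrite -natrM pnatr_eq0.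
transitivity ((k.+1%:R * 'C(k, i)%:R) * q ^+ (k - i) * p ^+ i).
  by field; rewrite nat1r pnatr_eq0.
by rewrite E; field; rewrite nat1r pnatr_eq0 (gt_eqF p0).
Qed.

(** A bound affine in [1/(i+1)] reduces the binomial mean of [2/sqrt(i+1)] to [sum_binomial_inv]. *)
Lemma inv_sqrt_amgm (i k : nat) :
  2 / Num.sqrt i.+1%:R <= (Num.sqrt k.+1%:R)^-1 + Num.sqrt k.+1%:R / i.+1%:R :> R.
Proof.
have si : 0 < Num.sqrt i.+1%:R :> R by rewrite sqrtr_gt0.
have sk : 0 < Num.sqrt k.+1%:R :> R by rewrite sqrtr_gt0.
have : Num.sqrt i.+1%:R ^+ 2 = i.+1%:R :> R by rewrite sqr_sqrtr.
move: (Num.sqrt i.+1%:R) (Num.sqrt k.+1%:R) si sk => x y si sk <-.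
rewrite -subr_ge0.
have -> : y^-1 + y / x ^+ 2 - 2 / x = (x - y) ^+ 2 / (x ^+ 2 * y).
  by field; rewrite !gt_eqF.
by rewrite divr_ge0 ?sqr_ge0 // mulr_ge0 ?sqr_ge0 // ltW.
Qed.

(* Q contains the Bernoulli component c X (1 + X); expanding Q ^+ k as a
   mixture, the factor 1 - X acts on a binomial of random length. *)
Lemma l1le_diff_exp (c : R) Q k : 0 < c -> nnegp Q -> Q.[1] <= 1 ->
  c <= Q`_1 -> c <= Q`_2 ->
  l1le ((1 - 'X) * Q ^+ k) ((1 + (2 * c)^-1) / Num.sqrt k.+1%:R).
Proof.
move=> c0 Q0 Q1 cQ1 cQ2.
pose Y : {poly R} := c *: ('X * (1 + 'X)); pose Z := Q - Y.
have YE i : Y`_i = if (i == 1%N) || (i == 2) then c else 0.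
  rewrite /Y coefZ coefXM coefD coef1 coefX; case: i => [|[|[|i]]] //=;
  by rewrite ?mulr0 ?addr0 ?add0r ?mulr1 // mulr0.
have Z0 : nnegp Z.
  move=> i; rewrite coefB YE subr_ge0; case: ifP => [/orP[]/eqP->|_] //.
have Y1 : Y.[1] = 2 * c by rewrite !hornerE /=; ring.
have Zl : l1le Z (1 - 2 * c).
  by apply: l1le_nneg => //; rewrite hornerD hornerN Y1 lerD2r.
have q0 := l1le_ge0 Zl.
set q := 1 - 2 * c in Zl q0 *.
have p0 : 0 < 2 * c by rewrite mulr_gt0.
have -> : (1 - 'X) * Q ^+ k =
  \sum_(i < k.+1) ('C(k, i)%:R * c ^+ i) *:
     (Z ^+ (k - i) * 'X^i * ((1 - 'X) * (1 + 'X) ^+ i)).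
  rewrite -[Q](subrK Y) -/Z exprDn mulr_sumr; apply: eq_bigr => i _.
  by rewrite /Y exprZn exprMn -!mul_polyC polyCM polyC_natr; ring.
have Xl n : l1le ('X^n : {poly R}) 1.
  apply: l1le_nneg; last by rewrite hornerXn expr1n.
  by move=> j; rewrite coefXn ler0n.
apply: (@l1le_trans _ (\sum_(i < k.+1) `|'C(k, i)%:R * c ^+ i| *
   (q ^+ (k - i) * 1 * (2 ^+ i * (2 / Num.sqrt i.+1%:R))))).
  apply: l1le_sum => i; apply: l1leZ; apply: l1leM; last exact: l1le_diff_binomial.
  by apply: l1leM (Xl i); exact: l1leX.
set s := Num.sqrt k.+1%:R.
have s0 : 0 < s by rewrite sqrtr_gt0.
have s2 : s ^+ 2 = k.+1%:R by rewrite sqr_sqrtr.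
apply: (@le_trans _ _ (s^-1 * (\sum_(i < k.+1) 'C(k, i)%:R * q ^+ (k - i) * (2 * c) ^+ i)
  + s * (\sum_(i < k.+1) ('C(k, i)%:R * q ^+ (k - i) * (2 * c) ^+ i) / i.+1%:R))).
  rewrite !mulr_sumr -big_split ler_sum // => i _ /=.
  rewrite ger0_norm ?mulr_ge0 ?exprn_ge0 ?(ltW c0) //.
  set w := 'C(k, i)%:R * q ^+ (k - i) * (2 * c) ^+ i.
  have w0 : 0 <= w by rewrite !mulr_ge0 ?exprn_ge0 ?(ltW p0).
  apply: (@le_trans _ _ (w * (2 / Num.sqrt i.+1%:R))).
    by rewrite /w exprMn le_eqVlt; apply/orP; left; apply/eqP; ring.
  apply: (le_trans (ler_wpM2l w0 (inv_sqrt_amgm i k))).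
  by rewrite -/s le_eqVlt; apply/orP; left; apply/eqP; ring.
have -> : \sum_(i < k.+1) 'C(k, i)%:R * q ^+ (k - i) * (2 * c) ^+ i = 1.
  transitivity ((q + 2 * c) ^+ k); last by rewrite subrK expr1n.
  by rewrite exprDn; apply: eq_bigr => i _; rewrite -[RHS]mulr_natl mulrA.
apply: (@le_trans _ _ (s^-1 * 1 + s * (2 * c * k.+1%:R)^-1)).
  rewrite lerD2l ler_wpM2l ?(ltW s0) // sum_binomial_inv //.
  by rewrite addrC subrK.
rewrite -s2 le_eqVlt; apply/orP; left; apply/eqP; field.
by rewrite !gt_eqF.
Qed.

(** The exponent is cut as [k = k1 + k1 + k3] with all parts of order k. Each factor [1 - X] is
    absorbed by a part of its own at the price [b], and the last part pays [b] once more for the sup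
    norm. The 2 in [b] is the square root of the 4 in [k + 1 <= 4 (k1 + 1)]. *)
Lemma coef_diff_exp (c : R) Q (k i : nat) : 0 < c -> nnegp Q -> Q.[1] <= 1 ->
  c <= Q`_1 -> c <= Q`_2 ->
  let b := 2 * (1 + (2 * c)^-1) / Num.sqrt k.+1%:R in
  [/\ `|(Q ^+ k)`_i| <= b, `|((1 - 'X) * Q ^+ k)`_i| <= b ^+ 2 &
     `|((1 - 'X) ^+ 2 * Q ^+ k)`_i| <= b ^+ 3].
Proof.
move=> c0 Q0 Q1 cQ1 cQ2 b; set d := 1 + (2 * c)^-1.
have d0 : 0 < d by rewrite ltr_wpDr // invr_ge0 mulr_ge0 // ltW.
pose k1 := (k %/ 3)%N; pose k3 := (k - k1 - k1)%N.
have [h1 h3] : (k.+1 <= 4 * k1.+1)%N /\ (k.+1 <= 4 * k3.+1)%N.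
  rewrite /k3 /k1; have := divn_eq k 3; have := ltn_pmod k (isT : 0 < 3)%N; lia.
have kE : k = (k1 + (k1 + k3))%N by rewrite /k3 /k1; have := leq_divM k 3; lia.
have bnd j : (k.+1 <= 4 * j.+1)%N -> l1le ((1 - 'X) * Q ^+ j) b.
  move=> kj; apply: l1le_trans (l1le_diff_exp j c0 Q0 Q1 cQ1 cQ2) _.
  rewrite /b -/d [2 * d]mulrC -[d * 2 / _]mulrA ler_wpM2l ?(ltW d0) //.
  rewrite -[X in _ <= X]invrK lef_pV2 ?posrE ?invr_gt0 ?divr_gt0 ?sqrtr_gt0 //.
  rewrite invf_div ler_pdivrMr // -(@ler_pXn2r _ 2) ?nnegrE ?mulr_ge0 ?sqrtr_ge0 //.
  by rewrite exprMn !sqr_sqrtr // -natrX -natrM ler_nat mulnC.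
have Ql j : l1le (Q ^+ j) 1.
  by rewrite -(expr1n _ j); apply: l1leX; exact: l1le_nneg.
have b0 := l1le_ge0 (bnd _ h1).
have sup3 j : `|(Q ^+ k3)`_j| <= b by apply: l1le_diff_coef; exact: bnd.
have sup2 j : `|(Q ^+ k1 * Q ^+ k3)`_j| <= b.
  by rewrite -[b]mul1r; apply: l1le_coefM.
rewrite kE !exprD; split.
- by rewrite -[b]mul1r; apply: l1le_coefM.
- have -> : (1 - 'X) * (Q ^+ k1 * (Q ^+ k1 * Q ^+ k3)) =
    (1 - 'X) * Q ^+ k1 * (Q ^+ k1 * Q ^+ k3) by ring.
  by rewrite expr2; apply: l1le_coefM => //; exact: bnd.
- have -> : (1 - 'X) ^+ 2 * (Q ^+ k1 * (Q ^+ k1 * Q ^+ k3)) =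
    (1 - 'X) * Q ^+ k1 * ((1 - 'X) * Q ^+ k1 * Q ^+ k3) by ring.
  rewrite exprS expr2; apply: l1le_coefM; first exact: bnd.
  by move=> j; apply: l1le_coefM => //; exact: bnd.
Qed.

End Domination.

(** * The discrete Stein equation *)

Section Stein.
Variable R : rcfType.
Implicit Types (p P Q : {poly R}) (q : nat -> R).

Definition mom e q n : R := \sum_(j < n.+1) j%:R ^+ e * q j.

Lemma mom_ge0 e q n : (forall j, 0 <= q j) -> 0 <= mom e q n.
Proof. by move=> q0; rewrite sumr_ge0 // => j _; rewrite mulr_ge0 // exprn_ge0. Qed.

Lemma nnegp_poly q n : (forall j, 0 <= q j) -> nnegp (\poly_(j < n) q j).
Proof. by move=> q0 j; rewrite coef_poly; case: ifP. Qed.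

Lemma poly_horner1 q n : (\poly_(j < n.+1) q j).[1] = mom 0 q n.
Proof.
rewrite horner_poly /mom.
by apply: eq_bigr => j _; rewrite expr1n expr0 mulr1 mul1r.
Qed.

(** Taylor expansion at [X = 1]: passing from n to n + 1 turns the remainder [r] into [n + X r], and
    [n + n^2 <= (n + 1)^2]. *)
Lemma Xn_taylor1 n : exists2 r : {poly R}, l1le r (n%:R ^+ 2) &
  'X^n = 1 - n%:R *: (1 - 'X) + (1 - 'X) ^+ 2 * r.
Proof.
elim: n => [|n [r rn E]].
  exists 0; last by rewrite mulr0 scale0r subr0 addr0.
  by apply: l1le_nneg; [move=> i; rewrite coef0|rewrite horner0 expr0n].
exists (n%:R%:P + 'X * r).
  apply: (@l1le_trans _ _ (`|n%:R| + 1 * n%:R ^+ 2)).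
    apply: l1leD; first exact: l1leC.
    apply: l1leM rn; apply: l1le_nneg; last by rewrite hornerX.
    by move=> i; rewrite coefX ler0n.
  by rewrite ger0_norm // mul1r -natr1 sqrrD1; have := ler0n R n; lra.
by rewrite exprS E -natr1 -!mul_polyC polyCD; ring.
Qed.

Lemma poly_taylor1 q n : (forall j, 0 <= q j) ->
  exists2 r : {poly R}, l1le r (mom 2 q n) &
  \poly_(j < n.+1) q j = (mom 0 q n)%:P - (mom 1 q n)%:P * (1 - 'X) + (1 - 'X) ^+ 2 * r.
Proof.
move=> q0; rewrite poly_def /mom; elim: n.+1 => [|N [r rn E]].
  exists 0; rewrite !big_ord0 ?mulr0 ?mul0r ?subr0 ?addr0 //.
  by apply: l1le_nneg; [move=> i; rewrite coef0|rewrite horner0].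
have [r' rn' E'] := Xn_taylor1 N.
exists (r + q N *: r').
  rewrite big_ord_recr /=; apply: l1leD => //.
  by have := l1leZ (q N) rn'; rewrite ger0_norm // mulrC.
by rewrite !big_ord_recr /= E E' !(polyCD, polyCM) expr1 -!mul_polyC; ring.
Qed.

(** Adding one summand with law [q] expands in powers of the difference operator [1 - X] acting on
    [P]; only second differences of [P] enter the error. *)
Lemma stein_taylor q n P (d : R) i : (forall j, 0 <= q j) ->
  (forall j, `|((1 - 'X) ^+ 2 * P)`_j| <= d) ->
  `|(\poly_(j < n.+1) q j * P)`_i
    - (mom 0 q n * P`_i - mom 1 q n * ((1 - 'X) * P)`_i)| <= mom 2 q n * d.
Proof.
move=> q0 Pd; have [r rl ->] := poly_taylor1 n q0.
have -> : ((mom 0 q n)%:P - (mom 1 q n)%:P * (1 - 'X) + (1 - 'X) ^+ 2 * r) * P =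
  (mom 0 q n)%:P * P - (mom 1 q n)%:P * ((1 - 'X) * P) + r * ((1 - 'X) ^+ 2 * P).
  by ring.
rewrite coefD coefB !coefCM addrC addKr.
exact: l1le_coefM.
Qed.

Lemma theta_poly q n :
  'X * (\poly_(j < n) q j)^`() = \poly_(j < n) (j%:R * q j).
Proof.
apply/polyP => i; rewrite coef_theta !coef_poly.
by case: ifP => _ //; rewrite mulr0.
Qed.

Lemma mom_theta e q n : mom e (fun j => j%:R * q j) n = mom e.+1 q n.
Proof. by apply: eq_bigr => j _; rewrite exprSr mulrA. Qed.

(* Exchangeability: the mean of one of k+1 summands given their sum i is i/(k+1). *)
Lemma theta_exp Q k i :
  i%:R * (Q ^+ k.+1)`_i = k.+1%:R * ('X * Q^`() * Q ^+ k)`_i.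
Proof.
rewrite -coef_theta deriv_exp /= mulrnAr coefMn mulr_natl.
by rewrite mulrA.
Qed.

(** The size-biased weights [j q_j] shift every moment by one. This is a second expansion of the
    same coefficient of [Q^(k+1)]; comparing it with [stein_taylor] yields the Stein equation. *)
Lemma stein_taylor_theta q n k (d : R) i : (forall j, 0 <= q j) ->
  let Q := \poly_(j < n.+1) q j in
  (forall j, `|((1 - 'X) ^+ 2 * Q ^+ k)`_j| <= d) ->
  `|i%:R * (Q ^+ k.+1)`_i - k.+1%:R *
    (mom 1 q n * (Q ^+ k)`_i - mom 2 q n * ((1 - 'X) * Q ^+ k)`_i)|
  <= k.+1%:R * (mom 3 q n * d).
Proof.
move=> q0 Q Pd; rewrite theta_exp -mulrBr normrM ger0_norm // ler_wpM2l //.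
rewrite theta_poly -(mom_theta 2) -(mom_theta 1) -(mom_theta 0); apply: stein_taylor => // j.
by rewrite mulr_ge0.
Qed.

End Stein.

(** * Uniform big-O calculus *)

Section BigO.
(* f = O(z^e) uniformly on the domain D; below z is n^(-1/2) or n^(-1), and
   uniformity in the parameter t of the theorem comes from quantifying over all
   admissible data. *)
Variables (R : realFieldType) (T : Type) (D : T -> Prop) (z : T -> R).
Hypothesis z01 : forall t, D t -> 0 < z t <= 1.
Implicit Types (f g : T -> R) (e : int).

Definition OO e f := exists K, forall t, D t -> `|f t| <= K * z t ^ e.

Lemma OO_pos e f : OO e f ->
  exists2 K, 0 < K & forall t, D t -> `|f t| <= K * z t ^ e.
Proof.
move=> [K Kf]; exists (`|K| + 1); first by rewrite ltr_wpDl.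
move=> t Dt; apply: le_trans (Kf t Dt) _; have /andP[z0 _] := z01 Dt.
rewrite ler_wpM2r ?exprz_ge0 ?(ltW z0) //.
by rewrite (le_trans (ler_norm K)) // lerDl.
Qed.

Lemma zexp_le e e' t : D t -> e' <= e -> z t ^ e <= z t ^ e'.
Proof.
move=> /z01/andP[z0 z1] ee'; have u : z t != 0 by rewrite gt_eqF.
rewrite -(subrK e' e) expfzDr // ler_piMl ?exprz_ge0 ?(ltW z0) //.
rewrite -subr_ge0 in ee'; case: (e - e') ee' => // d _.
by rewrite exprn_ile1 // ltW.
Qed.

Lemma OO_le e e' f g : OO e f -> (forall t, D t -> `|g t| <= `|f t|) ->
  e' <= e -> OO e' g.
Proof.
move=> /OO_pos[K K0 Kf] gf ee'; exists K => t Dt.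
apply: le_trans (gf t Dt) _; apply: le_trans (Kf t Dt) _.
by rewrite ler_wpM2l ?zexp_le // ltW.
Qed.

Lemma OOw e e' f : OO e f -> e' <= e -> OO e' f.
Proof. by move=> fe; apply: OO_le fe _. Qed.

Lemma OO_eq e f g : OO e f -> (forall t, D t -> g t = f t) -> OO e g.
Proof. by move=> fe fg; apply: OO_le fe _ _ => // t Dt; rewrite fg. Qed.

Lemma OO_D e f g : OO e f -> OO e g -> OO e (fun t => f t + g t).
Proof.
move=> [K Kf] [L Lg]; exists (K + L) => t Dt.
by rewrite mulrDl (le_trans (ler_normD _ _)) // lerD ?Kf ?Lg.
Qed.

Lemma OO_N e f : OO e f -> OO e (fun t => - f t).
Proof. by move=> [K Kf]; exists K => t Dt; rewrite normrN Kf. Qed.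

Lemma OO_B e f g : OO e f -> OO e g -> OO e (fun t => f t - g t).
Proof. by move=> fe ge; apply: OO_D => //; exact: OO_N. Qed.

Lemma OO_M e1 e2 f g : OO e1 f -> OO e2 g -> OO (e1 + e2) (fun t => f t * g t).
Proof.
move=> [K Kf] [L Lg]; exists (K * L) => t Dt; have /andP[z0 _] := z01 Dt.
rewrite expfzDr ?gt_eqF // normrM mulrACA.
by rewrite ler_pM ?Kf ?Lg.
Qed.

Lemma OO_Mw e e1 e2 f g : OO e1 f -> OO e2 g -> e <= e1 + e2 ->
  OO e (fun t => f t * g t).
Proof. by move=> fe ge; apply: OOw; exact: OO_M. Qed.

Lemma OO_c (c : R) e : e <= 0 -> OO e (fun=> c).
Proof. by apply: OOw; exists `|c| => t _; rewrite expr0z mulr1. Qed.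

Lemma OO_z e : OO e (fun t => z t ^ e).
Proof.
exists 1 => t /z01/andP[z0 _]; rewrite mul1r ger0_norm // exprz_ge0 //.
exact: ltW.
Qed.

Lemma OO_inv (c : R) e f : 0 < c -> (forall t, D t -> c * z t ^ e <= f t) ->
  OO (- e) (fun t => (f t)^-1).
Proof.
move=> c0 cf; exists c^-1 => t Dt; have /andP[z0 _] := z01 Dt.
have cz : 0 < c * z t ^ e by rewrite mulr_gt0 ?exprz_gt0.
have f0 := lt_le_trans cz (cf t Dt).
rewrite gtr0_norm ?invr_gt0 // -invr_expz -invfM.
by rewrite lef_pV2 ?posrE ?cf.
Qed.

Lemma OO_bnd (K : R) e f : (forall t, D t -> `|f t| <= K * z t ^ e) -> OO e f.
Proof. by move=> fK; exists K. Qed.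

End BigO.

Lemma OO_sub (R : realFieldType) (T : Type) (D D' : T -> Prop) (z : T -> R) e f :
  OO D z e f -> (forall t, D' t -> D t) -> OO D' z e f.
Proof. by move=> [K Kf] DD; exists K => t /DD; exact: Kf. Qed.

Lemma OO_comp (R : realFieldType) (T T' : Type) (h : T' -> T) (D : T -> Prop)
  (D' : T' -> Prop) (z : T -> R) e f :
  OO D z e f -> (forall t, D' t -> D (h t)) ->
  OO D' (z \o h) e (f \o h).
Proof. by move=> [K Kf] DD; exists K => t /DD; exact: Kf. Qed.

(** * Regular data and estimates in the central window *)

Section Window.
Variable R : rcfType.

(* n, the law q of Y, its first two moments mu and nu, and the parameters m and b
   of the weight.  Only q_0, ..., q_n matter for the coefficient of X^n, so the
   moments dM of the truncated law are only close to those of q. *)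
Record lltdata := LLTData {
  dn : nat; dq : nat -> R; dmu : R; dnu : R; dm : R; db : R }.

Definition dQ p := \poly_(j < (dn p).+1) dq p j.
Definition dM p e := mom e (dq p) (dn p).
Definition dvar p := dnu p - dmu p ^+ 2.
Definition dz p : R := (Num.sqrt (dn p)%:R)^-1.

(** All later constants depend on [c] and [C] only. The mass defect is [O(n^-2)] so that powers of
    order n of the truncated law keep mass at least 1/2. The bound [1 + c <= mu] gives
    [m <= n/(1+c)], so that a window of width [sqrt n] around m stays below n for large n. *)
Record regular (c C : R) p : Prop := Regular {
  reg_n : (1 < dn p)%N;
  reg_q : forall j, 0 <= dq p j;
  reg_q0 : dq p 0 = 0;
  reg_q1 : c <= dq p 1;
  reg_q2 : c <= dq p 2;
  reg_M0_le1 : dM p 0 <= 1;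
  reg_M0 : `|dM p 0 - 1| <= C / (dn p)%:R ^+ 2;
  reg_M1 : `|dM p 1 - dmu p| <= C / (dn p)%:R;
  reg_M2 : `|dM p 2 - dnu p| <= C / (dn p)%:R;
  reg_M3 : dM p 3 <= C;
  reg_mu : 1 + c <= dmu p <= C;
  reg_nu : `|dnu p| <= C;
  reg_var : c <= dvar p;
  reg_m : dm p * dmu p = (dn p)%:R;
  reg_b : 0 <= db p <= C }.

Variables (c C : R).
Hypotheses (c0 : 0 < c).

Local Notation Reg := (regular c C).

Section Basic.
Variable p : lltdata.
Hypothesis rp : Reg p.

Lemma dn_gt0 : 0 < (dn p)%:R :> R. Proof. by rewrite ltr0n ltnW // (reg_n rp). Qed.

Lemma dz01 : 0 < dz p <= 1.
Proof.
rewrite /dz invr_gt0 sqrtr_gt0 dn_gt0 /= invf_le1 ?sqrtr_gt0 ?dn_gt0 //.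
by rewrite -[leLHS]sqrtr1 ler_sqrt ?(ltW dn_gt0) // ler1n ltnW // (reg_n rp).
Qed.

Lemma dz_gt0 : 0 < dz p. Proof. by case/andP: dz01. Qed.
Lemma dz_le1 : dz p <= 1. Proof. by case/andP: dz01. Qed.

Lemma dz2 : dz p ^ 2 = (dn p)%:R^-1.
Proof. by rewrite /dz -exprnP exprVn sqr_sqrtr // ltW // dn_gt0. Qed.

Lemma dnE : (dn p)%:R = dz p ^ (-2).
Proof. by rewrite -invr_expz dz2 invrK. Qed.

Lemma dmu_gt1 : 1 < dmu p.
Proof. by have /andP[h _] := reg_mu rp; apply: lt_le_trans h; rewrite ltrDl. Qed.

Lemma dmu_gt0 : 0 < dmu p. Proof. exact: lt_trans dmu_gt1. Qed.

Lemma dmE : dm p = (dn p)%:R / dmu p.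
Proof. by rewrite -(reg_m rp) mulfK // gt_eqF // dmu_gt0. Qed.

Lemma dm_gt0 : 0 < dm p. Proof. by rewrite dmE divr_gt0 ?dn_gt0 ?dmu_gt0. Qed.

Lemma C_gt1 : 1 < C.
Proof. by have /andP[_ h] := reg_mu rp; apply: lt_le_trans h; exact: dmu_gt1. Qed.

Lemma C_gt0 : 0 < C. Proof. exact: lt_trans C_gt1. Qed.

Lemma dm_ge : dz p ^ (-2) / C <= dm p.
Proof.
rewrite dmE -dnE ler_pM2l ?dn_gt0 // lef_pV2 ?posrE ?dmu_gt0 ?C_gt0 //.
by case/andP: (reg_mu rp).
Qed.

Lemma dm_le : dm p <= (dn p)%:R / (1 + c).
Proof.
rewrite dmE ler_pM2l ?dn_gt0 // lef_pV2 ?posrE ?dmu_gt0 //.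
  by case/andP: (reg_mu rp).
by rewrite addr_gt0.
Qed.

Lemma dm_len : dm p <= (dn p)%:R.
Proof.
apply: le_trans dm_le _; rewrite ler_pdivrMr ?addr_gt0 //.
by rewrite ler_peMr ?lerDl ?(ltW c0) ?(ltW dn_gt0).
Qed.

Lemma dQ_nneg : nnegp (dQ p). Proof. by apply: nnegp_poly; exact: reg_q rp. Qed.

Lemma dQ1 : (dQ p).[1] = dM p 0. Proof. exact: poly_horner1. Qed.

Lemma dM_ge0 e : 0 <= dM p e. Proof. by apply: mom_ge0; exact: reg_q rp. Qed.

Lemma dM_le e e' : (0 < e)%N -> (e <= e')%N -> dM p e <= dM p e'.
Proof.
move=> e0 ee; apply: ler_sum => j _; apply: ler_wpM2r; first exact: (reg_q rp).
case: (nat_of_ord j) => [|i]; first by rewrite !expr0n; case: e e' e0 ee => // ? [].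
by rewrite ler_weXn2l // ler1n.
Qed.

Lemma coef_dQ j : (dQ p)`_j = if (j < (dn p).+1)%N then dq p j else 0.
Proof. by rewrite coef_poly. Qed.

End Basic.

Record idx := Idx { ip : lltdata; ik : nat; ii : nat }.

Definition window (A : R) t :=
  [/\ Reg (ip t), `|(ik t)%:R - dm (ip t)| <= A / dz (ip t),
     `|(ii t)%:R - (dn (ip t))%:R| <= A / dz (ip t) & dm (ip t) <= 2 * (ik t).+1%:R].

Definition iz t := dz (ip t).
Definition ig t := (dQ (ip t) ^+ ik t)`_(ii t).
Definition inabla t := ((1 - 'X) * dQ (ip t) ^+ ik t)`_(ii t).
Definition inabla2 t j := ((1 - 'X) ^+ 2 * dQ (ip t) ^+ ik t)`_j.

(** Smoothness only requires k to be of order n. Separating this condition from [window] makes the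
    bounds available in the tails too. *)
Definition late t := Reg (ip t) /\ dm (ip t) <= 2 * (ik t).+1%:R.

Lemma late_smooth :
  exists2 K : R, 0 < K & forall t, late t ->
   [/\ `|ig t| <= K * iz t, `|inabla t| <= K * iz t ^ 2 &
     forall j, `|inabla2 t j| <= K * iz t ^ 3].
Proof.
have d0 : 0 <= 1 + (2 * c)^-1 by rewrite addr_ge0 // invr_ge0 mulr_ge0 // ltW.
(* From [n/C <= m <= 2(k+1)] follows [1/sqrt(k+1) <= sqrt(2C) z <= (1 + 2C) z]. The absolute value
   appears because [C > 0] is known only once a regular datum is given. *)
pose L := 2 * (1 + (2 * c)^-1) * (1 + 2 * `|C|).
have L0 : 0 <= L by rewrite !mulr_ge0 // addr_ge0 ?mulr_ge0.
exists (1 + L + L ^+ 2 + L ^+ 3).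
  by rewrite -addrA -addrA ltr_pwDl // addr_ge0 // addr_ge0 ?exprn_ge0.
case=> p k i [/= rp mk]; rewrite /ig /inabla /inabla2 /iz /=.
have z0 := dz_gt0 rp; have n2 := reg_n rp.
have [q1 q2] : c <= (dQ p)`_1 /\ c <= (dQ p)`_2.
  by rewrite !coef_dQ !ltnS n2 (ltnW n2) (reg_q1 rp) (reg_q2 rp).
have Q1 : (dQ p).[1] <= 1 by rewrite dQ1 (reg_M0_le1 rp).
have bz : 2 * (1 + (2 * c)^-1) / Num.sqrt k.+1%:R <= L * dz p.
  have -> : L * dz p = 2 * (1 + (2 * c)^-1) * ((1 + 2 * `|C|) * dz p).
    by rewrite /L mulrA.
  rewrite ler_wpM2l ?mulr_ge0 //.
  rewrite -[X in X <= _]mul1r ler_pdivrMr ?sqrtr_gt0 // -mulrA mulrC.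
  have C0 := C_gt0 rp.
  have h : dz p ^ (-2) <= 2 * C * k.+1%:R.
    have := le_trans (dm_ge rp) mk; rewrite ler_pdivrMr //.
    by move: (dz p ^ _) => y; lra.
  have u1 : 1 <= dz p ^+ 2 * (2 * C * k.+1%:R).
    have zz : dz p ^+ 2 != 0 by rewrite gt_eqF ?exprn_gt0.
    rewrite -[leLHS](mulfV zz).
    by rewrite ler_pM2l ?exprn_gt0.
  have v0 : 0 <= Num.sqrt k.+1%:R :> R by rewrite sqrtr_ge0.
  rewrite (ger0_norm (ltW C0)) -(@ler_pXn2r _ 2) ?nnegrE ?mulr_ge0 ?(ltW z0) //; last first.
    by rewrite addr_ge0 ?mulr_ge0 // ltW.
  rewrite expr1n !exprMn sqr_sqrtr //; apply: le_trans u1 _.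
  rewrite -[X in _ <= X]mulrA ler_wpM2l ?exprn_ge0 ?(ltW z0) // mulrC.
  rewrite ler_wpM2l //.
  have -> : (1 + 2 * C) ^+ 2 = 1 + 2 * (2 * C) + (2 * C) ^+ 2 by ring.
  by clear h; have := sqr_ge0 (2 * C); lra.
have b0 : 0 <= 2 * (1 + (2 * c)^-1) / Num.sqrt k.+1%:R :> R.
  by rewrite !mulr_ge0 // invr_ge0 sqrtr_ge0.
have pw e : (2 * (1 + (2 * c)^-1) / Num.sqrt k.+1%:R) ^+ e <= L ^+ e * dz p ^+ e.
  by rewrite -exprMn lerXn2r // nnegrE // mulr_ge0 // ltW.
have K e : (e <= 3)%N -> L ^+ e <= 1 + L + L ^+ 2 + L ^+ 3.
  have := exprn_ge0 2 L0; have := exprn_ge0 3 L0.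
  by case: e => [|[|[|[|]]]] // ? ? _; rewrite ?expr0 ?expr1; lra.
have fin e (x : R) : (e <= 3)%N -> `|x| <= (2 * (1 + (2 * c)^-1) / Num.sqrt k.+1%:R) ^+ e ->
    `|x| <= (1 + L + L ^+ 2 + L ^+ 3) * dz p ^+ e.
  move=> e3 h; apply: le_trans h _; apply: le_trans (pw e) _.
  by rewrite ler_wpM2r ?K // exprn_ge0 // ltW.
have S j := coef_diff_exp k j c0 (dQ_nneg rp) Q1 q1 q2.
split.
- by case: (S i) => h _ _; have := fin 1%N _ isT h; rewrite expr1.
- by case: (S i) => _ h _; rewrite -exprnP; exact: (fin 2%N).
- by move=> j; case: (S j) => _ _ h; rewrite -exprnP; exact: (fin 3%N).
Qed.

Variable A : R.

Local Notation O := (OO (window A) iz).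

Lemma iz01 t : window A t -> 0 < iz t <= 1.
Proof. by case=> rp _ _ _; exact: dz01. Qed.

Local Notation OM := (OO_Mw iz01).
Local Notation Ow := (OOw iz01).
Local Notation Oc := (OO_c iz01).

Lemma window_late t : window A t -> late t.
Proof. by case. Qed.

Lemma Ow_n : O (-2) (fun t => (dn (ip t))%:R).
Proof.
apply: (OO_bnd (K := 1)) => t [rp _ _ _].
by rewrite dnE mul1r ger0_norm // exprz_ge0 // ltW // dz_gt0.
Qed.

Lemma Ow_m : O (-2) (fun t => dm (ip t)).
Proof.
apply: (OO_le iz01 Ow_n) => // t [rp _ _ _].
by rewrite !ger0_norm ?(dm_len rp) // ltW ?dn_gt0 ?(dm_gt0 rp).
Qed.

Lemma Ow_km : O (-1) (fun t => (ik t)%:R - dm (ip t)).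
Proof. by apply: (OO_bnd (K := A)) => t []. Qed.

Lemma Ow_in : O (-1) (fun t => (ii t)%:R - (dn (ip t))%:R).
Proof. by apply: (OO_bnd (K := A)) => t []. Qed.

Lemma Ow_i : O (-2) (fun t => (ii t)%:R).
Proof.
apply: (OO_eq iz01 (OO_D (Ow Ow_in _) Ow_n)) => // t _.
by rewrite subrK.
Qed.

Lemma Ow_k : O (-2) (fun t => (ik t)%:R).
Proof.
apply: (OO_eq iz01 (OO_D (Ow Ow_km _) Ow_m)) => // t _.
by rewrite subrK.
Qed.

Lemma Ow_k1 : O (-2) (fun t => (ik t).+1%:R).
Proof.
apply: (OO_eq iz01 (OO_D Ow_k (Oc 1 _))) => // t _.
by rewrite natr1.
Qed.

Lemma Ow_M0 : O 4 (fun t => dM (ip t) 0 - 1).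
Proof.
apply: (OO_bnd (K := C)) => t [rp _ _ _].
apply: le_trans (reg_M0 rp) _; rewrite -exprVn -dz2 //.
by rewrite -exprnP -exprM.
Qed.

Lemma Ow_M1 : O 2 (fun t => dM (ip t) 1 - dmu (ip t)).
Proof.
apply: (OO_bnd (K := C)) => t [rp _ _ _].
by apply: le_trans (reg_M1 rp) _; rewrite -dz2.
Qed.

Lemma Ow_M2 : O 2 (fun t => dM (ip t) 2 - dnu (ip t)).
Proof.
apply: (OO_bnd (K := C)) => t [rp _ _ _].
by apply: le_trans (reg_M2 rp) _; rewrite -dz2.
Qed.

Lemma Ow_Mle3 e : (0 < e)%N -> (e <= 3)%N -> O 0 (fun t => dM (ip t) e).
Proof.
move=> e0 e3; apply: (OO_bnd (K := C)) => t [rp _ _ _].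
rewrite expr0z mulr1 ger0_norm ?dM_ge0 //.
exact: le_trans (dM_le rp e0 e3) (reg_M3 rp).
Qed.

Lemma Ow_mu : O 0 (fun t => dmu (ip t)).
Proof.
apply: (OO_bnd (K := C)) => t [rp _ _ _].
rewrite expr0z mulr1 ger0_norm ?(ltW (dmu_gt0 rp)) //.
by case/andP: (reg_mu rp).
Qed.

Lemma Ow_nu : O 0 (fun t => dnu (ip t)).
Proof.
apply: (OO_bnd (K := C)) => t [rp _ _ _].
by rewrite expr0z mulr1 (reg_nu rp).
Qed.

Lemma Ow_g : O 1 ig.
Proof.
have [K _ h] := late_smooth; apply: (OO_bnd (K := K)) => t /window_late/h[g _ _].
by rewrite expr1z.
Qed.

Lemma Ow_nabla : O 2 inabla.
Proof.
by have [K _ h] := late_smooth; exists K => t /window_late/h[].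
Qed.

Lemma Ow_T1 : O 3 (fun t => (dQ (ip t) ^+ (ik t).+1)`_(ii t)
  - (dM (ip t) 0 * ig t - dM (ip t) 1 * inabla t)).
Proof.
have [K K0 h] := late_smooth.
apply: (OO_eq iz01 (f := fun t => (dQ (ip t) * dQ (ip t) ^+ (ik t))`_(ii t)
  - (dM (ip t) 0 * ig t - dM (ip t) 1 * inabla t))); last by move=> t; rewrite exprS.
apply: (OO_bnd (K := C * K)) => t wt; have [rp _ _ _] := wt.
have [_ _ g2] := h _ (window_late wt).
apply: le_trans (stein_taylor (dn (ip t)) (ii t) (reg_q rp) g2) _.
rewrite -mulrA ler_wpM2r //; last first.
  exact: le_trans (dM_le rp _ _) (reg_M3 rp).
by apply: le_trans (g2 0%N).
Qed.

Lemma Ow_T2 : O 1 (fun t => (ii t)%:R * (dQ (ip t) ^+ (ik t).+1)`_(ii t)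
  - (ik t).+1%:R * (dM (ip t) 1 * ig t - dM (ip t) 2 * inabla t)).
Proof.
have [K K0 h] := late_smooth.
have b : O 3 (fun t => K * iz t ^ 3) by apply: OM (Oc K (lexx 0)) (OO_z iz01 3) _.
have a : O 1 (fun t => (ik t).+1%:R * (dM (ip t) 3 * (K * iz t ^ 3))).
  by apply: OM Ow_k1 (OO_M iz01 (Ow_Mle3 (isT : (0 < 3)%N) (leqnn 3)) b) _.
apply: (OO_le iz01 a) => // t wt.
have [rp _ _ _] := wt.
have [_ _ g2] := h _ (window_late wt).
have b' := @stein_taylor_theta _ _ (dn (ip t)) _ _ (ii t) (reg_q rp) g2.
apply: le_trans b' _; exact: ler_norm.
Qed.

(* Eliminating the common term from the two Taylor expansions gives the
   discrete Stein equation of the normal law. *)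
Lemma window_stein :
  O 1 (fun t => dm (ip t) * dvar (ip t) * inabla t
                - ((ik t)%:R * dmu (ip t) - (ii t)%:R) * ig t).
Proof.
pose M e := fun t => dM (ip t) e.
pose mu t := dmu (ip t).
(* In the second expansion minus i times the first, the coefficient of [Q^(k+1)] cancels. [d1] and
   [d2] are the errors in the factors of [ig] and [inabla] when the truncated moments are replaced
   by 1, [mu], [nu], and k+1 and i by their central values where required. *)
have d1 : O 0 (fun t => (ik t).+1%:R * (M 1%N t - mu t) + mu t + (ii t)%:R * (1 - M 0%N t)).
  apply: OO_D; first apply: OO_D Ow_mu; first exact: OM Ow_k1 Ow_M1 _.
  apply: OM Ow_i (OO_eq iz01 (OO_N Ow_M0) _) _ => // t _.
  by rewrite opprB.
have d2 : O (-1) (fun t => (ik t).+1%:R * (M 2%N t - dnu (ip t))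
   + ((ik t)%:R - dm (ip t) + 1) * dnu (ip t) - (ii t)%:R * (M 1%N t - mu t)
   - ((ii t)%:R - (dn (ip t))%:R) * mu t).
  apply: OO_B; last by apply: OM Ow_in Ow_mu _.
  apply: OO_B; last by apply: OM Ow_i Ow_M1 _.
  apply: OO_D; first by apply: OM Ow_k1 Ow_M2 _.
  by apply: OM (OO_D Ow_km (Oc 1 _)) Ow_nu _.
have t1 : O 1 (fun t => (ii t)%:R * ((dQ (ip t) ^+ (ik t).+1)`_(ii t)
  - (dM (ip t) 0 * ig t - dM (ip t) 1 * inabla t))) by apply: OM Ow_i Ow_T1 _.
apply: (OO_eq iz01 (OO_B (OO_D (OO_B Ow_T2 t1) (OM d1 Ow_g _)) (OM d2 Ow_nabla _))) => // t wt.
have [rp _ _ _] := wt.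
have E : dm (ip t) * dmu (ip t) = (dn (ip t))%:R := reg_m rp.
rewrite /M /mu -E /dvar -natr1; ring.
Qed.

(** The first expansion with limiting moments: it describes the passage from k to k+1 summands, and
    [window_stein] then expresses [inabla] through [ig]. *)
Lemma window_step :
  O 3 (fun t => (dQ (ip t) ^+ (ik t).+1)`_(ii t) - ig t + dmu (ip t) * inabla t).
Proof.
have a : O 3 (fun t => (dM (ip t) 0 - 1) * ig t) by apply: OM Ow_M0 Ow_g _.
have b : O 3 (fun t => (dM (ip t) 1 - dmu (ip t)) * inabla t) by apply: OM Ow_M1 Ow_nabla _.
by apply: (OO_eq iz01 (OO_B (OO_D Ow_T1 a) b)) => t _; ring.
Qed.

End Window.

(** * Transport along the Stein equation *)

Section Transport.
Variable R : realType.

Lemma expR_taylor1 (h : R) : `|expR h - 1 - h| <= h ^+ 2 * expR `|h|.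
Proof.
have e1 := expR_ge1Dx h; have e2 := expR_ge1Dx (- h).
have e0 := expR_gt0 h.
have e3 : expR h - 1 <= h * expR h.
  have : expR h * (1 - h) <= expR h * expR (- h) by rewrite ler_pM2l.
  by rewrite expRxMexpNx_1; lra.
rewrite ger0_norm; last by lra.
have [h0|h0] := leP 0 h.
  rewrite ger0_norm // expr2 -mulrA.
  apply: (@le_trans _ _ (h * (expR h - 1))); last by rewrite ler_wpM2l.
  by lra.
apply: (@le_trans _ _ (h * (expR h - 1))); first by lra.
have g1 : 1 <= expR `|h| by rewrite -expR0 ler_expR.
apply: (@le_trans _ _ (h ^+ 2)); last by rewrite ler_peMr ?sqr_ge0.
by nra.
Qed.

(** One step of the recursion as a single object, so that [OO] quantifies over all sequences,
    centres and variances at once. *)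
Record tdat := TDat { tz : R; tc : R; tV : R; ta : nat -> R; tk : nat }.

Section Step.
Variables A C v : R.
Hypothesis v0 : 0 < v.

Definition tdom t := [/\ 0 < tz t <= 1, v * tz t ^ (-2) <= tV t,
  `|(tk t)%:R - tc t| <= A / tz t, `|ta t (tk t)| <= C * tz t &
  `|ta t (tk t).+1 - ta t (tk t) * (1 - ((tk t)%:R - tc t) / tV t)| <= C * tz t ^ 3].

Lemma tdom01 t : tdom t -> 0 < tz t <= 1. Proof. by case. Qed.

Definition tE t k := expR ((k%:R - tc t) ^+ 2 / (2 * tV t)).

Lemma tV_gt0 t : tdom t -> 0 < tV t.
Proof.
by move=> [/andP[z0 _] h _ _ _]; apply: lt_le_trans h; rewrite mulr_gt0 ?exprz_gt0.
Qed.

Local Notation O := (OO tdom tz).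
Local Notation OM := (OO_Mw tdom01).
Local Notation Ow := (OOw tdom01).
Local Notation Oc := (OO_c tdom01).

Lemma OO_expR (f : tdat -> R) : O 0 f -> O 0 (fun t => expR (f t)).
Proof.
move=> [K Kf]; apply: (OO_bnd (K := expR K)) => t Dt.
rewrite expr0z mulr1 gtr0_norm ?expR_gt0 // ler_expR (le_trans (ler_norm _)) //.
by apply: le_trans (Kf _ Dt) _; rewrite expr0z mulr1.
Qed.

(** With [y = (k - c)/V], the exponent grows by [h = y + 1/(2V)] when k increases by one. Since
    [(1 - y) exp h = 1 + O(z^2)] and the sequence itself is [O(z)], the product changes by
    [O(z^3)]. *)
Lemma transport_step :
  O 3 (fun t => ta t (tk t).+1 * tE t (tk t).+1 - ta t (tk t) * tE t (tk t)).
Proof.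
pose d t := (tk t)%:R - tc t.
have od : O (-1) d by apply: (OO_bnd (K := A)) => t [].
have oV : O 2 (fun t => (tV t)^-1).
  by apply: (OO_inv tdom01 (e := -2) v0) => t [].
pose y t := d t / tV t.
have oy : O 1 y by apply: OM od oV _.
pose w t := (2 * tV t)^-1.
have ow : O 2 w.
  apply: (OO_eq tdom01 (OM (e := 2) (Oc 2^-1 (lexx 0)) oV _)) => // t _.
  by rewrite /w invfM.
pose h t := y t + w t.
have oh : O 1 h by apply: OO_D => //; apply: Ow ow _.
have oE : O 0 (fun t => tE t (tk t)).
  apply: OO_expR.
  apply: (OO_eq tdom01 (OM (e := 0) (OO_M tdom01 od od) ow _)) => //.
have oEh : O 0 (fun t => expR (h t)) by apply: OO_expR; apply: Ow oh _.
have oEah : O 0 (fun t => expR `|h t|).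
  apply: OO_expR; apply: Ow (_ : O 1 _) _ => //.
  by apply: (OO_le tdom01 oh) => // t _; rewrite normr_id.
have orr : O 2 (fun t => expR (h t) - 1 - h t).
  apply: (OO_le tdom01 (OM (e := 2) (OO_M tdom01 oh oh) oEah _)) => // t _.
  by apply: le_trans (expR_taylor1 _) _; rewrite -expr2 ler_norm.
have ob : O 2 (fun t => (1 - y t) * expR (h t) - 1).
  have o1y : O 0 (fun t => 1 - y t) by apply: OO_B (Oc 1 _) (Ow oy _).
  have oyh : O 2 (fun t => y t * h t) by apply: OM oy oh _.
  apply: (OO_eq tdom01 (OO_D (OO_B ow oyh) (OM (e := 2) o1y orr _))) => // t _.
  by rewrite /h; ring.
have oa : O 1 (fun t => ta t (tk t)) by apply: (OO_bnd (K := C)) => t []; rewrite expr1z.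
have oa1 : O 3 (fun t => ta t (tk t).+1 - ta t (tk t) * (1 - y t)).
  by apply: (OO_bnd (K := C)) => t [].
have EE t : tdom t -> tE t (tk t).+1 = tE t (tk t) * expR (h t).
  move=> /tV_gt0 V0; rewrite /tE -expRD /h /y /w /d -natr1; congr expR.
  by field; rewrite gt_eqF.
apply: (OO_eq tdom01 (OO_D (OM (e := 3) (OO_M tdom01 oa1 oE) oEh _)
  (OM (e := 3) (OO_M tdom01 oa oE) ob _))) => // t /EE ->.
ring.
Qed.

End Step.

(** Two indices of the range are at most [2|A|/z] steps apart, and each step costs [K z^3]. The
    lemma serves twice: in the value of the sum for fixed k, and in k itself. *)
Lemma transport (A C v : R) : 0 < v -> exists2 K, 0 < K &
  forall (z c V : R) (a : nat -> R) (k1 k2 : nat), 0 < z <= 1 -> v * z ^ (-2) <= V ->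
  (forall k, (k1 <= k <= k2)%N -> `|k%:R - c| <= A / z /\ `|a k| <= C * z) ->
  (forall k, (k1 <= k < k2)%N -> `|a k.+1 - a k * (1 - (k%:R - c) / V)| <= C * z ^ 3) ->
  forall k k', (k1 <= k <= k2)%N -> (k1 <= k' <= k2)%N ->
  `|a k * expR ((k%:R - c) ^+ 2 / (2 * V)) - a k' * expR ((k'%:R - c) ^+ 2 / (2 * V))|
     <= K * z ^ 2.
Proof.
move=> v0; have [K K0 step] := OO_pos (@tdom01 A C v) (transport_step A C v0).
exists (K * (2 * `|A| + 1)); first by rewrite mulr_gt0 // ltr_wpDl // mulr_ge0.
move=> z c V a k1 k2 z01 Vz H1 H2.
pose e k := a k * expR ((k%:R - c) ^+ 2 / (2 * V)).
have st k : (k1 <= k < k2)%N -> `|e k.+1 - e k| <= K * z ^ 3.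
  move=> /andP[ka kb].
  have [|h1 h2] := H1 k; first by rewrite ka ltnW.
  by apply: (step (TDat z c V a k)); split => //; apply: H2; rewrite ka kb.
have tele d k : (k1 <= k)%N -> (k + d <= k2)%N -> `|e (k + d)%N - e k| <= d%:R * (K * z ^ 3).
  move=> ka; elim: d => [|d IH] kd; first by rewrite addn0 subrr normr0 mul0r.
  rewrite addnS in kd *; rewrite -(subrK (e (k + d)%N) (e (k + d).+1)) -addrA.
  apply: le_trans (ler_normD _ _) _; rewrite -natr1 mulrDl mul1r [leRHS]addrC.
  apply: lerD; last by apply: IH; exact: ltnW.
  by apply: st; rewrite kd (leq_trans ka) // leq_addr.
have /andP[z0 z1] := z01.
have main k k' : (k1 <= k <= k2)%N -> (k1 <= k' <= k2)%N -> (k <= k')%N ->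
    `|e k' - e k| <= K * (2 * `|A| + 1) * z ^ 2.
  move=> hk hk' kk'; rewrite -(subnKC kk').
  have /andP[ka kb] := hk; have /andP[_ kb'] := hk'.
  apply: le_trans (tele _ _ ka _) _; first by rewrite subnKC.
  have [h1 _] := H1 _ hk; have [h1' _] := H1 _ hk'.
  have dd : (k' - k)%:R <= 2 * `|A| / z.
    rewrite natrB //; have := ler_norm A; rewrite -(@ler_pM2r _ z^-1) ?invr_gt0 //.
    move: h1 h1'; rewrite !ler_norml => /andP[h _] /andP[_ h'] hA.
    by rewrite -mulrA; move: (A / z) (`|A| / z) h h' hA; clear => x y; lra.
  apply: le_trans (ler_wpM2r _ dd) _.
    by rewrite mulr_ge0 ?exprz_ge0 // ltW.
  rewrite -!exprnP.
  have -> : 2 * `|A| / z * (K * z ^+ 3) = K * (2 * `|A|) * z ^+ 2.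
    by field; rewrite gt_eqF.
  rewrite ler_wpM2r ?exprn_ge0 ?(ltW z0) // ler_wpM2l ?(ltW K0) //.
  by rewrite lerDl.
move=> k k' hk hk'; rewrite -/(e k) -/(e k').
by case/orP: (leq_total k k') => kk'; [rewrite distrC|]; apply: main.
Qed.

End Transport.

(** * A lower bound for the central coefficient *)

Section SecondMoment.
Variable R : rcfType.

Lemma poly_theta1 (q : nat -> R) n :
  ('X * (\poly_(j < n.+1) q j)^`()).[1] = mom 1 q n.
Proof. by rewrite theta_poly poly_horner1 mom_theta. Qed.

Lemma poly_theta2 (q : nat -> R) n :
  ('X * ('X * (\poly_(j < n.+1) q j)^`())^`()).[1] = mom 2 q n.
Proof. by rewrite theta_poly poly_theta1 mom_theta. Qed.

(** The operator [X d/dX - x], applied twice and evaluated at 1, produces the left side. The right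
    side is variance plus squared bias, unnormalised because the mass [mom 0] may be below 1; two
    derivatives consume two factors, hence the exponent [k.+2]. *)
Lemma second_moment_exp (q : nat -> R) n k (x : R) :
  let P := (\poly_(j < n.+1) q j) ^+ k.+2 in
  \sum_(i < size P) (i%:R - x) ^+ 2 * P`_i =
  mom 0 q n ^+ k * (k.+2%:R * (mom 0 q n * mom 2 q n - mom 1 q n ^+ 2)
                   + (k.+2%:R * mom 1 q n - x * mom 0 q n) ^+ 2).
Proof.
set Q := \poly_(j < n.+1) q j => P.
pose theta (p : {poly R}) := 'X * p^`().
pose F := theta (theta P - x%:P * P) - x%:P * (theta P - x%:P * P).
have Fi i : F`_i = (i%:R - x) ^+ 2 * P`_i.
  by rewrite !(coefB, coefCM, coef_theta); ring.
transitivity F.[1].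
  rewrite (@horner1_coef _ F (size P)); first by apply: eq_bigr => i _; rewrite Fi.
  by apply/leq_sizeP => j Pj; rewrite Fi nth_default // mulr0.
have e0 : Q.[1] = mom 0 q n by exact: poly_horner1.
have e1 := poly_theta1 q n; have e2 := poly_theta2 q n.
rewrite -/Q in e1 e2.
have thM p r : theta (p * r) = theta p * r + p * theta r.
  by rewrite /theta derivM; ring.
have thC a p : theta (a%:P * p) = a%:P * theta p.
  by rewrite thM /theta derivC mulr0 mul0r add0r.
have thB p r : theta (p - r) = theta p - theta r by rewrite /theta derivB mulrBr.
have thX l : theta (Q ^+ l.+1) = l.+1%:R%:P * (theta Q * Q ^+ l).
  by rewrite /theta deriv_exp /= -mulr_natl polyC_natr; ring.
rewrite -/(theta Q) -/(theta (theta Q)) in e1 e2.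
rewrite /F /P; move: theta thM thC thB thX e1 e2 {F Fi} => th thM thC thB thX e1 e2.
have eW : (Q ^+ k).[1] = mom 0 q n ^+ k by rewrite horner_exp e0.
have := thX k; have := thX k.+1; rewrite !exprS.
move: (Q ^+ k) eW => W eW t2 t1.
rewrite t2 thB !thC t2 (thM (th Q)) t1.
rewrite !(hornerD, hornerN, hornerM, hornerC) e0 e1 e2 eW -!natr1.
by ring.
Qed.

Lemma bernoulli_pow (x : R) k : 0 <= x <= 1 -> 1 - k%:R * (1 - x) <= x ^+ k.
Proof.
move=> /andP[x0 x1]; elim: k => [|k IH]; first by rewrite mul0r subr0 expr0.
rewrite exprS -natr1; apply: le_trans (ler_wpM2l x0 IH).
rewrite -subr_ge0.
have -> : x * (1 - k%:R * (1 - x)) - (1 - (k%:R + 1) * (1 - x)) = k%:R * (1 - x) ^+ 2.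
  by ring.
by rewrite mulr_ge0 // sqr_ge0.
Qed.

Lemma sum_nat_interval N (a b : nat) : (\sum_(i < N) (a <= i < b) <= b - a)%N.
Proof.
suff -> : (\sum_(i < N) (a <= i < b) = minn N b - minn N a)%N by lia.
by elim: N => [|N IH]; rewrite ?big_ord0 ?big_ord_recr /= ?IH; lia.
Qed.

End SecondMoment.

Section LowerBound.
Variable R : realType.

Lemma dz_small (e : R) : 0 < e ->
  exists N, forall p : lltdata R, (N <= dn p)%N -> dz p <= e.
Proof.
move=> e0; exists (Num.truncn (e ^- 2)).+1 => p Np.
have h : e ^- 2 <= (dn p)%:R.
  apply: le_trans (ltW (truncnS_gt _)) _; by rewrite ler_nat.
have d0 : 0 < Num.sqrt (dn p)%:R :> R by rewrite sqrtr_gt0 ltr0n (leq_trans _ Np).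
rewrite /dz -[leRHS]invrK lef_pV2 ?posrE ?invr_gt0 //.
rewrite -(@ler_pXn2r _ 2) ?nnegrE ?(ltW d0) ?invr_ge0 ?(ltW e0) //.
by rewrite sqr_sqrtr ?ler0n // exprVn.
Qed.

Variables c C : R.
Hypothesis c0 : 0 < c.
Local Notation Reg := (regular c C).

(** Because [m mu = n], the bias [(k+2) M1 - n M0] stays bounded for k+2 within 1 of m, while the
    variance term is at most of order n. *)
Lemma chebyshev_bound : exists2 K : R, 0 < K & forall p k, Reg p ->
  `|k.+2%:R - dm p| <= 1 ->
  \sum_(i < size (dQ p ^+ k.+2)) (i%:R - (dn p)%:R) ^+ 2 * (dQ p ^+ k.+2)`_i
    <= K * (dn p)%:R.
Proof.
exists (2 * `|C| + (4 * `|C|) ^+ 2 + 1).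
  by rewrite ltr_wpDl // addr_ge0 ?mulr_ge0 // exprn_ge0 ?mulr_ge0.
move=> p k rp km; rewrite /dQ second_moment_exp -!/(dM p _).
have C0 := C_gt0 c0 rp; rewrite (gtr0_norm C0).
have n1 : 1 < (dn p)%:R :> R by rewrite ltr1n (reg_n rp).
have n0 : 0 < (dn p)%:R :> R by apply: lt_trans n1.
set n : R := (dn p)%:R in n0 n1 *.
have M0 := dM_ge0 rp 0; have M0' := reg_M0_le1 rp.
have mn : dm p <= n := dm_len c0 rp.
set K1 : R := k.+2%:R in km *.
have K10 : 0 <= K1 by rewrite ler0n.
have K1n : K1 <= 2 * n by move: km; rewrite ler_norml => /andP[_ h]; lra.
have M2C : dM p 2 <= C by exact: le_trans (dM_le rp _ _) (reg_M3 rp).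
have M20 := dM_ge0 rp 2.
have t1 : K1 * (dM p 0 * dM p 2 - dM p 1 ^+ 2) <= 2 * n * C.
  have h : dM p 0 * dM p 2 - dM p 1 ^+ 2 <= C.
    apply: (@le_trans _ _ (dM p 0 * dM p 2)); first by rewrite gerBl sqr_ge0.
    by apply: le_trans M2C; rewrite ler_piMl.
  apply: (@le_trans _ _ (K1 * C)); first by rewrite ler_wpM2l.
  by rewrite ler_wpM2r // ltW.
have t2 : `|K1 * dM p 1 - n * dM p 0| <= 4 * C.
  have -> : K1 * dM p 1 - n * dM p 0 =
     K1 * (dM p 1 - dmu p) + (K1 - dm p) * dmu p - n * (dM p 0 - 1).
    by rewrite /n -(reg_m rp); ring.
  have a1 : `|K1 * (dM p 1 - dmu p)| <= 2 * C.
    rewrite normrM (ger0_norm K10).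
    apply: (@le_trans _ _ (2 * n * (C / n))); first by rewrite ler_pM // (reg_M1 rp).
    by rewrite le_eqVlt; apply/orP; left; apply/eqP; field; rewrite gt_eqF.
  have a2 : `|(K1 - dm p) * dmu p| <= C.
    have /andP[_ muC] := reg_mu rp.
    rewrite normrM -[leRHS]mul1r ler_pM // ger0_norm //.
    exact: ltW (dmu_gt0 c0 rp).
  have a3 : `|n * (dM p 0 - 1)| <= C.
    rewrite normrM (gtr0_norm n0).
    apply: (@le_trans _ _ (n * (C / n ^+ 2))).
      by rewrite ler_wpM2l ?(ltW n0) // (reg_M0 rp).
    have -> : n * (C / n ^+ 2) = C / n by field; rewrite gt_eqF.
    by rewrite ler_pdivrMr // ler_peMr ?(ltW C0) ?(ltW n1).
  apply: le_trans (ler_normB _ _) _; have := ler_normD (K1 * (dM p 1 - dmu p)) ((K1 - dm p) * dmu p).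
  lra.
have t3 : (K1 * dM p 1 - n * dM p 0) ^+ 2 <= (4 * C) ^+ 2.
  by rewrite -(real_normK (num_real (_ - _))) lerXn2r // nnegrE // mulr_ge0 // ltW.
set B := (2 * C + (4 * C) ^+ 2 + 1) * n.
have B0 : 0 <= B by rewrite mulr_ge0 ?(ltW n0) // !addr_ge0 ?exprn_ge0 ?mulr_ge0 ?(ltW C0).
apply: (@le_trans _ _ (dM p 0 ^+ k * B)); last by rewrite ler_piMl // exprn_ile1.
rewrite ler_wpM2l ?exprn_ge0 //; apply: (le_trans (lerD t1 t3)).
have e2 := sqr_ge0 (4 * C); have : (4 * C) ^+ 2 <= (4 * C) ^+ 2 * n by rewrite ler_peMr // ltW.
by rewrite /B; move: ((4 * C) ^+ 2) e2 => x x0; lra.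
Qed.

End LowerBound.

Section LowerBound.
Variable R : realType.
Variables c C : R.
Hypothesis c0 : 0 < c.
Local Notation Reg := (regular c C).

Lemma mass_lower : exists N, forall p k, Reg p -> (N <= dn p)%N ->
  `|k%:R - dm p| <= 1 -> 1 / 2 <= (dQ p ^+ k).[1].
Proof.
exists (Num.truncn (4 * C)).+1 => p k rp Np km.
have C0 := C_gt0 c0 rp.
rewrite horner_exp dQ1.
have n1 : 1 < (dn p)%:R :> R by rewrite ltr1n (reg_n rp).
have n0 : 0 < (dn p)%:R :> R by apply: lt_trans n1.
have M0 := dM_ge0 rp 0; have M0' := reg_M0_le1 rp.
apply: le_trans (bernoulli_pow k (_ : 0 <= dM p 0 <= 1)); last by rewrite M0 M0'.
have h : 1 - dM p 0 <= C / (dn p)%:R ^+ 2.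
  by apply: le_trans (reg_M0 rp); rewrite distrC ler_norm.
have mn : dm p <= (dn p)%:R := dm_len c0 rp.
have kn : k%:R <= 2 * (dn p)%:R :> R by move: km; rewrite ler_norml => /andP[_ ?]; lra.
have n4 : 4 * C <= (dn p)%:R.
  by apply: le_trans (ltW (truncnS_gt _)) _; rewrite ler_nat.
have : k%:R * (1 - dM p 0) <= 2 * (dn p)%:R * (C / (dn p)%:R ^+ 2).
  by rewrite ler_pM // subr_ge0.
have -> : 2 * (dn p)%:R * (C / (dn p)%:R ^+ 2) = 4 * C / (dn p)%:R / 2.
  by field; rewrite gt_eqF.
have : 4 * C / (dn p)%:R <= 1 by rewrite ler_pdivrMr // mul1r.
by move: (4 * C / _) (k%:R * _) => x y; clear; lra.
Qed.

(** Chebyshev and pigeonhole. With [A = 8K + 1] the mass outside the window is at most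
    [K/A^2 <= 1/8]; if the at most [3A/z] coefficients inside were all below [z/(32A)], the total
    would be at most [3/32 + 1/8], less than the mass 1/2 of [mass_lower]. *)
Lemma large_coef : exists2 A : R, 1 <= A & exists N,
  forall p k, Reg p -> (N <= dn p)%N -> `|k.+2%:R - dm p| <= 1 ->
  exists2 i : nat, `|i%:R - (dn p)%:R| <= A / dz p &
     (32 * A)^-1 * dz p <= (dQ p ^+ k.+2)`_i.
Proof.
have [K K0 cheb] := chebyshev_bound C c0; have [N mass] := mass_lower.
exists (8 * K + 1); first by rewrite lerDr mulr_ge0 // ltW.
set A := 8 * K + 1; have A1 : 1 <= A by rewrite lerDr mulr_ge0 // ltW.
have A0 : 0 < A by apply: lt_le_trans A1.
exists N => p k rp Np km.
have {cheb} := cheb p k rp km; have {mass} := mass p k.+2 rp Np km.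
set P := dQ p ^+ k.+2; set n := dn p; set z := dz p => mass cheb.
have z0 : 0 < z := dz_gt0 rp; have z1 : z <= 1 := dz_le1 rp.
have n0 : 0 < n%:R :> R := dn_gt0 rp.
have nz : n%:R * z ^+ 2 = 1.
  by rewrite /z exprnP dz2 mulfV // gt_eqF.
have P0 : nnegp P by apply: nnegpX; exact: dQ_nneg rp.
apply: contrapT => nex.
pose L := Num.truncn (A / z).
have Az0 : 0 <= A / z by rewrite divr_ge0 // ltW.
have LA : L%:R <= A / z by rewrite truncn_le.
have AL : A / z < L.+1%:R by rewrite truncnS_gt.
have small i : (n - L <= i < (n + L).+1)%N -> P`_i <= (32 * A)^-1 * z.
  move=> /andP[ia ib]; rewrite leNgt; apply/negP => Pi.
  apply: nex; exists i; last exact: ltW.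
  apply: le_trans LA; rewrite ler_norml.
  have : n%:R <= i%:R + L%:R :> R by rewrite -natrD ler_nat; move: ia ib; clear; move: n L => n' L'; lia.
  have : i%:R <= n%:R + L%:R :> R by rewrite -natrD ler_nat; move: ia ib; clear; move: n L => n' L'; lia.
  by move: (L%:R : R) (n%:R : R) (i%:R : R) => x y w; clear; lra.
(* One majorant for both cases: inside the window the coefficient is small, outside it the factor
   [((i - n) z/A)^2] is at least 1. *)
have key i : P`_i <= (32 * A)^-1 * z * (n - L <= i < (n + L).+1)%N%:R
     + (z / A) ^+ 2 * ((i%:R - n%:R) ^+ 2 * P`_i).
  have [hi|hi] := boolP (n - L <= i < (n + L).+1)%N.
    rewrite mulr1 ler_wpDr ?small //.
    by rewrite mulr_ge0 ?sqr_ge0 // mulr_ge0 ?sqr_ge0.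
  rewrite mulr0 add0r mulrA ler_peMl //.
  have h : A / z <= `|i%:R - n%:R|.
    apply: (le_trans (ltW AL)).
    have : (L.+1 <= i - n \/ L.+1 <= n - i)%N by move: hi; rewrite negb_and; clear; move: n L => n' L'; lia.
    case=> hL.
      apply: le_trans (ler_norm _); rewrite -natrB ?ler_nat //.
      by move: hL; clear; move: n L => n' L'; lia.
    rewrite distrC; apply: le_trans (ler_norm _); rewrite -natrB ?ler_nat //.
    by move: hL; clear; move: n L => n' L'; lia.
  rewrite -exprMn -(real_normK (num_real (_ * _))) exprn_ege1 //.
  rewrite normrM [X in X * _]gtr0_norm ?divr_gt0 //.
  by rewrite mulrC -ler_pdivrMr ?divr_gt0 // mul1r invf_div.
have : P.[1] <= (32 * A)^-1 * z * (3 * A / z) + (z / A) ^+ 2 * (K * n%:R).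
  rewrite (@horner1_coef _ P (size P)) //.
  have /le_trans := @ler_sum R _ (index_enum _) xpredT (fun i : 'I_(size P) => P`_i) _
    (fun i _ => key i).
  apply.
  rewrite big_split /= -!mulr_sumr; apply: lerD; last first.
    by rewrite ler_wpM2l ?sqr_ge0.
  rewrite ler_wpM2l; first by [].
    by rewrite mulr_ge0 ?invr_ge0 ?mulr_ge0 ?(ltW A0) // ltW.
  rewrite -natr_sum; apply: (@le_trans _ _ ((n + L).+1 - (n - L))%:R).
    by rewrite ler_nat sum_nat_interval.
  apply: (@le_trans _ _ (2 * L%:R + 1)).
    by rewrite -[2]/(2%:R) -natrM natr1 ler_nat; clear; move: n L => n' L'; lia.
  have : 1 <= A / z by rewrite ler_pdivlMr // mul1r (le_trans z1).
  rewrite -[3 * A / z]mulrA; move: (A / z) LA => x LA; clear -LA; lra.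
have -> : (z / A) ^+ 2 * (K * n%:R) = K / A ^+ 2 * (n%:R * z ^+ 2).
  by rewrite expr_div_n; ring.
have -> : (32 * A)^-1 * z * (3 * A / z) = 3 / 32.
  by field; rewrite (gt_eqF A0) (gt_eqF z0).
rewrite nz mulr1 => mass2.
have : K / A ^+ 2 <= 1 / 8.
  rewrite ler_pdivrMr ?exprn_gt0 //.
  have : A <= A ^+ 2 by rewrite expr2 ler_peMl // ltW.
  rewrite /A; move: ((8 * K + 1) ^+ 2) => x; clear; lra.
move: mass mass2; move: P.[1] (K / A ^+ 2) => x y; clear; lra.
Qed.

End LowerBound.

Section LowerBound.
Variable R : realType.
Variables c C : R.
Hypothesis c0 : 0 < c.
Local Notation Reg := (regular c C).

Lemma near_mean_ge2 p k : Reg p -> ((Num.truncn (3 * C)).+1 <= dn p)%N ->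
  `|k%:R - dm p| <= 1 -> (2 <= k)%N.
Proof.
move=> rp Np km; have C0 := C_gt0 c0 rp.
have n3 : 3 * C < (dn p)%:R.
  by apply: lt_le_trans (truncnS_gt _) _; rewrite ler_nat.
have m3 : 3 < dm p.
  by apply: lt_le_trans (dm_ge c0 rp); rewrite -dnE ltr_pdivlMr.
rewrite -ltnS -(ltr_nat R) -[k.+1%:R]natr1.
by move: km; rewrite ler_norml; move: (dm p) (k%:R : R) m3 => x y; clear; lra.
Qed.

Lemma dV_ge p : Reg p -> c / `|C| * dz p ^ (-2) <= dm p * dvar p.
Proof.
move=> rp; have C0 := C_gt0 c0 rp; rewrite (gtr0_norm C0).
have -> : c / C * dz p ^ (-2) = dz p ^ (-2) / C * c by move: (dz p ^ _) => y; ring.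
rewrite ler_pM ?(dm_ge c0 rp) ?(reg_var rp) ?(ltW c0) //.
by rewrite divr_ge0 ?(ltW C0) // exprz_ge0 // ltW // (dz_gt0 rp).
Qed.

(** Pigeonhole does not say where near n the large coefficient sits. For fixed k the Stein equation
    in i is a Gaussian recursion with centre [k mu] and variance [m var], so [transport] carries the
    bound from [i0] to n, at the price of a bounded exponential factor. *)
Lemma coef_lower : exists2 c' : R, 0 < c' & exists N, forall p k, Reg p ->
  (N <= dn p)%N -> `|k%:R - dm p| <= 1 -> c' * dz p <= (dQ p ^+ k)`_(dn p).
Proof.
have [A A1 [N1 large]] := large_coef C c0.
have A0 : 0 < A by apply: lt_le_trans A1.
have [K2 K20 stein] := OO_pos (@iz01 R c C A) (window_stein C c0 A).
have [K3 K30 smooth] := late_smooth C c0.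
pose B := `|C| + 1; have B0 : 0 < B by rewrite ltr_wpDl.
pose A3 := A + B; have A30 : 0 < A3 by rewrite addr_gt0.
pose v := c / B; have v0 : 0 < v by rewrite divr_gt0.
pose K4 := (K2 + A3 * K3 + K3) / v.
have K40 : 0 < K4 by rewrite divr_gt0 // !addr_gt0 // mulr_gt0.
have [K5 K50 trans] := @transport R A3 (K3 + K4) v v0.
(* For z below this threshold the transport error [K5 z^2] uses up at most half of the lower bound
   [z/(32A)]; hence the 64. *)
have AK0 : 0 < (64 * A * K5)^-1 by rewrite invr_gt0 !mulr_gt0.
have [N2 small] := dz_small AK0.
exists ((64 * A)^-1 * expR (- (B ^+ 2 / (2 * v)))).
  by rewrite mulr_gt0 ?expR_gt0 // invr_gt0 mulr_gt0.
exists (maxn (maxn N1 N2) (Num.truncn (3 * C)).+1) => p k rp.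
rewrite !geq_max => /andP[/andP[NN1 NN2] NN3] km.
have C0 := C_gt0 c0 rp; have BC : C <= B by rewrite /B (gtr0_norm C0) lerDl.
have := near_mean_ge2 rp NN3 km; case: k km => [|[|k]] // km _.
set K := k.+2 in km *.
have [i0 i0n Pi0] := large p k rp NN1 km.
set n := dn p; set z := dz p; set P := dQ p ^+ K.
have z0 : 0 < z := dz_gt0 rp; have z1 : z <= 1 := dz_le1 rp.
have Az1 : 1 <= A / z by rewrite ler_pdivlMr // mul1r (le_trans z1).
have Bz1 : B <= B / z by rewrite ler_pdivlMr // ler_piMr // ltW.
pose V := dm p * dvar p; pose ctr := K%:R * dmu p.
have Vv : v * z ^ (-2) <= V.
  apply: le_trans (dV_ge rp); rewrite (gtr0_norm C0) ler_wpM2r ?exprz_ge0 ?(ltW z0) //.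
  by rewrite ler_pM2l // lef_pV2.
have V0 : 0 < V by apply: lt_le_trans Vv; rewrite mulr_gt0 ?exprz_gt0.
have mn : dm p * dmu p = n%:R := reg_m rp.
have /andP[_ muC] := reg_mu rp; have mu0 := dmu_gt0 c0 rp.
have nctr : `|n%:R - ctr| <= B.
  rewrite -mn /ctr -mulrBl normrM distrC (gtr0_norm mu0).
  by apply: le_trans BC; rewrite -[leRHS]mul1r ler_pM // ltW.
have mK : dm p <= 2 * K.+1%:R.
  move: km; rewrite -[K.+1%:R]natr1 ler_norml; move: (ler0n R K).
  by move: (dm p) (K%:R : R) => x y; clear; lra.
pose L := Num.truncn (A / z).
have Az0 : 0 <= A / z by rewrite divr_ge0 // ltW.
have LA : L%:R <= A / z by rewrite truncn_le.
have rng i : (n - L <= i <= n + L)%N <-> `|i%:R - n%:R| <= A / z.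
  split=> [/andP[ia ib]|h].
    apply: le_trans LA; rewrite ler_norml.
    have : n%:R <= i%:R + L%:R :> R by rewrite -natrD ler_nat; move: ia ib; clear; move: n L => n' L'; lia.
    have : i%:R <= n%:R + L%:R :> R by rewrite -natrD ler_nat; move: ia ib; clear; move: n L => n' L'; lia.
    by move: (L%:R : R) (n%:R : R) (i%:R : R) => x y w; clear; lra.
  have hd (d : nat) : d%:R <= A / z -> (d <= L)%N by move=> hd; rewrite truncn_ge_nat.
  have : (i - n <= L)%N.
    have [/eqP->|/ltnW ni] := leqP i n => //; apply: hd.
    by rewrite natrB // (le_trans (ler_norm _)).
  have : (n - i <= L)%N.
    have [/eqP->|/ltnW ni] := leqP n i => //; apply: hd.
    by rewrite natrB // (le_trans (ler_norm _)) // distrC.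
  by clear; move: n L => n' L'; lia.
have win i : (n - L <= i <= n + L)%N -> window c C A (Idx p K i).
  by move=> /rng h; split => //=; apply: le_trans km _.
have sm i : `|P`_i| <= K3 * z /\ `|((1 - 'X) * P)`_i| <= K3 * z ^ 2.
  by have [] := smooth (Idx p K i) (conj rp mK).
have H1 i : (n - L <= i <= n + L)%N -> `|i%:R - ctr| <= A3 / z /\ `|P`_i| <= (K3 + K4) * z.
  move=> /rng h; split; last first.
    by apply: le_trans (proj1 (sm i)) _; rewrite ler_pM2r // lerDl ltW.
  rewrite -(subrK n%:R i%:R) -addrA /A3 mulrDl; apply: le_trans (ler_normD _ _) _.
  by rewrite lerD // (le_trans nctr).
have H2 i : (n - L <= i < n + L)%N ->
    `|P`_i.+1 - P`_i * (1 - (i%:R - ctr) / V)| <= (K3 + K4) * z ^ 3.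
  move=> hi.
  have hi1 : (n - L <= i.+1 <= n + L)%N by move: hi; clear; move: n L => n' L'; lia.
  have [h _] : `|i%:R - ctr| <= A3 / z /\ `|P`_i| <= (K3 + K4) * z 
    by apply: H1; move: hi; clear; move: n L => n' L'; lia.
  have st := stein _ (win _ hi1); rewrite /= /inabla /ig /iz /= -/V -/ctr -/P -/z expr1z in st.
  have nab : ((1 - 'X) * P)`_i.+1 = P`_i.+1 - P`_i.
    by rewrite mulrBl mul1r coefB coefXM.
  have [g1 g2] := sm i.+1; rewrite nab in st g2.
  set D := P`_i.+1 - P`_i in st g2.
  set X := V * D - _ in st.
  (* The Stein equation is taken at i+1, where [inabla] is the step [D] from i to i+1. Moving its
     drift term back to i leaves [(i - ctr) D] and one coefficient, both [O(z)], before the division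
     by V. *)
  have -> : P`_i.+1 - P`_i * (1 - (i%:R - ctr) / V) =
      (X - (i%:R - ctr) * D - P`_i.+1) / V.
    by rewrite /X /D -natr1; field; rewrite gt_eqF.
  have num : `|X - (i%:R - ctr) * D - P`_i.+1| <= (K2 + A3 * K3 + K3) * z.
    have -> : (K2 + A3 * K3 + K3) * z = K2 * z + A3 * K3 * z + K3 * z by ring.
    apply: le_trans (ler_normB _ _) _; apply: lerD => //.
    apply: le_trans (ler_normB _ _) _; apply: lerD => //.
    rewrite normrM; apply: (@le_trans _ _ (A3 / z * (K3 * z ^ 2))); first by rewrite ler_pM.
    by rewrite -exprnP le_eqVlt; apply/orP; left; apply/eqP; field; rewrite gt_eqF.
  rewrite normrM normfV (gtr0_norm V0) ler_pdivrMr //.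
  apply: le_trans num _.
  apply: (@le_trans _ _ (K4 * z ^ 3 * (v * z ^ (-2)))).
    rewrite /K4 -invr_expz -!exprnP le_eqVlt; apply/orP; left; apply/eqP.
    by field; rewrite (gt_eqF z0) (gt_eqF v0).
  have zz (e : int) : 0 < z ^ e by rewrite exprz_gt0.
  apply: ler_pM => //; [exact: ltW (mulr_gt0 K40 (zz 3))|exact: ltW (mulr_gt0 v0 (zz _))|].
  by rewrite (ler_pM2r (zz 3)) lerDr ltW.
have z01 : 0 < z <= 1 by rewrite z0 z1.
have hi0 : (n - L <= i0 <= n + L)%N by apply/rng.
have hn : (n - L <= n <= n + L)%N by rewrite leq_subr leq_addr.
have := trans z ctr V (fun i => P`_i) _ _ z01 Vv H1 H2 n i0 hn hi0.
have Pn0 : 0 <= P`_n by apply: nnegpX; exact: dQ_nneg rp.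
have e1 : (64 * A)^-1 * z <= P`_n * expR ((n%:R - ctr) ^+ 2 / (2 * V)) ->
   (64 * A)^-1 * expR (- (B ^+ 2 / (2 * v))) * z <= P`_n.
  move=> h; rewrite mulrAC expRN ler_pdivrMr ?expR_gt0 //; apply: le_trans h _.
  rewrite ler_wpM2l // ler_expR ler_pM ?sqr_ge0 //.
  - by rewrite invr_ge0 mulr_ge0 // ltW.
  - by rewrite -(real_normK (num_real (_ - _))) lerXn2r // nnegrE ltW.
  - rewrite lef_pV2 ?posrE ?(mulr_gt0 (ltr0Sn R 1) V0) ?(mulr_gt0 (ltr0Sn R 1) v0) // (ler_pM2l (ltr0Sn R 1)); apply: le_trans Vv.
    rewrite ler_peMr ?(ltW v0) // -invr_expz -exprnP invf_ge1 ?exprn_gt0 //.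
    by rewrite exprn_ile1 // ltW.
move=> tr; apply: e1.
have q1 : K5 * z ^ 2 <= (64 * A)^-1 * z.
  rewrite -exprnP expr2 mulrA ler_pM2r //.
  have := small p NN2; rewrite -/z => h; apply: (le_trans (ler_wpM2l (ltW K50) h)).
  by rewrite le_eqVlt; apply/orP; left; apply/eqP; field; rewrite (gt_eqF A0) (gt_eqF K50).
have q2 : P`_i0 <= P`_i0 * expR ((i0%:R - ctr) ^+ 2 / (2 * V)).
  have Pi1 : 0 <= P`_i0 by apply: nnegpX; exact: dQ_nneg rp.
  rewrite ler_peMr // -[leLHS]expR0 ler_expR divr_ge0 ?sqr_ge0 //.
  exact: ltW (mulr_gt0 (ltr0Sn R 1) V0).
have q3 : (32 * A)^-1 * z = 2 * ((64 * A)^-1 * z).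
  by field; rewrite gt_eqF.
move: tr Pi0; rewrite -/P -/z q3 ler_norml => /andP[tr _].
move: tr q1 q2; move: (expR _) (expR _) (K5 * _) (_ * z) P`_n P`_i0 => a b d e f g.
move: (f * a) (g * b) => x y; clear; lra.
Qed.

End LowerBound.

(** * Weights and tails *)

Section Weights.
Variable R : realType.
Variables c C : R.
Hypothesis c0 : 0 < c.
Local Notation Reg := (regular c C).

Definition dk0 (p : lltdata R) := Num.truncn (dm p).

(** For [b = 0] this is the Poisson recursion with mean m. For [b > 0] it is that of [C(N,k) b^k]
    with [N = m (1+b)/b], a binomial type weight with mean m and variance [m/(1+b)]. *)
Record weight (p : lltdata R) (w : nat -> R) : Prop := Weight {
  w_ge0 : forall k, (k <= dn p)%N -> 0 <= w k;
  w_rec : forall k, (k < dn p)%N -> w k.+1 * k.+1%:R = w k * (dm p + db p * (dm p - k%:R));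
  w_k0 : w (dk0 p) = 1 }.

(* p(k) up to the normalising factor B *)
Definition dU (p : lltdata R) (w : nat -> R) k := w k * (dQ p ^+ k)`_(dn p).

Section Bounds.
Variables (p : lltdata R) (w : nat -> R).
Hypotheses (rp : Reg p) (wp : weight p w).

Let n0 : 0 < (dn p)%:R :> R. Proof. exact: (dn_gt0 rp). Qed.
Let m0 : 0 < dm p. Proof. exact: (dm_gt0 c0 rp). Qed.

Lemma dk0_le : (dk0 p)%:R <= dm p.
Proof. by rewrite truncn_le ltW. Qed.

Lemma dk0_gt : dm p < (dk0 p)%:R + 1.
Proof. by rewrite natr1 truncnS_gt. Qed.

Lemma dk0_near : `|(dk0 p)%:R - dm p| <= 1.
Proof.
by have := dk0_le; have := dk0_gt; rewrite ler_norml; move: (_%:R) (dm p) => x y; lra.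
Qed.

Lemma dk0_len : (dk0 p <= dn p)%N.
Proof. by rewrite -(ler_nat R); apply: le_trans dk0_le (dm_len c0 rp). Qed.

Let E (d : nat) : R := expR (- (d%:R * (d%:R - 1) / (2 * (dn p)%:R))).

Let ES d : E d.+1 = E d * expR (- (d%:R / (dn p)%:R)).
Proof.
rewrite /E -expRD; congr expR; rewrite -natr1; field; rewrite gt_eqF //.
Qed.

Let exp_step (d x : R) : 0 < x -> x <= (dn p)%:R -> 0 <= d ->
  1 - d / x <= expR (- (d / (dn p)%:R)).
Proof.
move=> x0 xn d0; apply: (@le_trans _ _ (expR (- (d / x)))); first exact: expR_ge1Dx.
by rewrite ler_expR lerN2 ler_wpM2l // lef_pV2.
Qed.

(** Beyond [k0 + 1] the ratio at distance d is at most [(k0+1)/(k0+d+1) = 1 - d/(k0+d+1) <=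
    exp(-d/n)], and [E d] is the product of these exponentials. Only the first step can increase the
    weight, because k0 may lie below m; this accounts for [1 + C]. *)
Lemma weight_up d : (dk0 p + d <= dn p)%N -> w (dk0 p + d)%N <= (1 + C) * E d.
Proof.
have C0 := C_gt0 c0 rp; have /andP[b0 bC] := reg_b rp.
have E0 x : 0 < E x by exact: expR_gt0.
elim: d => [|d IH] kn.
  by rewrite addn0 (w_k0 wp) /E mul0r mul0r oppr0 expR0 mulr1 lerDl ltW.
rewrite addnS in kn *.
have k1 : 0 < (dk0 p + d).+1%:R :> R by rewrite ltr0n.
have wk := w_ge0 wp (ltnW kn).
rewrite -(ler_pM2r k1) (w_rec wp kn).
case: d IH kn k1 wk => [|d] IH kn k1 wk.
  rewrite ES /E !mul0r !oppr0 expR0 !mulr1 addn0 in wk *.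
  rewrite (w_k0 wp) mul1r -natr1.
  have h1 := dk0_gt; have h2 := dk0_le.
  have h3 : db p * (dm p - (dk0 p)%:R) <= C * 1.
    by apply: ler_pM => //; [rewrite subr_ge0|rewrite lerBlDl addrC ltW // addrC].
  have h4 : C * 1 <= C * ((dk0 p)%:R + 1).
    by rewrite ler_pM2l // lerDr.
  by move: (db p * _) h1 h2 h3 h4 => x; rewrite mulrDl; lra.
have neg : db p * (dm p - (dk0 p + d.+1)%:R) <= 0.
  rewrite mulr_ge0_le0 // subr_le0; apply: ltW; apply: lt_le_trans dk0_gt _.
  by rewrite natrD -natr1 lerD2l lerDr.
apply: (@le_trans _ _ (w (dk0 p + d.+1)%N * ((dk0 p)%:R + 1))).
  rewrite ler_wpM2l //; have := dk0_gt; move: (db p * _) neg => x.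
  by move: (dm p) ((dk0 p)%:R : R) => y u; lra.
apply: (@le_trans _ _ ((1 + C) * E d.+1 * ((dk0 p)%:R + 1))).
  by rewrite ler_wpM2r ?addr_ge0 // IH // ltnW.
rewrite (ES d.+1) [(1 + C) * (_ * _)]mulrA -[leRHS]mulrA ler_pM2l; last first.
  by rewrite mulr_gt0 // addr_gt0.
rewrite -ler_pdivrMr //.
have -> : ((dk0 p)%:R + 1) / (dk0 p + d.+1).+1%:R = 1 - d.+1%:R / (dk0 p + d.+1).+1%:R :> R.
  apply: (@mulIf _ (dk0 p + d.+1).+1%:R); first by rewrite pnatr_eq0.
  by rewrite mulrBl !divfK ?pnatr_eq0 // mul1r -[in RHS]natr1 natrD; ring.
by apply: exp_step => //; rewrite ler_nat.
Qed.

(** Below [k0 <= m] the term [b (m - k)] is nonnegative and helps: [w(l) m <= w(l+1) (l+1)], so no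
    constant is lost. *)
Lemma weight_down d : (d <= dk0 p)%N -> w (dk0 p - d)%N <= E d.
Proof.
have /andP[b0 bC] := reg_b rp.
have E0 x : 0 < E x by exact: expR_gt0.
elim: d => [|d IH] dk.
  by rewrite subn0 (w_k0 wp) /E mul0r mul0r oppr0 expR0.
set l := (dk0 p - d.+1)%N.
have lS : (dk0 p - d = l.+1)%N by rewrite /l; lia.
have k00 : 0 < (dk0 p)%:R :> R by rewrite ltr0n (leq_trans _ dk).
have ln : (l < dn p)%N by rewrite -lS (leq_trans (leq_subr _ _)) // dk0_len.
have wl := w_ge0 wp (ltnW ln).
have lm : l%:R <= dm p by apply: le_trans dk0_le; rewrite ler_nat leq_subr.
have h : w l * dm p <= w l.+1 * l.+1%:R.
  rewrite (w_rec wp ln) ler_wpM2l // lerDl mulr_ge0 // subr_ge0 //.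
rewrite -lS in h.
have h2 : w l * (dk0 p)%:R <= E d * (dk0 p - d)%:R.
  apply: (@le_trans _ _ (w l * dm p)); first by rewrite ler_wpM2l // dk0_le.
  by apply: le_trans h _; rewrite ler_wpM2r // IH // ltnW.
rewrite -(ler_pM2r k00); apply: le_trans h2 _.
rewrite ES -mulrA ler_pM2l // -ler_pdivrMr // natrB ?(ltnW dk) // mulrBl divff ?gt_eqF //.
by apply: exp_step => //; rewrite ler_nat dk0_len.
Qed.

Definition dist0 k := ((k - dk0 p) + (dk0 p - k))%N.

Lemma weight_bound k : (k <= dn p)%N -> w k <= (1 + C) * E (dist0 k).
Proof.
move=> kn; have C0 := C_gt0 c0 rp; rewrite /dist0.
have [kk|kk] := leqP (dk0 p) k.
  rewrite (eqP kk) addn0; have := @weight_up (k - dk0 p)%N.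
  by rewrite subnKC //; apply.
rewrite (eqP (ltnW kk)) add0n; have := @weight_down (dk0 p - k)%N (leq_subr _ _).
rewrite subKn ?(ltnW kk) // => h; apply: le_trans h _.
by rewrite ler_peMl ?expR_ge0 // lerDl ltW.
Qed.

Lemma weight_leC k : (k <= dn p)%N -> w k <= 1 + C.
Proof.
move=> kn; apply: le_trans (weight_bound kn) _.
have C0 := C_gt0 c0 rp.
rewrite ler_piMr ?addr_ge0 ?(ltW C0) // expR_le1 oppr_le0 divr_ge0 //.
by case: (dist0 k) => [|d]; rewrite ?mul0r // mulr_ge0 // subr_ge0 ler1n.
Qed.

End Bounds.

(** The weight contributes [exp(-x)] with [x = d(d-1)/(2n)]. For k of order n, smoothness supplies a
    factor z and [exp(-x) <= 1/x] suffices. For smaller k the coefficient is only bounded by 1, but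
    then [d >= m/2], so x is of order n and [exp(-x) <= 2/x^2] compensates. *)
Lemma tail_bound : exists2 K : R, 0 < K & forall p w k, Reg p -> weight p w ->
  (k <= dn p)%N -> (2 <= dist0 p k)%N ->
  dU p w k <= K / dz p / ((dist0 p k)%:R * ((dist0 p k)%:R - 1)).
Proof.
have [K3 K30 smooth] := late_smooth C c0.
have [B B0 BE] : exists2 B, 0 < B & `|C| + 1 = B.
  by exists (`|C| + 1); rewrite // ltr_wpDl.
exists ((1 + B) * 2 * K3 + 256 * (1 + B) * B ^+ 2).
  by rewrite addr_gt0 // !mulr_gt0 ?exprn_gt0 ?addr_gt0.
move=> p w k rp wp kn d2.
have C0 := C_gt0 c0 rp; have CB : C <= B by rewrite -BE (gtr0_norm C0) lerDl.
have z0 := dz_gt0 rp; have z1 := dz_le1 rp; have n0 := dn_gt0 rp.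
have wb := weight_bound rp wp kn; have wk := w_ge0 wp kn.
have G0 : 0 <= (dQ p ^+ k)`_(dn p) by apply: nnegpX; exact: dQ_nneg rp.
have nz : (dn p)%:R * dz p ^+ 2 = 1.
  by rewrite exprnP dz2 mulfV // gt_eqF.
have zi : 0 < (dz p)^-1 by move: z0; move: (dz p) => z zz; rewrite invr_gt0.
move: d2 wb; rewrite /dU; set d : R := (dist0 p k)%:R => d2 wb.
have d2' : 2 <= d by rewrite -[2]/(2%:R) ler_nat.
pose D := d * (d - 1).
have D0 : 0 < D by rewrite mulr_gt0 ?subr_gt0 // (lt_le_trans _ d2') // ltr1n.
pose x := D / (2 * (dn p)%:R).
have x0 : 0 < x by rewrite divr_gt0 // mulr_gt0.
have wb' : w k <= (1 + B) / expR x.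
  apply: le_trans wb _; rewrite expRN ler_pM ?addr_ge0 ?(ltW C0) ?invr_ge0 ?expR_ge0 //.
  by rewrite lerD2l.
have ex1 : x <= expR x by apply: le_trans (expR_ge1Dx x); rewrite lerDr.
have ex2 : x ^+ 2 / 2 <= expR x.
  apply: le_trans (expR_ge1Dxn 1 (ltW x0)); rewrite lerDr //.
have [mk|mk] := leP (dm p) (2 * k.+1%:R).
  have [g _ _] := smooth (Idx p k (dn p)) (conj rp mk).
  have {}g : (dQ p ^+ k)`_(dn p) <= K3 * dz p by apply: le_trans (ler_norm _) g.
  apply: (@le_trans _ _ ((1 + B) / x * (K3 * dz p))).
    apply: ler_pM => //; apply: le_trans wb' _.
    by rewrite ler_pM2l ?addr_gt0 // lef_pV2 ?posrE ?expR_gt0.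
  apply: (@le_trans _ _ ((1 + B) * 2 * K3 / dz p / D)).
    rewrite le_eqVlt; apply/orP; left; apply/eqP.
    have -> : (1 + B) / x * (K3 * dz p) = (1 + B) * 2 * K3 / dz p / D * ((dn p)%:R * dz p ^+ 2).
      by rewrite /x; field; rewrite (gt_eqF D0) (gt_eqF z0) (gt_eqF n0).
    by rewrite nz mulr1.
  rewrite ler_pM2r ?invr_gt0 // (ler_pM2r zi) lerDl.
  by rewrite !mulr_ge0 ?exprn_ge0 ?addr_ge0 // ltW.
have G1 : (dQ p ^+ k)`_(dn p) <= 1.
  apply: le_trans (coef_le_horner1 _ _) _; first by apply: nnegpX; exact: dQ_nneg rp.
  by rewrite horner_exp dQ1 exprn_ile1 ?(dM_ge0 rp) ?(reg_M0_le1 rp).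
have dm2 : dm p / 2 <= d.
  have kk : (k < dk0 p)%N.
    rewrite -(ltr_nat R); have := dk0_gt p; have := ler0n R k; move: mk; rewrite -[k.+1%:R]natr1.
    by move: (dm p) (k%:R : R) ((dk0 p)%:R : R) => a b e; clear; lra.
  rewrite /d /dist0 (eqP (ltnW kk)) add0n natrB ?(ltnW kk) //.
  move: mk (dk0_gt p); rewrite -[k.+1%:R]natr1.
  by move: (dm p) (k%:R : R) ((dk0 p)%:R : R) => a b e; clear; lra.
have mB : (dn p)%:R / B <= dm p.
  by rewrite (dmE c0 rp) ler_pM2l // lef_pV2 ?posrE ?(dmu_gt0 c0 rp) //;
     apply: le_trans CB; case/andP: (reg_mu rp).
have Dn : (dn p)%:R ^+ 2 / (8 * B ^+ 2) <= D.
  have h : (dn p)%:R / (2 * B) <= d.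
    apply: le_trans dm2; rewrite ler_pdivlMr //.
    by apply: le_trans mB; rewrite le_eqVlt; apply/orP; left; apply/eqP; field; rewrite gt_eqF.
  have h2 : d ^+ 2 / 2 <= D.
    by rewrite /D; move: d2'; clear; nra.
  apply: le_trans h2.
  have -> : (dn p)%:R ^+ 2 / (8 * B ^+ 2) = ((dn p)%:R / (2 * B)) ^+ 2 / 2.
    by field; rewrite gt_eqF.
  have hn : 0 <= (dn p)%:R / (2 * B) by rewrite divr_ge0 ?mulr_ge0 ?(ltW B0).
  by rewrite ler_pM2r ?invr_gt0 // lerXn2r ?nnegrE //; apply: le_trans h.
apply: (@le_trans _ _ ((1 + B) / (x ^+ 2 / 2) * 1)).
  apply: ler_pM => //; apply: le_trans wb' _.
  by rewrite ler_pM2l ?addr_gt0 // lef_pV2 ?posrE ?expR_gt0 ?divr_gt0 ?exprn_gt0.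
rewrite mulr1.
have -> : (1 + B) / (x ^+ 2 / 2) = (1 + B) * 8 * ((dn p)%:R ^+ 2 / D) / D.
  by rewrite /x; field; rewrite (gt_eqF D0) (gt_eqF n0).
rewrite ler_pM2r ?invr_gt0 //.
apply: (@le_trans _ _ (64 * (1 + B) * B ^+ 2)).
  have h : (dn p)%:R ^+ 2 / D <= 8 * B ^+ 2.
    by rewrite ler_pdivrMr // mulrC -ler_pdivrMr // mulr_gt0 // exprn_gt0.
  apply: (@le_trans _ _ ((1 + B) * 8 * (8 * B ^+ 2))).
    by rewrite ler_pM2l // mulr_gt0 // addr_gt0.
  by rewrite le_eqVlt; apply/orP; left; apply/eqP; ring.
rewrite ler_pdivlMr //; apply: (@le_trans _ _ (64 * (1 + B) * B ^+ 2)).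
  by rewrite ler_piMr // !mulr_ge0 ?exprn_ge0 ?addr_ge0 // ltW.
apply: (@le_trans _ _ (256 * (1 + B) * B ^+ 2)).
  rewrite ler_pM2r ?exprn_gt0 // ler_pM2r ?addr_gt0 //.
  by rewrite -[64]/(64%:R) -[256]/(256%:R) ler_nat.
by rewrite lerDr !mulr_ge0 ?addr_ge0 // ltW.
Qed.

(** [1/(d(d-1)) = 1/(d-1) - 1/d] telescopes on each side of k0, and each side contributes at most
    [1/L]. *)
Lemma tail_sum (k0 L N : nat) : (0 < L)%N ->
  \sum_(k < N) (L < (k - k0) + (k0 - k))%N%:R
     / (((k - k0) + (k0 - k))%N%:R * (((k - k0) + (k0 - k))%N%:R - 1)) <= 2 / L%:R :> R.
Proof.
move=> L0.
have inv_mono a b : (0 < a)%N -> (a <= b)%N -> b%:R^-1 <= a%:R^-1 :> R.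
  by move=> a0 ab; rewrite lef_pV2 ?posrE ?ltr0n ?ler_nat // (leq_trans a0).
have tel (d : nat) : (1 < d)%N -> (d%:R * (d%:R - 1))^-1 = d.-1%:R^-1 - d%:R^-1 :> R.
  case: d => [|[|d]] // _; rewrite -natr1 /=.
  by field; rewrite !nat1r natr1 !pnatr_eq0.
(* The [maxn L] freezes both potentials within distance L of k0, so that indices without tail weight
   contribute nothing and a single telescoping sum over all k works. *)
pose g (k : nat) : R := (maxn L (k - k0.+1))%:R^-1.
pose h (k : nat) : R := (maxn L (k0 - k))%:R^-1.
have gh k : (L < (k - k0) + (k0 - k))%N%:R
     / (((k - k0) + (k0 - k))%N%:R * (((k - k0) + (k0 - k))%N%:R - 1))
     <= (h k.+1 - g k.+1) - (h k - g k).
  have gm : 0 <= g k - g k.+1 by rewrite subr_ge0; apply: inv_mono; clear -L0; lia.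
  have hm : 0 <= h k.+1 - h k by rewrite subr_ge0; apply: inv_mono; clear -L0; lia.
  have -> : h k.+1 - g k.+1 - (h k - g k) = (g k - g k.+1) + (h k.+1 - h k) by ring.
  case: ltnP => Lk; last by rewrite mul0r addr_ge0.
  rewrite mul1r tel; last by clear -L0 Lk; lia.
  have [kk|kk] := leqP k k0.
    rewrite ler_wpDl // /h.
    have -> : (k - k0 + (k0 - k)).-1 = maxn L (k0 - k.+1) by clear -L0 Lk kk; lia.
    by have -> : (k - k0 + (k0 - k))%N = maxn L (k0 - k) by clear -L0 Lk kk; lia.
  rewrite ler_wpDr // /g.
  have -> : (k - k0 + (k0 - k)).-1 = maxn L (k - k0.+1) by clear -L0 Lk kk; lia.
  by have -> : (k - k0 + (k0 - k))%N = maxn L (k.+1 - k0.+1) by clear -L0 Lk kk; lia.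
have /le_trans := @ler_sum R _ (index_enum _) xpredT (fun k : 'I_N => _) _ (fun k _ => gh k).
apply; rewrite -(big_mkord xpredT (fun k => (h k.+1 - g k.+1) - (h k - g k))).
rewrite (telescope_sumr (fun k => h k - g k)) //.
have g0 k : 0 <= g k by rewrite invr_ge0.
have h0 k : 0 <= h k by rewrite invr_ge0.
have gL k : g k <= L%:R^-1 by apply: inv_mono => //; exact: leq_maxl.
have hL k : h k <= L%:R^-1 by apply: inv_mono => //; exact: leq_maxl.
have := g0 N; have := h0 0%N; have := gL 0%N; have := hL N.
by move: (g N) (h N) (g 0%N) (h 0%N) (L%:R^-1) => a b e f l; clear; lra.
Qed.

End Weights.

(** * Gaussian sums *)

Section GaussSum.
Variable R : realType.
Import gauss_integral_proof.
Local Notation I := (@integral0_gauss R).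

Lemma cvg_integral0_gauss : I x @[x --> +oo] --> Num.sqrt pi / 2.
Proof.
have : Num.sqrt (I x ^+ 2) @[x --> +oo] --> Num.sqrt (pi / 4 : R).
  apply: continuous_cvg; first exact: sqrt_continuous.
  exact: cvg_integral0_gauss_sqr.
rewrite sqrtrM ?pi_ge0 // sqrtrV // (_ : 4 = 2 ^+ 2 :> R); last by rewrite expr2 -natrM.
rewrite sqrtr_sqr ger0_norm // (_ : (fun x => Num.sqrt _) = I) //.
by apply/funext => r; rewrite sqrtr_sqr ger0_norm // integral0_gauss_ge0.
Qed.

Lemma integral0_gauss_mvt (a b : R) : 0 <= a -> a <= b ->
  exists2 x, a <= x <= b & I b - I a = expR (- x ^+ 2) * (b - a).
Proof.
move=> a0 ab.
have cg : {within `[0, b], continuous (@gauss_fun R)}.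
  by apply: continuous_subspaceT; exact: continuous_gauss_fun.
have [||x] := @MVT_segment R I (@gauss_fun R) a b ab.
- move=> x; rewrite in_itv /= => /andP[ax _].
  have x0 : 0 < x by apply: le_lt_trans ax.
  have [d1 d2] : derivable I x 1 /\ derive1 I x = gauss_fun x.
    apply: (@continuous_FTC1 R (@gauss_fun R) (BLeft 0) _ (x + 1)).
    + by rewrite ltrDl.
    + apply: continuous_compact_integrable; first exact: segment_compact.
      by apply: continuous_subspaceT; exact: continuous_gauss_fun.
    + by rewrite /= lte_fin.
    + exact: continuous_gauss_fun.
  by rewrite -d2 derive1E; exact: DeriveDef.
- apply: (@continuous_subspaceW _ _ _ `[0, b]).
    by move=> y /=; rewrite !in_itv /= => /andP[ay ->]; rewrite (le_trans a0).
  apply: parameterized_integral_continuous; first exact: le_trans ab.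
  by apply: continuous_compact_integrable => //; exact: segment_compact.
- by rewrite in_itv /= => xab E; exists x.
Qed.

Lemma expRN_lip (a b : R) : 0 <= a -> a <= b -> `|expR (- a) - expR (- b)| <= b - a.
Proof.
move=> a0 ab; have e : expR (- b) <= expR (- a) by rewrite ler_expR lerN2.
rewrite ger0_norm ?subr_ge0 //.
have -> : expR (- b) = expR (- a) * expR (- (b - a)) by rewrite -expRD; congr expR; ring.
have e1 : expR (- a) <= 1 by rewrite expR_le1 oppr_le0.
have e2 := expR_ge1Dx (- (b - a)); have e3 := expR_gt0 (- a).
have e4 : expR (- (b - a)) <= 1 by rewrite expR_le1 oppr_le0 subr_ge0.
apply: (@le_trans _ _ (1 - expR (- (b - a)))); last by lra.
by rewrite -[X in X - _]mulr1 -mulrBr ler_piMl // subr_ge0.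
Qed.

(** A Riemann sum of mesh [1/u] with [u = sqrt(2V)]. By the mean value theorem a cell has integral
    [exp(-x^2)/u]; since [exp(-y)] is 1-Lipschitz for [y >= 0], the cell error is at most the
    increment of [(d/u)^2], and these increments telescope. *)
Lemma gauss_partial_sum (V : R) L : 0 < V ->
  `|\sum_(d < L) expR (- (d%:R ^+ 2 / (2 * V)))
    - Num.sqrt (2 * V) * I (L%:R / Num.sqrt (2 * V))| <= L%:R ^+ 2 / (2 * V).
Proof.
move=> V0; set u := Num.sqrt (2 * V).
have V2 : 0 < 2 * V by rewrite mulr_gt0.
have u0 : 0 < u by rewrite sqrtr_gt0.
have u2 : u ^+ 2 = 2 * V by rewrite sqr_sqrtr // ltW.
rewrite -u2; elim: L => [|L IH].
  have [x _] := @integral0_gauss_mvt 0 0 (lexx _) (lexx _).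
  have I0 : I 0 = 0.
    by rewrite /integral0_gauss set_itv1 Rintegral_set1.
  by rewrite big_ord0 !mul0r I0 mulr0 subrr normr0 expr0n mul0r.
rewrite big_ord_recr /=.
have a0 : 0 <= L%:R / u by rewrite divr_ge0 // ltW.
have ab : L%:R / u <= L.+1%:R / u by rewrite ler_pM2r ?invr_gt0 // ler_nat.
have [x /andP[ax xb] E] := integral0_gauss_mvt a0 ab.
have x0 : 0 <= x by apply: le_trans ax.
have uI : u * I (L.+1%:R / u) = u * I (L%:R / u) + expR (- x ^+ 2).
  have -> : I (L.+1%:R / u) = I (L%:R / u) + expR (- x ^+ 2) * (L.+1%:R / u - L%:R / u).
    by rewrite -E addrC subrK.
  by rewrite -[L.+1%:R]natr1; field; rewrite gt_eqF.
rewrite uI.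
set S := \sum_(d < L) _ in IH *; set J := u * I (L%:R / u) in IH *.
have -> : S + expR (- (L%:R ^+ 2 / u ^+ 2)) - (J + expR (- x ^+ 2)) =
  (S - J) + (expR (- (L%:R ^+ 2 / u ^+ 2)) - expR (- x ^+ 2)) by ring.
apply: le_trans (ler_normD _ _) _.
have -> : L.+1%:R ^+ 2 / u ^+ 2 =
   L%:R ^+ 2 / u ^+ 2 + ((L.+1%:R / u) ^+ 2 - L%:R ^+ 2 / u ^+ 2) by rewrite expr_div_n; ring.
apply: lerD => //.
have ax2 : L%:R ^+ 2 / u ^+ 2 <= x ^+ 2.
  by rewrite -expr_div_n lerXn2r // nnegrE.
apply: le_trans (expRN_lip _ ax2) _; first by rewrite divr_ge0 ?sqr_ge0.
by rewrite lerD2r lerXn2r // nnegrE // (le_trans x0).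
Qed.

Lemma gauss_sum (e : R) : 0 < e -> exists2 Y, 0 < Y &
  forall (V : R) L, 0 < V -> Y * Num.sqrt (2 * V) <= L%:R ->
  `|\sum_(d < L) expR (- (d%:R ^+ 2 / (2 * V)))
    - Num.sqrt (2 * V) * (Num.sqrt pi / 2)| <= e * Num.sqrt (2 * V) + L%:R ^+ 2 / (2 * V).
Proof.
move=> e0; have /cvgrPdist_le /(_ e e0) [M [_ HM]] := cvg_integral0_gauss.
exists (`|M| + 1); first by rewrite ltr_wpDl.
move=> V L V0 YL; set u := Num.sqrt (2 * V).
have u0 : 0 < u by rewrite sqrtr_gt0 mulr_gt0.
have h := gauss_partial_sum L V0; rewrite -/u in h YL.
have {}HM : `|Num.sqrt pi / 2 - I (L%:R / u)| <= e.
  apply: HM; apply: (le_lt_trans (ler_norm M)).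
  by apply: (@lt_le_trans _ _ (`|M| + 1)); rewrite ?ltrDl // ler_pdivlMr.
set S := \sum_(d < L) _ in h *; set J := I _ in h HM.
have -> : S - u * (Num.sqrt pi / 2) = (S - u * J) - u * (Num.sqrt pi / 2 - J) by ring.
apply: le_trans (ler_normB _ _) _; rewrite addrC lerD //.
by rewrite normrM gtr0_norm // mulrC ler_pM2r.
Qed.

Lemma window_sum (F : nat -> R) k0 L n : (L <= k0)%N -> (k0 + L <= n)%N ->
  \sum_(k < n.+1) ((k - k0) + (k0 - k) <= L)%N%:R * F k =
  \sum_(k0 - L <= k < (k0 + L).+1) F k.
Proof.
move=> Lk kn.
rewrite -(big_mkord xpredT (fun k => ((k - k0) + (k0 - k) <= L)%N%:R * F k)).
rewrite (@big_cat_nat _ _ _ (k0 - L)) /=; [|by []|by clear -Lk kn; lia].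
rewrite (@big_cat_nat _ _ _ (k0 + L).+1 (k0 - L) n.+1) /=; [|by clear -Lk kn; lia|by clear -Lk kn; lia].
rewrite big_nat big1 ?add0r; last first.
  move=> i /andP[_ ik]; have -> : (i - k0 + (k0 - i) <= L)%N = false by clear -ik Lk; lia.
  by rewrite mul0r.
rewrite [X in _ + X = _]big_nat [X in _ + X = _]big1 ?addr0; last first.
  move=> i /andP[ik _]; have -> : (i - k0 + (k0 - i) <= L)%N = false by clear -ik Lk; lia.
  by rewrite mul0r.
rewrite big_nat [RHS]big_nat; apply: eq_bigr => i /andP[ia ib].
have -> : (i - k0 + (k0 - i) <= L)%N by clear -ia ib Lk; lia.
by rewrite mul1r.
Qed.

Lemma window_sum_dist (f : nat -> R) k0 L : (L <= k0)%N ->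
  \sum_(k0 - L <= k < (k0 + L).+1) f ((k - k0) + (k0 - k))%N =
  2 * \sum_(d < L.+1) f d - f 0%N.
Proof.
elim: L => [|L IH] Lk.
  by rewrite subn0 addn0 big_nat1 subnn big_ord1; ring.
rewrite big_ord_recr /= mulrDr addrAC -IH ?(ltnW Lk) //.
rewrite addnS big_nat_recr /=; last by clear -Lk; lia.
rewrite big_ltn; last by clear -Lk; lia.
have -> : (k0 - L.+1).+1 = (k0 - L)%N by clear -Lk; lia.
have -> : (k0 - L.+1 - k0 + (k0 - (k0 - L.+1)) = L.+1)%N by clear -Lk; lia.
have -> : ((k0 + L).+1 - k0 + (k0 - (k0 + L).+1) = L.+1)%N by clear -Lk; lia.
by ring.
Qed.

End GaussSum.

(** * The recursion in k for the weighted law *)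

Section Step.
Variable R : realType.
Variables c C : R.
Hypothesis c0 : 0 < c.
Local Notation Reg := (regular c C).

(* 1/V: the curvatures of w and of the law of the sum add up. *)
Definition dVi (p : lltdata R) := (1 + db p) / dm p + dmu p ^+ 2 / (dm p * dvar p).
Definition dV p := (dVi p)^-1.

Lemma dVi_gt0 p : Reg p -> 0 < dVi p.
Proof.
move=> rp; have m0 := dm_gt0 c0 rp; have /andP[b0 _] := reg_b rp.
have v0 : 0 < dvar p by apply: lt_le_trans (reg_var rp).
apply: ltr_pwDl; first by rewrite divr_gt0 // ltr_pwDl.
by rewrite divr_ge0 ?sqr_ge0 // mulr_ge0 ?(ltW m0) ?(ltW v0).
Qed.

Lemma dV_gt0 p : Reg p -> 0 < dV p.
Proof. by move=> /dVi_gt0; rewrite /dV invr_gt0. Qed.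

Lemma dV_le p : Reg p -> dV p <= dz p ^ (-2).
Proof.
move=> rp; have m0 := dm_gt0 c0 rp; have /andP[b0 _] := reg_b rp.
have v0 : 0 < dvar p by apply: lt_le_trans (reg_var rp).
rewrite -dnE; apply: le_trans (dm_len c0 rp).
rewrite /dV -[leRHS]invrK lef_pV2 ?posrE ?invr_gt0 ?(dVi_gt0 rp) //.
apply: ler_wpDr; first by rewrite divr_ge0 ?sqr_ge0 // mulr_ge0 ?(ltW m0) ?(ltW v0).
by rewrite -[leLHS]mul1r ler_pM2r ?invr_gt0 // lerDl.
Qed.

Lemma dV_lower : exists2 v, 0 < v & forall p, Reg p -> v * dz p ^ (-2) <= dV p.
Proof.
have [B B0 BE] : exists2 B, 0 < B & `|C| + 1 = B.
  by exists (`|C| + 1); rewrite // ltr_wpDl.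
exists ((B * (1 + B + B ^+ 2 / c))^-1).
  by rewrite invr_gt0 mulr_gt0 // !addr_gt0 // divr_gt0 // exprn_gt0.
move=> p rp; have m0 := dm_gt0 c0 rp; have /andP[b0 bC] := reg_b rp.
have C0 := C_gt0 c0 rp; have CB : C <= B by rewrite -BE (gtr0_norm C0) lerDl.
have v0 : 0 < dvar p by apply: lt_le_trans (reg_var rp).
have n0 := dn_gt0 rp; rewrite -dnE.
have [mu0 /andP[_ muC]] := (dmu_gt0 c0 rp, reg_mu rp).
have Vi : dVi p <= (1 + B + B ^+ 2 / c) / dm p.
  have -> : dVi p = (1 + db p + dmu p ^+ 2 / dvar p) / dm p.
    by rewrite /dVi; field; rewrite (gt_eqF m0) (gt_eqF v0).
  rewrite ler_pM2r ?invr_gt0 //; apply: lerD; first by rewrite lerD2l (le_trans bC).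
  apply: ler_pM; rewrite ?sqr_ge0 ?invr_ge0 ?(ltW v0) //.
    by rewrite lerXn2r ?nnegrE ?(ltW mu0) ?(ltW B0) // (le_trans muC).
  by rewrite lef_pV2 // (reg_var rp).
have K0 : 0 < 1 + B + B ^+ 2 / c by rewrite !addr_gt0 // divr_gt0 // exprn_gt0.
apply: (@le_trans _ _ (dm p / (1 + B + B ^+ 2 / c))); last first.
  by rewrite -invf_div /dV lef_pV2 ?posrE ?(dVi_gt0 rp) // divr_gt0.
rewrite invfM mulrAC ler_pM2r ?invr_gt0 // mulrC.
by rewrite (dmE c0 rp) ler_pM2l // lef_pV2 ?posrE // (le_trans muC).
Qed.

Definition kdom (A : R) (t : idx R * (nat -> R)) :=
  [/\ window c C A t.1, weight (ip t.1) t.2, (ik t.1 < dn (ip t.1))%N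
    & ii t.1 = dn (ip t.1)].

Definition kz (t : idx R * (nat -> R)) := iz t.1.

Lemma kz01 A t : kdom A t -> 0 < kz t <= 1.
Proof. by case=> [[rp _ _ _] _ _ _]; exact: dz01 rp. Qed.

Lemma OO_fst A e (f : idx R -> R) :
  OO (window c C A) (@iz R) e f -> OO (kdom A) kz e (fun t => f t.1).
Proof. by move=> [K Kf]; exists K => t [wt _ _ _]; exact: Kf. Qed.

Variable A : R.
Local Notation z01 := (@kz01 A).
Local Notation OM := (OO_Mw z01).

(** With [d = k - m], the weight has ratio [1 - y1 + O(z^2)], [y1 = (1+b) d/m], and the law of the
    sum at n has ratio [1 - y2], [y2 = mu^2 d/(m var)], up to an additive [O(z^3)]. The product
    [y1 y2] is [O(z^2)], and all second order terms carry the factor [ig = O(z)]. *)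
Lemma llt_step : OO (kdom A) kz 3 (fun t => let: (i, w) := t in
  dU (ip i) w (ik i).+1 -
  dU (ip i) w (ik i) * (1 - ((ik i)%:R - dm (ip i)) / dV (ip i))).
Proof.
pose O := OO (kdom A) kz.
have [B B0 BE] : exists2 B, 0 < B & `|C| + 1 = B.
  by exists (`|C| + 1); rewrite // ltr_wpDl.
pose P (t : idx R * (nat -> R)) := ip t.1.
pose d (t : idx R * (nat -> R)) := (ik t.1)%:R - dm (P t).
have od : O (-1) d := OO_fst (Ow_km c C A).
have ob : O 0 (fun t => 1 + db (P t)).
  apply: OO_D; first exact: (OO_c z01).
  apply: (OO_bnd (K := C)) => t [[rp _ _ _] _ _ _].
  by have /andP[b0 bC] := reg_b rp; rewrite expr0z mulr1 ger0_norm.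
have omge t : kdom A t -> (2 * B)^-1 * kz t ^ (-2) <= dm (P t) / 2.
  move=> [[rp _ _ _] _ _ _]; have C0 := C_gt0 c0 rp.
  have CB : C <= B by rewrite -BE (gtr0_norm C0) lerDl.
  have E (y : R) : (2 * B)^-1 * y = y / B / 2 by field; rewrite gt_eqF.
  rewrite E ler_pM2r ?invr_gt0 //; apply: le_trans (dm_ge c0 rp).
  rewrite /kz /iz -!dnE ler_pM2l ?(dn_gt0 rp) // lef_pV2 //.
have ok1 : O 2 (fun t => (ik t.1).+1%:R^-1).
  apply: (OO_inv z01 (e := -2) (c := (2 * B)^-1)); first by rewrite invr_gt0 mulr_gt0.
  move=> t kt; apply: le_trans (omge t kt) _.
  by case: kt => [[_ _ _ mk] _ _ _]; rewrite ler_pdivrMr // mulrC.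
have om : O 2 (fun t => (dm (P t))^-1).
  apply: (OO_inv z01 (e := -2) (c := (2 * B)^-1)); first by rewrite invr_gt0 mulr_gt0.
  move=> t kt; apply: le_trans (omge t kt) _.
  case: kt => [[rp _ _ _] _ _ _]; have m0 := dm_gt0 c0 rp.
  by rewrite ler_pdivrMr // ler_peMr ?(ltW m0) // ler1n.
have ovar : O 0 (fun t => (dvar (P t))^-1).
  apply: (OO_inv z01 (e := 0) (c := c)) => // t [[rp _ _ _] _ _ _].
  by rewrite expr0z mulr1 (reg_var rp).
have omu : O 0 (fun t => dmu (P t)) := OO_fst (Ow_mu C c0 A).
pose y1 t := (1 + db (P t)) * (d t * (dm (P t))^-1).
have oy1 : O 1 y1 by apply: OM ob (OO_M z01 od om) _.
pose y2 t := (dmu (P t) * dmu (P t)) * (d t * ((dm (P t))^-1 * (dvar (P t))^-1)).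
have oy2 : O 1 y2.
  by apply: OM (OO_M z01 omu omu) (OO_M z01 od (OO_M z01 om ovar)) _.
pose rho t := (dm (P t) + db (P t) * (dm (P t) - (ik t.1)%:R)) * (ik t.1).+1%:R^-1.
have orho : O 2 (fun t => rho t - 1 + y1 t).
  have o1 : O 2 (fun t => (1 + db (P t)) * ((d t * (d t + 1)) * ((dm (P t))^-1 * (ik t.1).+1%:R^-1))).
    have od1 : O (-1) (fun t => d t + 1) by apply: OO_D => //; exact: (OO_c z01).
    by apply: OM ob (OO_M z01 (OO_M z01 od od1) (OO_M z01 om ok1)) _.
  apply: (OO_eq z01 (OO_B o1 ok1)) => t [[rp _ _ _] _ _ _].
  have m0 := dm_gt0 c0 rp.
  rewrite /rho /y1 /d -/(P t) -[(ik t.1).+1%:R]natr1 in m0 *; field.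
  by rewrite (gt_eqF m0) addrC nat1r pnatr_eq0.
have og : O 1 (fun t => ig t.1) := OO_fst (Ow_g C c0 A).
pose G1 (t : idx R * (nat -> R)) := (dQ (P t) ^+ (ik t.1).+1)`_(ii t.1).
have oG : O 3 (fun t => G1 t - ig t.1 * (1 - y2 t)).
  have s1 : O 3 (fun t => G1 t - ig t.1 + dmu (P t) * inabla t.1).
    exact: (OO_fst (window_step C c0 A)).
  (* The Stein equation at [i = n], where [k mu - n = mu (k - m)], scaled by [mu/(m var)] so as to
     eliminate the difference from [s1]. *)
  have s2 : O 3 (fun t => (dmu (P t) * ((dm (P t))^-1 * (dvar (P t))^-1)) *
     (dm (P t) * dvar (P t) * inabla t.1
       - ((ik t.1)%:R * dmu (P t) - (ii t.1)%:R) * ig t.1)).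
    by apply: OM (OO_M z01 omu (OO_M z01 om ovar)) (OO_fst (window_stein C c0 A)) _.
  apply: (OO_eq z01 (OO_B s1 s2)) => t [[rp _ _ _] _ _ E].
  have m0 := dm_gt0 c0 rp; have v0 : 0 < dvar (P t) by apply: lt_le_trans (reg_var rp).
  rewrite E -(reg_m rp) /y2 /d -/(P t) in m0 *; field.
  by rewrite (gt_eqF m0) (gt_eqF v0).
have ow : O 0 (fun t => t.2 (ik t.1)).
  apply: (OO_bnd (K := 1 + C)) => t [[rp _ _ _] wp kn _].
  by rewrite expr0z mulr1 ger0_norm ?(weight_leC c0 rp wp) ?(w_ge0 wp) // ltnW.
have or0 : O 0 rho.
  have h1 : O 0 (fun t => 1 - y1 t) by apply: OO_B; [exact: (OO_c z01)|exact: (OOw z01 oy1)].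
  apply: (OO_eq z01 (OO_D (OOw z01 orho _) h1)) => // t _; ring.
have o1y2 : O 0 (fun t => 1 - y2 t).
  by apply: OO_B; [exact: (OO_c z01)|exact: (OOw z01 oy2)].
have f1 : O 3 (fun t => rho t * (G1 t - ig t.1 * (1 - y2 t))) by apply: OM or0 oG _.
have f2 : O 3 (fun t => ig t.1 * ((1 - y2 t) * (rho t - 1 + y1 t))).
  by apply: OM og (OO_M z01 o1y2 orho) _.
have f3 : O 3 (fun t => ig t.1 * (y1 t * y2 t)) by apply: OM og (OO_M z01 oy1 oy2) _.
have f4 : O 3 (fun t => t.2 (ik t.1) * (rho t * (G1 t - ig t.1 * (1 - y2 t))
   + ig t.1 * ((1 - y2 t) * (rho t - 1 + y1 t)) + ig t.1 * (y1 t * y2 t))).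
  by apply: OM ow (OO_D (OO_D f1 f2) f3) _.
apply: (OO_eq z01 f4) => -[[p k i] w] [[/= rp _ _ _] wp kn E].
have m0 := dm_gt0 c0 rp; have v0 : 0 < dvar p by apply: lt_le_trans (reg_var rp).
have wS : w k.+1 = w k * rho (Idx p k i, w).
  by rewrite /rho /P /= mulrA -(w_rec wp kn) mulfK // pnatr_eq0.
rewrite /dU wS /G1 /ig /P /= E /dV invrK.
have -> : (k%:R - dm p) * dVi p = y1 (Idx p k i, w) + y2 (Idx p k i, w).
  rewrite /y1 /y2 /dVi /d /P /=; field; by rewrite (gt_eqF m0) (gt_eqF v0).
by ring.
Qed.

End Step.

(** * The local limit theorem *)

Section LLT.
Variable R : realType.
Variables c C : R.
Hypothesis c0 : 0 < c.
Local Notation Reg := (regular c C).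

Definition dphi (p : lltdata R) k := expR (- ((k%:R - dm p) ^+ 2 / (2 * dV p))).
(** The unknown Gaussian amplitude, read off at [k0]; it is of order z. *)
Definition dE0 p w := dU p w (dk0 p) / dphi p (dk0 p).

Lemma dphi_gt0 p k : 0 < dphi p k. Proof. exact: expR_gt0. Qed.

Lemma dphi_le1 p k : Reg p -> dphi p k <= 1.
Proof.
move=> rp; rewrite expR_le1 oppr_le0 divr_ge0 ?sqr_ge0 //.
exact: mulr_ge0 (ltW (dV_gt0 c0 rp)).
Qed.

Lemma dist0_norm (p : lltdata R) k : (dist0 p k)%:R = `|k%:R - (dk0 p)%:R| :> R.
Proof.
rewrite /dist0; have [h|h] := leqP (dk0 p) k.
  by rewrite (eqP h) addn0 natrB // ger0_norm // subr_ge0 ler_nat.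
rewrite (eqP (ltnW h)) add0n natrB ?(ltnW h) // distrC ger0_norm //.
by rewrite subr_ge0 ler_nat ltnW.
Qed.

Lemma dist0_le (p : lltdata R) k L : (dist0 p k <= L)%N -> Reg p -> `|k%:R - dm p| <= L%:R + 1.
Proof.
move=> kL rp; rewrite -(subrK (dk0 p)%:R k%:R) -addrA.
apply: le_trans (ler_normD _ _) _; apply: lerD; last exact: (dk0_near c0 rp).
by rewrite -dist0_norm ler_nat.
Qed.

Lemma dist0_ge (p : lltdata R) k L : (L < dist0 p k)%N -> Reg p -> L%:R <= `|k%:R - dm p|.
Proof.
move=> kL rp; have := dk0_near c0 rp.
have : L%:R + 1 <= `|k%:R - (dk0 p)%:R| :> R by rewrite -dist0_norm natr1 ler_nat.
have := ler_normB (k%:R - dm p) ((dk0 p)%:R - dm p).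
have -> : k%:R - dm p - ((dk0 p)%:R - dm p) = k%:R - (dk0 p)%:R by ring.
by move: `|_| `|_| `|_| => x y z; lra.
Qed.

Lemma dU_ge0 p w k : Reg p -> weight p w -> (k <= dn p)%N -> 0 <= dU p w k.
Proof.
move=> rp wp kn; rewrite mulr_ge0 ?(w_ge0 wp) //.
by apply: nnegpX; exact: (dQ_nneg rp).
Qed.

(** For n large the window lies inside [[0, n)], where both the weight recursion and the smoothness
    bounds hold; [transport] then applies with k as the moving index. Multiplying back by
    [dphi <= 1] keeps the error. *)
Lemma window_transport (A : R) : 1 <= A -> exists2 K, 0 < K & exists N,
  forall p w, Reg p -> weight p w -> (N <= dn p)%N ->
  forall L, L%:R <= A / dz p ->
  [/\ (L <= dk0 p)%N, (dk0 p + L < dn p)%N, dm p <= 2 * (dk0 p).+1%:R &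
   forall k, (dist0 p k <= L)%N -> `|dU p w k - dE0 p w * dphi p k| <= K * dz p ^ 2].
Proof.
move=> A1; have A0 : 0 < A by apply: lt_le_trans A1.
have [B B0 BE] : exists2 B, 0 < B & `|C| + 1 = B.
  by exists (`|C| + 1); rewrite // ltr_wpDl.
have B1 : 1 <= B by rewrite -BE lerDr.
have [A' A'0 A'E] : exists2 A', 0 < A' & A + 1 = A' by exists (A + 1); rewrite ?addr_gt0.
have [Ks Ks0 step] := OO_pos (@kz01 _ c C A') (llt_step C c0 A').
have [K3 K30 smooth] := late_smooth C c0.
have [v v0 Vv] := dV_lower C c0.
pose C1 := (1 + B) * K3 + Ks.
have [K K0 trans] := @transport R A' C1 v v0.
(* Below this threshold for z one has [A'/z <= m/2], because [m >= n/B], and [m + A'/z <= n],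
   because [m <= n/(1+c)]. *)
have e0 : 0 < c / ((1 + c) * (2 * (A' * B))).
  by rewrite divr_gt0 // !mulr_gt0 // addr_gt0.
have [N small] := dz_small e0.
exists K => //; exists N => p w rp wp Np L LA.
have C0 := C_gt0 c0 rp; have CB : C <= B by rewrite -BE (gtr0_norm C0) lerDl.
have z0 := dz_gt0 rp; have z1 := dz_le1 rp; have n0 := dn_gt0 rp.
have m0 := dm_gt0 c0 rp.
have zn : (dz p)^-1 = dz p * (dn p)%:R.
  by rewrite dnE -invr_expz -exprnP; field; rewrite gt_eqF.
have zi1 : 1 <= (dz p)^-1 by rewrite invf_ge1.
have hz : dz p * (2 * (A' * B)) <= c / (1 + c).
  have c10 : 0 < 1 + c by rewrite addr_gt0.
  have X0 : 0 < 2 * (A' * B) by rewrite !mulr_gt0.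
  have := small p Np; rewrite (ler_pdivlMr _ _ (mulr_gt0 c10 X0)) (ler_pdivlMr _ _ c10).
  by rewrite -mulrA [X in _ * X <= _ -> _]mulrC.
have c1 : c / (1 + c) < 1 by rewrite ltr_pdivrMr ?addr_gt0 // mul1r ltrDr.
have mB : (dn p)%:R / B <= dm p.
  rewrite (dmE c0 rp) ler_pM2l // lef_pV2 ?posrE ?(dmu_gt0 c0 rp) //.
  by apply: le_trans CB; case/andP: (reg_mu rp).
have A'z : A' / dz p <= dm p / 2.
  rewrite zn mulrA ler_pdivlMr //; apply: le_trans mB; rewrite ler_pdivlMr //.
  have -> : A' * dz p * (dn p)%:R * 2 * B = dz p * (2 * (A' * B)) * (dn p)%:R by ring.
  by rewrite ler_piMl ?(ltW n0) // (le_trans hz) // ltW.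
have AzA' : A / dz p + 1 <= A' / dz p by rewrite -A'E mulrDl mul1r lerD2l.
have Ln : dm p + A' / dz p <= (dn p)%:R.
  apply: (@le_trans _ _ ((dn p)%:R / (1 + c) + c / (1 + c) * (dn p)%:R)); last first.
    by rewrite le_eqVlt; apply/orP; left; apply/eqP; field; rewrite gt_eqF // addr_gt0.
  apply: lerD; first exact: (dm_le c0 rp).
  rewrite zn mulrA ler_pM2r //; apply: le_trans hz; rewrite mulrC ler_pM2l //.
  by rewrite mulrCA ler_peMr ?(ltW A'0) //; lra.
have k0m := dk0_le c0 rp; have mk0 := dk0_gt p.
have Lk0 : (L <= dk0 p)%N.
  rewrite -ltnS -(ltr_nat R) -[(dk0 p).+1%:R]natr1; move: LA AzA' A'z m0 mk0.
  by move: (A / _) (A' / _) (L%:R : R) (dm p) ((dk0 p)%:R : R) => a b l m k; clear; lra.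
have kLn : (dk0 p + L < dn p)%N.
  rewrite -(ler_nat R) -natr1 natrD; move: LA AzA' Ln k0m.
  by move: (A / _) (A' / _) (L%:R : R) (dm p) ((dk0 p)%:R : R) => a b l m k; clear; lra.
have distr k : (dk0 p - L <= k <= dk0 p + L)%N -> (dist0 p k <= L)%N.
  by rewrite /dist0; clear -Lk0; lia.
have win k : (dist0 p k <= L)%N -> `|k%:R - dm p| <= A' / dz p.
  by move=> /dist0_le /(_ rp) h; apply: le_trans h _; apply: le_trans AzA'; rewrite lerD2r.
have late2 k : (dist0 p k <= L)%N -> dm p <= 2 * k.+1%:R.
  move=> /win; rewrite ler_norml -[k.+1%:R]natr1; move: A'z.
  by move: (A' / _) (k%:R : R) (dm p) => a b m; clear; lra.
split=> //; first by apply: late2; rewrite /dist0 subnn.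
have kn k : (dist0 p k <= L)%N -> (k < dn p)%N by rewrite /dist0; clear -kLn; lia.
have H1 k : (dk0 p - L <= k <= dk0 p + L)%N ->
    `|k%:R - dm p| <= A' / dz p /\ `|dU p w k| <= C1 * dz p.
  move=> /distr kL; split; first exact: win.
  have [g _ _] := smooth (Idx p k (dn p)) (conj rp (late2 _ kL)).
  have kln := ltnW (kn _ kL).
  rewrite normrM /C1 mulrDl -mulrA; apply: ler_wpDr; first by rewrite mulr_ge0 // ltW.
  apply: ler_pM => //; rewrite ger0_norm ?(w_ge0 wp) //.
  by apply: le_trans (weight_leC c0 rp wp kln) _; rewrite lerD2l.
have H2 k : (dk0 p - L <= k < dk0 p + L)%N ->
    `|dU p w k.+1 - dU p w k * (1 - (k%:R - dm p) / dV p)| <= C1 * dz p ^ 3.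
  move=> hk; have kL : (dist0 p k <= L)%N by apply: distr; move: hk; clear; lia.
  have kd : kdom c C A' (Idx p k (dn p), w).
    split=> //=; last exact: kn.
    split=> //=; [exact: win|by rewrite subrr normr0 divr_ge0 // ltW|exact: late2].
  apply: le_trans (step _ kd) _; rewrite /kz /iz /= ler_wpM2r ?exprz_ge0 ?(ltW z0) //.
  by rewrite /C1 ler_wpDl // mulr_ge0 ?addr_ge0 // ltW.
move=> k kL.
have hk : (dk0 p - L <= k <= dk0 p + L)%N by move: kL; rewrite /dist0; clear -Lk0; lia.
have hk0 : (dk0 p - L <= dk0 p <= dk0 p + L)%N by rewrite leq_subr leq_addr.
have := trans _ (dm p) (dV p) (dU p w) _ _ (dz01 rp) (Vv p rp) H1 H2 k (dk0 p) hk hk0.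
set t := K * _ => h.
have ek j : expR ((j%:R - dm p) ^+ 2 / (2 * dV p)) = (dphi p j)^-1.
  by rewrite /dphi expRN invrK.
rewrite !ek -/(dE0 p w) in h.
have -> : dU p w k - dE0 p w * dphi p k = (dU p w k / dphi p k - dE0 p w) * dphi p k.
  by rewrite mulrBl divfK // gt_eqF // dphi_gt0.
rewrite normrM (ger0_norm (ltW (dphi_gt0 p k))).
by apply: le_trans h; rewrite ler_piMr // dphi_le1.
Qed.

Lemma expRN_dist (a b : R) : 0 <= a -> 0 <= b -> `|expR (- a) - expR (- b)| <= `|a - b|.
Proof.
move=> a0 b0; have [ab|/ltW ba] := leP a b.
  by apply: le_trans (expRN_lip a0 ab) _; rewrite distrC ler_norm.
by rewrite distrC; apply: le_trans (expRN_lip b0 ba) _; exact: ler_norm.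
Qed.

(** Recentring from m to the integer k0 changes each exponent by at most [(2L+1)/(2V)], in total
    [O(1)] since [L^2] and V are both of order n; then [gauss_sum] applies to the two halves. [Y]
    depends on [e] alone, because [A] is chosen larger than it afterwards. *)
Lemma phi_sum (e : R) : 0 < e -> exists2 Y, 0 < Y & forall A, 0 < A -> exists2 K, 0 < K &
  forall p L, Reg p -> Y / dz p <= L%:R -> L%:R <= A / dz p -> (L <= dk0 p)%N ->
  `|\sum_(dk0 p - L <= k < (dk0 p + L).+1) dphi p k - Num.sqrt (2 * pi * dV p)|
     <= e / dz p + K.
Proof.
move=> e0; have e40 : 0 < e / 4 by rewrite divr_gt0.
have [Yg Yg0 gs] := gauss_sum e40.
have [v v0 Vv] := dV_lower C c0.
exists (2 * Yg) => [|A A0]; first by rewrite mulr_gt0.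
exists ((A + 1) ^+ 2 / v + 1 + (2 * A + 1) ^+ 2 / (2 * v)).
  rewrite addr_gt0 // ?addr_gt0 // divr_gt0 ?exprn_gt0 ?addr_gt0 ?mulr_gt0 //.
move=> p L rp YL LA Lk; have V0 := dV_gt0 c0 rp.
have z0 := dz_gt0 rp; have z1 := dz_le1 rp.
have zi1 : 1 <= (dz p)^-1 by rewrite invf_ge1.
set V := dV p in V0 *; set z := dz p in z0 z1 zi1 YL LA *.
have Vz : V <= (z ^+ 2)^-1 by have := dV_le c0 rp; rewrite -invr_expz -exprnP.
have vV : v * (z ^+ 2)^-1 <= V by have := Vv p rp; rewrite -invr_expz -exprnP.
have V20 : 0 < 2 * V by rewrite mulr_gt0.
have u2 : Num.sqrt (2 * V) <= 2 / z.
  rewrite -(@ler_pXn2r _ 2) ?nnegrE ?sqrtr_ge0 ?divr_ge0 ?(ltW z0) // sqr_sqrtr ?(ltW V20) //.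
  rewrite expr_div_n; move: Vz; move: (z ^+ 2)^-1 => x h; rewrite -[2 ^+ 2]natrX.
  by have h0 := le_trans (ltW V0) h; lra.
have iV : V^-1 <= z ^+ 2 / v.
  have t0 : 0 < v / z ^+ 2 by exact: divr_gt0 v0 (exprn_gt0 2 z0).
  by rewrite -[leRHS]invf_div lef_pV2 ?posrE.
pose f (d : nat) := expR (- (d%:R ^+ 2 / (2 * V))).
have h1 := gs V L.+1 V0.
have {}h1 : `|\sum_(d < L.+1) f d - Num.sqrt (2 * V) * (Num.sqrt pi / 2)|
    <= e / 4 * Num.sqrt (2 * V) + L.+1%:R ^+ 2 / (2 * V).
  apply: h1; apply: (@le_trans _ _ L%:R); last by rewrite ler_nat.
  apply: le_trans YL; rewrite -mulrA mulrCA; apply: ler_wpM2l; first exact: ltW.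
  exact: u2.
have fs := window_sum_dist f Lk.
have sq : Num.sqrt (2 * pi * V) = Num.sqrt (2 * V) * Num.sqrt pi.
  by rewrite -sqrtrM ?(ltW V20) //; congr Num.sqrt; ring.
have q2 (x : R) : 0 <= x ^+ 2 / (2 * dV p) by exact: divr_ge0 (sqr_ge0 _) (ltW V20).
have dif : `|\sum_(dk0 p - L <= k < (dk0 p + L).+1) dphi p k -
   \sum_(dk0 p - L <= k < (dk0 p + L).+1) f ((k - dk0 p) + (dk0 p - k))%N|
   <= (2 * L%:R + 1) ^+ 2 / (2 * V).
  rewrite -sumrB; apply: le_trans (ler_norm_sum _ _ _) _.
  apply: (@le_trans _ _ (\sum_(dk0 p - L <= k < (dk0 p + L).+1) ((2 * L%:R + 1) / (2 * V)))).
    rewrite big_nat [leRHS]big_nat; apply: ler_sum => k /andP[ka kb].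
    apply: le_trans (expRN_dist (q2 _) (q2 _)) _.
    rewrite -/V -mulrBl normrM [X in _ * X]gtr0_norm ?invr_gt0 // ler_pM2r ?invr_gt0 //.
    rewrite -/(dist0 p k) dist0_norm real_normK ?num_real //.
    have kL : (dist0 p k <= L)%N by rewrite /dist0; move: ka kb Lk; clear; lia.
    have -> : (k%:R - dm p) ^+ 2 - (k%:R - (dk0 p)%:R) ^+ 2 =
      ((dk0 p)%:R - dm p) * (2 * (k%:R - (dk0 p)%:R) + ((dk0 p)%:R - dm p)) by ring.
    have n1 := dk0_near c0 rp.
    rewrite normrM -[leRHS]mul1r; apply: ler_pM => //.
    apply: le_trans (ler_normD _ _) _; apply: lerD => //.
    by rewrite normrM ger0_norm // ler_pM2l // -dist0_norm ler_nat.
  rewrite sumr_const_nat -[_ *+ _]mulr_natr expr2 mulrAC ler_pM2r ?invr_gt0 //.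
  rewrite ler_pM2l; last by rewrite ltr_wpDl // mulr_ge0.
  by rewrite -[2]/(2%:R) -natrM natr1 ler_nat; move: Lk; clear; lia.
have f0 : f 0%N = 1 by rewrite /f expr0n mul0r oppr0 expR0.
rewrite fs f0 in dif.
have nA : 0 <= (2 * A + 1) / z.
  by rewrite divr_ge0 ?(ltW z0) // addr_ge0 // mulr_ge0 // ltW.
have nA1 : 0 <= (A + 1) / z by rewrite divr_ge0 ?(ltW z0) // addr_ge0 // ltW.
have le1 : 2 * L%:R + 1 <= (2 * A + 1) / z.
  have -> : (2 * A + 1) / z = 2 * (A / z) + z^-1 by ring.
  move: LA zi1.
  by move: (A / z) (z^-1) (L%:R : R) => a b l; lra.
have le2 : L.+1%:R <= (A + 1) / z.
  have -> : (A + 1) / z = A / z + z^-1 by ring.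
  rewrite -[L.+1%:R]natr1; move: LA zi1.
  by move: (A / z) (z^-1) (L%:R : R) => a b l; lra.
have b1 : (2 * L%:R + 1) ^+ 2 / (2 * V) <= (2 * A + 1) ^+ 2 / (2 * v).
  apply: (@le_trans _ _ (((2 * A + 1) / z) ^+ 2 * (z ^+ 2 / v / 2))); last first.
    by rewrite le_eqVlt; apply/orP; left; apply/eqP; field; rewrite (gt_eqF z0) (gt_eqF v0).
  rewrite invfM [2^-1 * _]mulrC; apply: ler_pM; rewrite ?sqr_ge0 //.
  - by rewrite divr_ge0 // invr_ge0 ltW.
  - by rewrite lerXn2r ?nnegrE // addr_ge0 // mulr_ge0.
  - by apply: ler_wpM2r iV; rewrite invr_ge0.
have b2 : L.+1%:R ^+ 2 / (2 * V) <= (A + 1) ^+ 2 / (2 * v).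
  apply: (@le_trans _ _ (((A + 1) / z) ^+ 2 * (z ^+ 2 / v / 2))); last first.
    by rewrite le_eqVlt; apply/orP; left; apply/eqP; field; rewrite (gt_eqF z0) (gt_eqF v0).
  rewrite invfM [2^-1 * _]mulrC; apply: ler_pM; rewrite ?sqr_ge0 //.
  - by rewrite divr_ge0 // invr_ge0 ltW.
  - by rewrite lerXn2r ?nnegrE.
  - by apply: ler_wpM2r iV; rewrite invr_ge0.
have b3 : e / 4 * Num.sqrt (2 * V) <= e / z / 2.
  by move: u2; rewrite -(ler_pM2l e40); move: (_ * Num.sqrt _) => x; rewrite mulrA;
     have -> : e / 4 * 2 / z = e / z / 2 by field; rewrite gt_eqF.
have b4 : (A + 1) ^+ 2 / v = 2 * ((A + 1) ^+ 2 / (2 * v)).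
  by field; rewrite gt_eqF.
rewrite sq b4; move: dif h1 b1 b2 b3; rewrite !ler_norml.
set S1 := \sum_(_ <= _ < _) _; set S2 := \sum_(_ < _) _; set q := Num.sqrt _ * (_ / 2).
have -> : Num.sqrt (2 * V) * Num.sqrt pi = 2 * q by rewrite /q; field.
move: (e / 4 * _) (L.+1%:R ^+ 2 / _) ((2 * L%:R + 1) ^+ 2 / _) ((2 * A + 1) ^+ 2 / _).
move: ((A + 1) ^+ 2 / _) (e / z) S1 S2 q => x1 x2 x3 x4 x5 x6 x7 x8 x9; clear; lra.
Qed.

End LLT.

Section LLT.
Variable R : realType.
Variables c C : R.
Hypothesis c0 : 0 < c.
Local Notation Reg := (regular c C).

Lemma window_split p w L : Reg p -> weight p w -> (L <= dk0 p)%N -> (dk0 p + L <= dn p)%N ->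
  \sum_(k < (dn p).+1) dU p w k = \sum_(dk0 p - L <= k < (dk0 p + L).+1) dU p w k
    + \sum_(k < (dn p).+1) (L < dist0 p k)%N%:R * dU p w k.
Proof.
move=> rp wp Lk kn; rewrite -(window_sum (dU p w) Lk kn) -big_split /=.
apply: eq_bigr => k _; rewrite -mulrDl -/(dist0 p k) ltnNge -natrD.
by case: (_ <= _)%N; rewrite ?mul1r.
Qed.

Lemma tail_mass : exists2 K : R, 0 < K & forall p w L, Reg p -> weight p w -> (0 < L)%N ->
  \sum_(k < (dn p).+1) (L < dist0 p k)%N%:R * dU p w k <= K / dz p / L%:R.
Proof.
have [K K0 tail] := tail_bound C c0.
exists (2 * K) => [|p w L rp wp L0]; first by rewrite mulr_gt0.
have Kz : 0 <= K / dz p by rewrite divr_ge0 // ltW // (dz_gt0 rp).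
have -> : 2 * K / dz p / L%:R = K / dz p * (2 / L%:R) by ring.
apply: le_trans (ler_wpM2l Kz (tail_sum R (dk0 p) (dn p).+1 L0)).
rewrite mulr_sumr; apply: ler_sum => k _; rewrite -/(dist0 p k).
case: ltnP => Lk; last by rewrite !mul0r mulr0.
rewrite mul1r div1r; apply: tail => //; last exact: leq_trans Lk.
by rewrite -ltnS ltn_ord.
Qed.

(** Summing the Gaussian approximation gives [Z = dE0 sqrt(2 pi V)] up to a small error, which
    determines the amplitude. [coef_lower] keeps both sides away from zero, so division by Z
    preserves the errors. Beyond the window the two terms are small separately. *)
Theorem llt (e : R) : 0 < e -> exists N, forall p w, Reg p -> weight p w -> (N <= dn p)%N ->
  let Z := \sum_(k < (dn p).+1) dU p w k in
  0 < Z /\ forall k, (k <= dn p)%N ->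
  `|dU p w k / Z - dphi p k / Num.sqrt (2 * pi * dV p)| <= e * dz p.
Proof.
move=> e0.
have [v v0 Vv] := dV_lower C c0.
have [c1 c10 [N1 lower]] := coef_lower C c0.
have [K3 K30 smooth] := late_smooth C c0.
have [KT KT0 tail] := tail_bound C c0.
have [KM KM0 tailM] := tail_mass.
have [q q0 qE] : exists2 q, 0 < q & Num.sqrt (2 * pi * v) = q.
  by exists (Num.sqrt (2 * pi * v)); rewrite // sqrtr_gt0 !mulr_gt0 ?pi_gt0.
have [KE KE0 KEE] : exists2 K, 0 < K & K3 * expR (1 / (2 * v)) = K.
  by exists (K3 * expR (1 / (2 * v))); rewrite // mulr_gt0 // expR_gt0.
have [c2 c20 c2E] : exists2 c2, 0 < c2 & c1 * q = c2 by exists (c1 * q); rewrite ?mulr_gt0.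
(* [h] is the tolerated error in Z: at most [c2/2], to keep [Z >= c2/2], and at most [e c2 q/4], so
   that normalisation costs no more than [e z/2]. It is shared in thirds by the tail mass, the
   Gaussian sum and the [O(z)] errors. *)
have [h [h0 h1 h2]] : exists h, [/\ 0 < h, h <= c2 / 2 & h <= e * c2 * q / 4].
  exists (Num.min (c2 / 2) (e * c2 * q / 4)); rewrite lt_min !ge_min !lexx orbT.
  by rewrite !divr_gt0 ?mulr_gt0.
(* The Gaussian sum is multiplied by the amplitude, at most [KE z], so a relative error [h/(3 KE)]
   against [1/z] becomes [h/3]. *)
have e10 : 0 < h / (3 * KE) by rewrite divr_gt0 // mulr_gt0.
have [Y Y0 phi] := phi_sum C c0 e10.
(* The window half-width is about [Y'/z]. The bounds on [Y'] serve, in order, the Gaussian sum, the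
   inequality [Y' <= Y'^2], the tail mass [h/3], and the pointwise bound [e z] outside the
   window. *)
have [Y' [YY' Y'1 Y'2 Y'3]] : exists Y', [/\ Y <= Y', 1 <= Y', 3 * KM / h <= Y' &
     (2 * KT / c2 + 2 / q) / e <= Y'].
  have a1 : 0 <= 3 * KM / h by rewrite divr_ge0 ?mulr_ge0 ?(ltW h0) // ltW.
  have a2 : 0 <= (2 * KT / c2 + 2 / q) / e.
    by rewrite divr_ge0 ?(ltW e0) // addr_ge0 // divr_ge0 ?mulr_ge0 ?(ltW KT0) // ltW.
  exists (Y + 1 + 3 * KM / h + (2 * KT / c2 + 2 / q) / e).
  by move: (3 * KM / h) ((_ + _) / e) a1 a2 => x y x0 y0; split; lra.
have Y'0 : 0 < Y' by apply: lt_le_trans Y'1.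
have [A A1 AE] : exists2 A, 1 <= A & Y' + 1 = A by exists (Y' + 1); rewrite // lerDr ltW.
have A0 : 0 < A by apply: lt_le_trans A1.
have [K2 K20 {}phi] := phi A A0.
have [KA KA0 [N2 trans]] := window_transport C c0 A1.
have [KB KB0 KBE] : exists2 K, 0 < K & (2 * A + 1) * KA + KE * K2 = K.
  exists ((2 * A + 1) * KA + KE * K2) => //.
  by rewrite addr_gt0 ?mulr_gt0 // ltr_wpDl // mulr_ge0 // ltW.
have d1 : 0 < h / (3 * KB) by rewrite divr_gt0 // mulr_gt0.
have d2 : 0 < e * c2 / (4 * KA) by rewrite divr_gt0 ?mulr_gt0.
have [N3 small1] := dz_small d1; have [N4 small2] := dz_small d2.
exists (maxn (maxn N1 N2) (maxn N3 N4)) => p w rp wp.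
rewrite !geq_max => /andP[/andP[NN1 NN2] /andP[NN3 NN4]] Z.
have := dk0_near c0 rp; have := lower p (dk0 p) rp NN1.
have := small1 p NN3; have := small2 p NN4.
have z0 := dz_gt0 rp; have z1 := dz_le1 rp; have V0 := dV_gt0 c0 rp.
have Vz := dV_le c0 rp; have {Vv}Vv := Vv p rp.
have := tailM p w _ rp wp; have := phi p _ rp; have := trans p w rp wp NN2.
have := fun k => tail p w k rp wp.
rewrite -!invr_expz -!exprnP in Vz Vv *.
set z := dz p in z0 z1 Vz Vv * => {}tail {}trans {}phi {}tailM zs2 zs1 {}lower k0m.
have zi1 : 1 <= z^-1 by rewrite invf_ge1.
pose L := (Num.truncn (Y' / z)).+1.
have YL : Y' / z <= L%:R by rewrite ltW // truncnS_gt.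
have LA : L%:R <= A / z.
  rewrite -AE mulrDl mul1r /L -natr1; apply: lerD => //.
  by rewrite truncn_le divr_ge0 // ltW.
have [Lk kL mk {}trans] := trans L LA.
have L0 : (0 < L)%N by [].
have S0 : 0 < Num.sqrt (2 * pi * dV p) by rewrite sqrtr_gt0 !mulr_gt0 ?pi_gt0.
set S := Num.sqrt (2 * pi * dV p) in S0 *.
have Sq : q / z <= S.
  rewrite -(@ler_pXn2r _ 2) ?nnegrE ?(ltW S0) ?divr_ge0 ?(ltW q0) ?(ltW z0) //.
  rewrite expr_div_n -qE !sqr_sqrtr ?mulr_ge0 ?pi_ge0 ?(ltW v0) ?(ltW V0) //.
  by rewrite -[leLHS]mulrA ler_wpM2l // mulr_ge0 ?pi_ge0.
have V2 : 0 < 2 * dV p by rewrite mulr_gt0.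
have U0 : dU p w (dk0 p) = (dQ p ^+ dk0 p)`_(dn p) by rewrite /dU (w_k0 wp) mul1r.
have {}lower : c1 * z <= dU p w (dk0 p) by rewrite U0; exact: lower.
have ph0 := dphi_gt0 p (dk0 p); have ph1 := dphi_le1 c0 (dk0 p) rp.
have E0l : c1 * z <= dE0 p w.
  rewrite /dE0 ler_pdivlMr //; apply: le_trans lower.
  by rewrite ler_piMr // mulr_ge0 // ltW.
have E0u : dE0 p w <= KE * z.
  have Vv1 : v <= dV p.
    apply: le_trans Vv; rewrite ler_peMr ?(ltW v0) // invf_ge1 ?exprn_gt0 //.
    by rewrite exprn_ile1 // ltW.
  have [g _ _] := smooth (Idx p (dk0 p) (dn p)) (conj rp mk).
  rewrite /dE0 -KEE [leRHS]mulrAC; apply: ler_pM.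
  - by rewrite U0; apply: nnegpX; exact: (dQ_nneg rp).
  - by rewrite invr_ge0 ltW.
  - by rewrite U0; apply: le_trans (ler_norm _) g.
  - rewrite /dphi expRN invrK ler_expR; apply: ler_pM; rewrite ?sqr_ge0 //.
    + by rewrite invr_ge0 ltW.
    + by rewrite -(real_normK (num_real _)) distrC exprn_ile1 // distrC.
    + by rewrite lef_pV2 ?posrE ?mulr_gt0 // ler_pM2l.
have E00 : 0 < dE0 p w by apply: lt_le_trans E0l; rewrite mulr_gt0.
have T1 : \sum_(k < (dn p).+1) (L < dist0 p k)%N%:R * dU p w k <= h / 3.
  apply: le_trans (tailM L L0) _.
  have YLi : KM / z / L%:R <= KM / Y'.
    rewrite -mulrA; apply: ler_wpM2l; first exact: ltW.
    by rewrite -invfM lef_pV2 ?posrE ?mulr_gt0 ?ltr0n // mulrC -ler_pdivrMr.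
  apply: le_trans YLi _; rewrite ler_pdivrMr //; move: Y'2; rewrite ler_pdivrMr //.
  by move: (Y' * h) (mulrC h Y') => x E; rewrite mulrAC E; lra.
have T1' : 0 <= \sum_(k < (dn p).+1) (L < dist0 p k)%N%:R * dU p w k.
  apply: sumr_ge0 => k _; rewrite mulr_ge0 //; apply: (dU_ge0 rp wp).
  by rewrite -ltnS ltn_ord.
have T2 : `|\sum_(dk0 p - L <= k < (dk0 p + L).+1) dU p w k -
   dE0 p w * \sum_(dk0 p - L <= k < (dk0 p + L).+1) dphi p k| <= (2 * A + 1) * KA * z.
  rewrite mulr_sumr -sumrB; apply: le_trans (ler_norm_sum _ _ _) _.
  apply: (@le_trans _ _ (\sum_(dk0 p - L <= k < (dk0 p + L).+1) (KA * z ^+ 2))).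
    rewrite big_nat [leRHS]big_nat; apply: ler_sum => k /andP[ka kb].
    by apply: trans; rewrite /dist0; move: ka kb Lk; clear; move: L => L'; lia.
  rewrite sumr_const_nat -[_ *+ _]mulr_natr.
  have cnt : ((dk0 p + L).+1 - (dk0 p - L))%:R <= (2 * A + 1) / z :> R.
    apply: (@le_trans _ _ (2 * L%:R + 1)).
      by rewrite -[2]/(2%:R) -natrM natr1 ler_nat; move: Lk; clear; move: L => L'; lia.
    have -> : (2 * A + 1) / z = 2 * (A / z) + z^-1 by ring.
    by move: LA zi1; move: (A / z) z^-1 (L%:R : R) => a b l; lra.
  apply: le_trans (ler_wpM2l _ cnt) _; first by rewrite mulr_ge0 ?sqr_ge0 // ltW.
  by rewrite le_eqVlt; apply/orP; left; apply/eqP; field; rewrite gt_eqF.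
have T3 := phi L (le_trans (ler_wpM2r (ltW (lt_le_trans ltr01 zi1)) YY') YL) LA Lk.
have T3' : `|dE0 p w * \sum_(dk0 p - L <= k < (dk0 p + L).+1) dphi p k - dE0 p w * S|
    <= h / 3 + KE * K2 * z.
  rewrite -mulrBr normrM (gtr0_norm E00).
  apply: (@le_trans _ _ (KE * z * (h / (3 * KE) / z + K2))).
    by apply: ler_pM => //; exact: ltW.
  by rewrite le_eqVlt; apply/orP; left; apply/eqP; field; rewrite (gt_eqF z0) (gt_eqF KE0).
have zs1' : KB * z <= h / 3.
  apply: le_trans (ler_wpM2l (ltW KB0) zs1) _.
  by rewrite le_eqVlt; apply/orP; left; apply/eqP; field; rewrite gt_eqF.
have ZE : `|Z - dE0 p w * S| <= h.
  rewrite /Z (window_split rp wp Lk (ltnW kL)).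
  have kb : KB * z = (2 * A + 1) * KA * z + KE * K2 * z by rewrite -KBE; ring.
  move: T1 T1' T2 T3' zs1'; rewrite kb !ler_norml.
  set x1 := \sum_(_ < _) _; set x2 := \sum_(_ <= _ < _) dU p w _.
  move: (dE0 p w * \sum_(_ <= _ < _) _) (dE0 p w * S) ((2 * A + 1) * KA * z) (KE * K2 * z).
  by move: x1 x2 => x1 x2 x3 x4 x5 x6; lra.
have ES : c2 <= dE0 p w * S.
  rewrite -c2E; apply: (@le_trans _ _ ((c1 * z) * (q / z))).
    by rewrite le_eqVlt; apply/orP; left; apply/eqP; field; rewrite gt_eqF.
  by apply: ler_pM => //; rewrite ?divr_ge0 ?mulr_ge0 // ltW.
have Z2 : c2 / 2 <= Z.
  by move: ZE; rewrite ler_norml; move: (dE0 p w * S) ES h1 => x; lra.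
have Z0 : 0 < Z by apply: lt_le_trans Z2; rewrite divr_gt0.
have iZ : Z^-1 <= 2 / c2 by rewrite -[leRHS]invf_div lef_pV2 ?posrE ?divr_gt0.
have iS : S^-1 <= z / q by rewrite -[leRHS]invf_div lef_pV2 ?posrE ?divr_gt0.
split=> // k kn.
have pk0 := dphi_gt0 p k; have pk1 := dphi_le1 c0 k rp.
have [kL'|kL'] := leqP (dist0 p k) L.
  have -> : dU p w k / Z - dphi p k / S =
     (dU p w k - dE0 p w * dphi p k) / Z + dphi p k * ((dE0 p w * S - Z) / Z / S).
    by field; rewrite (gt_eqF Z0) (gt_eqF S0).
  apply: le_trans (ler_normD _ _) _.
  have -> : e * z = e * z / 2 + e * z / 2 by field.
  apply: lerD.
    rewrite normrM normfV (gtr0_norm Z0).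
    apply: (@le_trans _ _ (KA * z ^+ 2 * (2 / c2))).
      by apply: ler_pM => //; [rewrite invr_ge0 ltW|exact: trans].
    have -> : KA * z ^+ 2 * (2 / c2) = z * (KA * z * 2 / c2) by ring.
    have -> : e * z / 2 = z * (e / 2) by ring.
    rewrite (ler_pM2l z0) (ler_pdivrMr _ _ c20).
    move: zs2; rewrite ler_pdivlMr ?mulr_gt0 // => zs2.
    have -> : KA * z * 2 = z * (4 * KA) / 2 by field.
    have -> : e / 2 * c2 = e * c2 / 2 by field.
    by apply: ler_wpM2r zs2; rewrite invr_ge0.
  rewrite normrM (gtr0_norm pk0) -[leRHS]mul1r.
  apply: ler_pM => //; first exact: ltW.
  rewrite !normrM !normfV (gtr0_norm Z0) (gtr0_norm S0) distrC.
  apply: (@le_trans _ _ (e * c2 * q / 4 * (2 / c2) * (z / q))).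
    apply: ler_pM => //; rewrite ?mulr_ge0 ?invr_ge0 ?(ltW Z0) ?(ltW S0) //.
    by apply: ler_pM => //; rewrite ?invr_ge0 ?(ltW Z0) // (le_trans ZE).
  by rewrite le_eqVlt; apply/orP; left; apply/eqP; field; rewrite (gt_eqF c20) (gt_eqF q0).
have d2' : (2 <= dist0 p k)%N by apply: leq_trans kL'.
have Lz2 : Y' / z ^+ 2 <= L%:R ^+ 2.
  apply: (@le_trans _ _ ((Y' / z) ^+ 2)).
    by rewrite expr_div_n ler_pM2r ?invr_gt0 ?exprn_gt0 // expr2 ler_peMl // ltW.
  by rewrite lerXn2r // nnegrE ?divr_ge0 // ltW.
have Yz0 : 0 < Y' / z ^+ 2 by rewrite divr_gt0 // exprn_gt0.
have UB : dU p w k <= KT * z / Y'.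
  apply: le_trans (tail k kn d2') _.
  have -> : KT * z / Y' = KT / z / (Y' / z ^+ 2).
    by field; rewrite (gt_eqF z0) (gt_eqF Y'0).
  rewrite ler_wpM2l ?divr_ge0 ?(ltW KT0) ?(ltW z0) //.
  have dd : L%:R + 1 <= (dist0 p k)%:R :> R by rewrite natr1 ler_nat.
  have L0' : 0 <= L%:R :> R by [].
  have Ld : L%:R ^+ 2 <= (dist0 p k)%:R * ((dist0 p k)%:R - 1) :> R.
    by rewrite expr2; move: dd L0'; move: (L%:R : R) ((dist0 p k)%:R : R) => l d dd l0;
       apply: ler_pM; lra.
  have le1 := le_trans Lz2 Ld.
  by rewrite lef_pV2 ?posrE // (lt_le_trans Yz0).
have PB : dphi p k <= 2 / Y'.
  have Lm := dist0_ge c0 kL' rp.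
  have x0 : Y' / 2 <= (k%:R - dm p) ^+ 2 / (2 * dV p).
    rewrite ler_pdivlMr //; apply: (@le_trans _ _ (L%:R ^+ 2)).
      apply: le_trans Lz2; rewrite mulrA divfK ?pnatr_eq0 //.
      by rewrite ler_pM2l.
    by rewrite -(real_normK (num_real (_ - _))) lerXn2r // nnegrE.
  have x1 : 0 < (k%:R - dm p) ^+ 2 / (2 * dV p) by apply: lt_le_trans x0; rewrite divr_gt0.
  rewrite /dphi expRN -[leRHS]invf_div lef_pV2 ?posrE ?expR_gt0 ?divr_gt0 //.
  by apply: le_trans x0 _; apply: le_trans (expR_ge1Dx _); rewrite lerDr.
apply: (@le_trans _ _ (dU p w k / Z + dphi p k / S)).
  have u0 : 0 <= dU p w k / Z by exact: divr_ge0 (dU_ge0 rp wp kn) (ltW Z0).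
  have p0 : 0 <= dphi p k / S by exact: divr_ge0 (ltW pk0) (ltW S0).
  by apply: le_trans (ler_normB _ _) _; rewrite (ger0_norm u0) (ger0_norm p0).
apply: (@le_trans _ _ (KT * z / Y' * (2 / c2) + 2 / Y' * (z / q))).
  have uk := dU_ge0 rp wp kn.
  by apply: lerD; apply: ler_pM => //; rewrite ?invr_ge0 ltW.
have -> : KT * z / Y' * (2 / c2) + 2 / Y' * (z / q) = (2 * KT / c2 + 2 / q) / Y' * z.
  by field; rewrite (gt_eqF Y'0) (gt_eqF c20) (gt_eqF q0).
rewrite (ler_pM2r z0) (ler_pdivrMr _ _ Y'0).
by move: Y'3; rewrite (ler_pdivrMr _ _ e0) [Y' * e]mulrC.
Qed.

End LLT.

(** * Regularity from moment estimates *)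

Section RegularI.
Variable R : realType.

(** Lower bounds for mean and variance come from the masses at 1 and 2: [M1 - M0 >= q_2], and the
    spread about [mu] is at least [c'/2]. For n beyond the chosen N the truncation errors use up at
    most half of these bounds, which leaves [c = c'/4]. *)
Lemma regularI (c' C' : R) : 0 < c' -> 0 < C' -> exists2 c, 0 < c & exists C, exists N,
  forall p : lltdata R, (N <= dn p)%N -> (forall j, 0 <= dq p j) -> dq p 0 = 0 ->
  c' <= dq p 1 -> c' <= dq p 2 -> dM p 0 <= 1 ->
  `|dM p 0 - 1| <= C' / (dn p)%:R ^+ 2 -> `|dM p 1 - dmu p| <= C' / (dn p)%:R ->
  `|dM p 2 - dnu p| <= C' / (dn p)%:R -> dM p 3 <= C' ->
  dm p * dmu p = (dn p)%:R -> 0 <= db p <= C' -> regular c C p.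
Proof.
move=> c'0 C'0; exists (c' / 4); first by rewrite divr_gt0.
exists (2 * C'); exists (Num.truncn ((8 * C' + 16 * C' ^+ 2) / c' + 2)).+1.
move=> p Np q0 q00 q1 q2 M01 M0 M1 M2 M3 m /andP[b0 bC].
have hN : (8 * C' + 16 * C' ^+ 2) / c' + 2 <= (dn p)%:R.
  by apply: le_trans (ltW (truncnS_gt _)) _; rewrite ler_nat.
have K0 : 0 <= 8 * C' + 16 * C' ^+ 2 by rewrite addr_ge0 // mulr_ge0 ?sqr_ge0 // ltW.
have K1 : 0 <= (8 * C' + 16 * C' ^+ 2) / c' by rewrite divr_ge0 // ltW.
have n2 : 2 <= (dn p)%:R :> R by move: K1 hN; move: (_ / c') => x; lra.
have n1 : (1 < dn p)%N by rewrite -(ler_nat R).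
have n0 : 0 < (dn p)%:R :> R by lra.
have hn : (8 * C' + 16 * C' ^+ 2) / (dn p)%:R <= c'.
  rewrite ler_pdivrMr // [c' * _]mulrC -ler_pdivrMr //.
  by move: hN; move: (_ / c') => x; lra.
have M1M3 : dM p 1 <= C'.
  apply: le_trans M3; apply: ler_sum => j _; apply: ler_wpM2r => //.
  by case: (nat_of_ord j) => [|i]; rewrite ?expr0n // ler_weXn2l // ler1n.
have M2M3 : dM p 2 <= C'.
  apply: le_trans M3; apply: ler_sum => j _; apply: ler_wpM2r => //.
  by case: (nat_of_ord j) => [|i]; rewrite ?expr0n // ler_weXn2l // ler1n.
have pick (F : nat -> R) : (forall j, 0 <= F j) -> F 1%N + F 2%N <= \sum_(j < (dn p).+1) F j.
  move=> F0; rewrite -(big_mkord xpredT F) big_ltn // big_ltn //; last by move: n1; clear; lia.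
  rewrite big_ltn; last by move: n1; clear; lia.
  have s0 : 0 <= \sum_(3 <= i < (dn p).+1) F i by apply: sumr_ge0.
  by have := F0 0%N; lra.
have M10 : dM p 0 + c' <= dM p 1.
  have h : \sum_(j < (dn p).+1) (j%:R - 1) * dq p j = dM p 1 - dM p 0.
    by rewrite -sumrB; apply: eq_bigr => j _; rewrite expr1 expr0; ring.
  have h0 (j : nat) : 0 <= (j%:R - 1) * dq p j.
    by case: j => [|j]; rewrite ?q00 ?mulr0 // mulr_ge0 // subr_ge0 ler1n.
  have := pick (fun j => (j%:R - 1) * dq p j) h0; rewrite h subrr mul0r add0r.
  have -> : (2%:R - 1) * dq p 2%N = dq p 2%N by ring.
  by move: q2; lra.
have var : c' / 2 <= dM p 2 - 2 * dmu p * dM p 1 + dmu p ^+ 2 * dM p 0.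
  have h : \sum_(j < (dn p).+1) (j%:R - dmu p) ^+ 2 * dq p j =
     dM p 2 - 2 * dmu p * dM p 1 + dmu p ^+ 2 * dM p 0.
    rewrite /dM /mom !mulr_sumr -sumrB -big_split /=.
    by apply: eq_bigr => j _; rewrite expr1 expr0; ring.
  have h0 (j : nat) : 0 <= (j%:R - dmu p) ^+ 2 * dq p j by rewrite mulr_ge0 ?sqr_ge0.
  rewrite -h; apply: le_trans (pick _ h0).
  (* The mean cannot be close to both 1 and 2: [(1-mu)^2 + (2-mu)^2 >= 1/2], which is
     [(2 mu - 3)^2 >= 0]. *)
  apply: (@le_trans _ _ ((1%:R - dmu p) ^+ 2 * c' + (2%:R - dmu p) ^+ 2 * c')); last first.
    by apply: lerD; rewrite ler_wpM2l ?sqr_ge0.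
  rewrite -mulrDl mulrC ler_pM2r //; have := sqr_ge0 (2 * dmu p - 3); nra.
have C'n : C' / (dn p)%:R <= c' / 8.
  apply: (@le_trans _ _ ((8 * C' + 16 * C' ^+ 2) / (dn p)%:R / 8)); last first.
    by rewrite ler_pM2r ?invr_gt0.
  rewrite mulrAC ler_pM2r ?invr_gt0 //.
  by have := sqr_ge0 C'; lra.
have C'n2 : C' / (dn p)%:R ^+ 2 <= c' / 8.
  apply: le_trans C'n; rewrite ler_pM2l // lef_pV2 ?posrE ?exprn_gt0 //.
  by rewrite expr2 ler_peMl ?(ltW n0) //; lra.
have CCn : 4 * C' * (C' / (dn p)%:R) <= c' / 4 - C' / (dn p)%:R.
  have -> : 4 * C' * (C' / (dn p)%:R) =
    (8 * C' + 16 * C' ^+ 2) / (dn p)%:R / 4 - 2 * (C' / (dn p)%:R).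
    by field; rewrite gt_eqF.
  have : 0 < C' / (dn p)%:R by rewrite divr_gt0.
  by move: hn; move: (_ / (dn p)%:R) (C' / _) => x y; lra.
have C'n1 : C' / (dn p)%:R <= C'.
  by rewrite ler_pdivrMr // ler_peMr ?(ltW C'0) //; lra.
have muC : dmu p <= 2 * C'.
  by move: M1; rewrite ler_norml; move: (C' / _) C'n1 => x; lra.
have mu0 : 1 + c' / 4 <= dmu p.
  move: M1 M0; rewrite !ler_norml; move: (C' / _) C'n (C' / _) C'n2 => x hx y hy; lra.
split=> //.
- by apply: le_trans q1; lra.
- by apply: le_trans q2; lra.
- by apply: le_trans M0 _; rewrite ler_pM2r ?invr_gt0 ?exprn_gt0 //; lra.
- by apply: le_trans M1 _; rewrite ler_pM2r ?invr_gt0 //; lra.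
- by apply: le_trans M2 _; rewrite ler_pM2r ?invr_gt0 //; lra.
- by lra.
- by rewrite mu0.
- have M20 : 0 <= dM p 2 by apply: mom_ge0.
  by move: M2; rewrite !ler_norml; move: (C' / _) C'n1 => x; lra.
- have a1 : `|2 * dmu p * (dM p 1 - dmu p)| <= 4 * C' * (C' / (dn p)%:R).
    rewrite normrM ger0_norm; last by rewrite mulr_ge0 //; lra.
    by apply: ler_pM => //; [rewrite mulr_ge0 //; lra | lra].
  have a2 : 0 <= dmu p ^+ 2 * (1 - dM p 0) by rewrite mulr_ge0 ?sqr_ge0 // subr_ge0.
  have -> : dvar p = (dM p 2 - 2 * dmu p * dM p 1 + dmu p ^+ 2 * dM p 0)
    - (dM p 2 - dnu p) + 2 * dmu p * (dM p 1 - dmu p) + dmu p ^+ 2 * (1 - dM p 0).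
    by rewrite /dvar; ring.
  move: a1 M2; rewrite !ler_norml => /andP[a1 _] /andP[_ a3].
  by lra.
- by rewrite b0; lra.
Qed.


End RegularI.

(** * Stirling numbers and moments *)

Section Coefficients.
Variable R : realType.

Definition logq (l L : R) (j : nat) : R := if j is 0%N then 0 else l ^+ j / (j%:R * L).
Definition expq (l D : R) (j : nat) : R := if j is 0%N then 0 else l ^+ j / (j`!%:R * D).

Lemma coef_exp_S (Q : {poly R}) k i :
  i.+1%:R * (Q ^+ k.+1)`_i.+1 = k.+1%:R * (Q^`() * Q ^+ k)`_i.
Proof.
have : ((Q ^+ k.+1)^`())`_i = (k.+1%:R%:P * (Q^`() * Q ^+ k))`_i.
  by rewrite deriv_exp /= -mulr_natl polyC_natr.
by rewrite coefCM coef_deriv -[_ *+ i.+1]mulr_natl.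
Qed.

(** Truncation at degree n enters the differential equations below only through a multiple of [X^n],
    invisible to coefficients of lower degree. *)
Lemma coefM_low (p : {poly R}) (u : R) n i (q : {poly R}) : (i < n)%N ->
  (p * (u *: 'X^n) * q)`_i = 0.
Proof.
move=> ik; rewrite -mulrA -scalerAl mulrC -scalerAl coefZ -mulrA coefXnM ik.
by rewrite mulr0.
Qed.

Lemma coef_exp0 (q : nat -> R) n k : q 0%N = 0 -> ((\poly_(j < n.+1) q j) ^+ k)`_0 = (k == 0%N)%:R.
Proof.
move=> q0; rewrite -horner_coef0 horner_exp horner_coef0 coef_poly q0.
by case: k => [|k]; rewrite ?expr0 // expr0n.
Qed.

(** The generating function [(e^x - 1)^k = k! sum S(i,k) x^i/i!]. Below degree n the truncation
    satisfies [Q' = l/D + l Q]; inserted into [(Q^(k+1))' = (k+1) Q' Q^k], this is the recursion of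
    [stirling2]. *)
Lemma stirling2_coef (l D : R) n k i : D != 0 -> (i <= n)%N ->
  ((\poly_(j < n.+1) expq l D j) ^+ k)`_i = k`!%:R * l ^+ i / (D ^+ k * i`!%:R) * (stirling2 i k)%:R.
Proof.
move=> D0; set Q := \poly_(j < n.+1) _.
have fn (j : nat) : (j`!%:R : R) != 0 by rewrite pnatr_eq0 -lt0n fact_gt0.
have dQ i' k' : (i' < n)%N -> (Q^`() * Q ^+ k')`_i' = l / D * (Q ^+ k')`_i' + l * (Q ^+ k'.+1)`_i'.
  move=> il; have E : Q^`() = (l / D)%:P + l%:P * Q + 1 * (- (l * expq l D n) *: 'X^n).
    apply/polyP => j; rewrite mul1r !coefD coefC coefCM coef_deriv coefZ coefXn !coef_poly.
    rewrite !ltnS; case: (ltngtP j n) => [jn|jn|->]; last 1 first.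
    - rewrite mul0rn mulr1; case: (n) il => [|n'] // _.
      by rewrite /= ?leqnn ?ltnSn /=; ring.
    - rewrite mulr0 addr0 -[_ *+ j.+1]mulr_natl; case: j {jn} => [|j] /=.
        by rewrite expr1 mulr0 addr0 mul1r (_ : 1`! = 1%N) // mul1r.
      rewrite add0r !factS !natrM !exprS; field.
      by rewrite D0 fn nat1r -natrD !pnatr_eq0.
    - by rewrite mul0rn mulr0 addr0; case: j jn => [|j] //= _; rewrite ?mulr0 ?addr0.
  rewrite E 2!mulrDl !coefD coefM_low // addr0 coefCM -mulrA coefCM -exprS //.
elim: i k => [|i IH] k i_n.
  rewrite coef_exp0 // fact0 expr0; case: k => [|k] /=; last by rewrite !mulr0.
  by rewrite expr0 fact0 !mulr1 divr1.
case: k => [|k]; first by rewrite expr0 coef1 mulr0.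
apply: (@mulfI _ i.+1%:R); first by rewrite pnatr_eq0.
rewrite coef_exp_S dQ // !IH ?(ltnW i_n) //= natrD natrM !factS !natrM !exprS.
by field; rewrite ?fn ?expf_neq0 ?D0 ?nat1r ?pnatr_eq0.
Qed.

(** The generating function of [(- ln (1 - x))^k]. Here [(1 - l X) Q' = l/L] below degree n, and the
    extra factor [1 - l X] produces the term [n' * stirling1 n' k'.+1] of the recursion. *)
Lemma stirling1_coef (l L : R) n k i : L != 0 -> (i <= n)%N ->
  ((\poly_(j < n.+1) logq l L j) ^+ k)`_i = k`!%:R * l ^+ i / (L ^+ k * i`!%:R) * (stirling1 i k)%:R.
Proof.
move=> L0; set Q := \poly_(j < n.+1) _.
have fn (j : nat) : (j`!%:R : R) != 0 by rewrite pnatr_eq0 -lt0n fact_gt0.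
have dQ i' k' : (i' < n)%N -> (Q^`() * Q ^+ k')`_i' - l * ('X * (Q^`() * Q ^+ k'))`_i'
    = l / L * (Q ^+ k')`_i'.
  move=> il; have E : (1 - l%:P * 'X) * Q^`() = (l / L)%:P + 1 * (- (l ^+ n.+1 / L) *: 'X^n).
    apply/polyP => j; rewrite mul1r mulrBl mul1r coefB -mulrA coefCM coefXM.
    rewrite coefD coefC coefZ coefXn !coef_deriv !coef_poly.
    have nz (m : nat) : m.+1%:R != 0 :> R by rewrite pnatr_eq0.
    have ev (m : nat) : logq l L m.+1 *+ m.+1 = l ^+ m.+1 / L.
      by rewrite /= -mulr_natl; field; rewrite L0 nat1r nz.
    case: j => [|j] /=.
      by rewrite ltnS; case: (n) il => [|n'] //= _; field.
    rewrite !ltnS; case: (ltngtP j.+1 n) => [jn|jn|jn].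
    - rewrite !ev [l ^+ j.+2]exprS mulr0 addr0; ring.
    - rewrite ?(leqNgt j.+1 n) ?jn /= ?mul0rn; ring.
    - by rewrite -jn ev mul0rn mulr1 [l ^+ j.+2]exprS; ring.
  have <- : ((1 - l%:P * 'X) * Q^`() * Q ^+ k')`_i' = l / L * (Q ^+ k')`_i'.
    by rewrite E mulrDl coefD coefM_low // addr0 coefCM.
  by rewrite mulrBl mul1r mulrBl coefB -!mulrA coefCM.
elim: i k => [|i IH] k i_n.
  rewrite coef_exp0 // fact0 expr0; case: k => [|k] /=; last by rewrite !mulr0.
  by rewrite expr0 fact0 !mulr1 divr1.
case: k => [|k]; first by rewrite expr0 coef1 mulr0.
apply: (@mulfI _ i.+1%:R); first by rewrite pnatr_eq0.
have h : k.+1%:R * ('X * (Q^`() * Q ^+ k))`_i = i%:R * (Q ^+ k.+1)`_i.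
  case: i IH i_n => [|i] IH i_n; first by rewrite coefXM mulr0 mul0r.
  by rewrite coefXM /= -coef_exp_S.
rewrite coef_exp_S (canRL (subrK _) (dQ i k i_n)).
rewrite mulrDr mulrCA [k.+1%:R * (l * _)]mulrCA h !IH ?(ltnW i_n) //=.
rewrite natrD natrM !factS !natrM !exprS.
by field; rewrite ?fn ?expf_neq0 ?L0 ?nat1r ?pnatr_eq0.
Qed.

End Coefficients.

(** * Remainders of the geometric, exponential and logarithmic series *)

Section Series.
Variable R : realType.

(** [l <= exp(-(1-l))] and [y^3/6 <= exp y]. The cube outweighs the powers of n that multiply [l^n]
    in the moment defects. *)
Lemma pow_le_cube (l : R) n : 0 < l < 1 -> (0 < n)%N ->
  l ^+ n <= 6 / ((1 - l) * n%:R) ^+ 3.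
Proof.
move=> /andP[l0 l1] n0.
have y0 : 0 < (1 - l) * n%:R by rewrite mulr_gt0 ?subr_gt0 // ltr0n.
have h1 : l ^+ n <= expR (- ((1 - l) * n%:R)).
  rewrite -mulNr expRM_natr lerXn2r ?nnegrE ?expR_ge0 ?(ltW l0) //.
  by have := expR_ge1Dx (- (1 - l)); lra.
apply: le_trans h1 _; rewrite expRN -[leRHS]invf_div lef_pV2 ?posrE ?expR_gt0 ?divr_gt0 ?exprn_gt0 //.
apply: le_trans (expR_ge1Dxn 2 (ltW y0)); rewrite (_ : 3`! = 6%N) // lerDr //.
Qed.

Definition exp_sum (x : R) N := \sum_(j < N) x ^+ j / j`!%:R.

Lemma exp_sum_le_expR x N : 0 <= x -> exp_sum x N <= expR x.
Proof.
move=> x0.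
have -> : exp_sum x N = series (exp_coeff x) N.
  by rewrite /exp_sum /series /= big_mkord; apply: eq_bigr => j _; rewrite exp_coeffE mulrC.
apply: nondecreasing_cvgn_le; last exact: is_cvg_series_exp_coeff.
by apply: nondecreasing_series => k _ _; exact: exp_coeff_ge0.
Qed.

Lemma expR_le_exp_sum x B : (forall N, exp_sum x N <= B) -> expR x <= B.
Proof.
move=> EB; apply: limr_le; first exact: is_cvg_series_exp_coeff.
apply: nearW => N.
have -> : series (exp_coeff x) N = exp_sum x N.
  by rewrite /exp_sum /series /= big_mkord; apply: eq_bigr => j _; rewrite exp_coeffE mulrC.
exact: EB.
Qed.

(** For [j >= n - 1] and [n > 3], [4 j (j-1) >= n^2]: a tail term is at most [4 x^2/n^2] times the
    term two places earlier, and those sum to at most [expR x]. The cut at [n.-1] is the one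
    occurring in the second moment. *)
Lemma expR_tail x n : 0 <= x -> (3 < n)%N ->
  0 <= expR x - exp_sum x n.-1 <= 4 * x ^+ 2 * expR x / n%:R ^+ 2.
Proof.
move=> x0 n3; rewrite subr_ge0 exp_sum_le_expR //=; rewrite lerBlDl.
have t0 (j : nat) : 0 <= x ^+ j / j`!%:R by rewrite divr_ge0 ?exprn_ge0.
have n0 : 0 < n%:R :> R by rewrite ltr0n; lia.
have T0 : 0 <= 4 * x ^+ 2 * expR x / n%:R ^+ 2.
  by rewrite divr_ge0 ?sqr_ge0 // mulr_ge0 ?expR_ge0 // mulr_ge0 ?sqr_ge0.
apply: expR_le_exp_sum => N; have [Nn|nN] := leqP N n.-1.
  apply: ler_wpDr => //; rewrite /exp_sum -!(big_mkord xpredT (fun j => x ^+ j / j`!%:R)).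
  by rewrite [leRHS](@big_cat_nat _ _ _ N) //= lerDl sumr_ge0.
rewrite /exp_sum -!(big_mkord xpredT (fun j => x ^+ j / j`!%:R)).
rewrite (@big_cat_nat _ _ _ n.-1) //=; last exact: ltnW.
rewrite lerD2l.
have step j : (n.-1 <= j)%N -> x ^+ j / j`!%:R <= 4 * x ^+ 2 / n%:R ^+ 2 * (x ^+ (j - 2) / (j - 2)`!%:R).
  case: j => [|[|j]] nj; [lia|lia|]; rewrite subn2 /= !factS !natrM !exprS.
  have f0 : 0 < j`!%:R :> R by rewrite ltr0n fact_gt0.
  have jj : 0 < j.+2%:R * j.+1%:R :> R by rewrite mulr_gt0.
  have -> : x * (x * x ^+ j) / (j.+2%:R * (j.+1%:R * j`!%:R)) =
    (x ^+ 2 * (x ^+ j / j`!%:R)) * (j.+2%:R * j.+1%:R)^-1.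
    by field; rewrite (gt_eqF f0) nat1r -natrD !pnatr_eq0.
  have -> : 4 * (x * (x * x ^+ 0)) / (n%:R * (n%:R * n%:R ^+ 0)) * (x ^+ j / j`!%:R) =
    (x ^+ 2 * (x ^+ j / j`!%:R)) * (4 / n%:R ^+ 2).
    by field; rewrite (gt_eqF f0) (gt_eqF n0).
  rewrite (ler_wpM2l (mulr_ge0 (sqr_ge0 x) (t0 j))) // -[leRHS]invf_div lef_pV2 ?posrE ?divr_gt0 ?exprn_gt0 //.
  rewrite ler_pdivrMr // -natrX -!natrM ler_nat; move: nj n3; clear; nia.
apply: (@le_trans _ _ (4 * x ^+ 2 / n%:R ^+ 2 * expR x)); last first.
  by rewrite le_eqVlt; apply/orP; left; apply/eqP; ring.
apply: (@le_trans _ _ (\sum_(n.-1 <= j < N) 4 * x ^+ 2 / n%:R ^+ 2 * (x ^+ (j - 2) / (j - 2)`!%:R))).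
  by rewrite big_nat [leRHS]big_nat; apply: ler_sum => j /andP[nj _]; exact: step.
rewrite -mulr_sumr ler_wpM2l //; first by rewrite divr_ge0 ?sqr_ge0 // mulr_ge0 ?sqr_ge0.
apply: le_trans (exp_sum_le_expR N x0).
rewrite /exp_sum -(big_mkord xpredT (fun j => x ^+ j / j`!%:R)).
have -> : \sum_(n.-1 <= j < N) (x ^+ (j - 2) / (j - 2)`!%:R) =
   \sum_(n.-1 - 2 <= j < N - 2) (x ^+ j / j`!%:R).
  rewrite -{1}(subnK (_ : 2 <= n.-1)%N); last by lia.
  rewrite -{1}(subnK (_ : 2 <= N)%N); last by lia.
  by rewrite big_addn; under eq_bigr do rewrite addnK; rewrite addnK.
rewrite [leRHS](@big_cat_nat _ _ _ (N - 2)) //=; last by lia.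
rewrite [X in _ <= X + _](@big_cat_nat _ _ _ (n.-1 - 2)) //=; last by lia.
by rewrite -addrA addrCA lerDl addr_ge0 // sumr_ge0.
Qed.

Lemma sum_pow_closed (l : R) N : l != 1 -> [/\
  \sum_(j < N) l ^+ j = (1 - l ^+ N) / (1 - l),
  \sum_(j < N) j%:R * l ^+ j = l / (1 - l) ^+ 2 - l ^+ N * (N%:R / (1 - l) + l / (1 - l) ^+ 2) &
  \sum_(j < N) j%:R ^+ 2 * l ^+ j = l * (1 + l) / (1 - l) ^+ 3 - l ^+ N *
     (N%:R ^+ 2 / (1 - l) + 2 * l * N%:R / (1 - l) ^+ 2 + l * (1 + l) / (1 - l) ^+ 3)].
Proof.
move=> l1; have d : 1 - l != 0 by rewrite subr_eq0 eq_sym.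
elim: N => [|N [I1 I2 I3]]; first by rewrite !big_ord0 expr0; split; field.
rewrite !big_ord_recr /= I1 I2 I3 -[N.+1%:R]natr1 exprS.
by split; field.
Qed.

(** The remainder vanishes at 0 and has derivative [y^n/(1-y)]; the mean value theorem on [[0, x]]
    concludes. *)
Lemma ln_tail (x : R) n : 0 < x < 1 ->
  0 <= - ln (1 - x) - \sum_(j < n) x ^+ j.+1 / j.+1%:R <= x ^+ n / (1 - x).
Proof.
move=> /andP[x0 x1].
pose p : {poly R} := \poly_(j < n.+1) (if j is 0%N then 0 else j%:R^-1).
have pE y : p.[y] = \sum_(j < n) y ^+ j.+1 / j.+1%:R.
  rewrite horner_poly big_ord_recl mul0r add0r; apply: eq_bigr => j _.
  by rewrite lift0 mulrC.
have dpE y : (p^`()).[y] = \sum_(j < n) y ^+ j.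
  have -> : p^`() = \poly_(j < n) 1.
    apply/polyP => j; rewrite coef_deriv !coef_poly ltnS; case: ifP => _; last by rewrite mul0rn.
    by rewrite -[_ *+ _]mulr_natl mulfV // pnatr_eq0.
  by rewrite horner_poly; apply: eq_bigr => j _; rewrite mul1r.
pose f (y : R) := - ln (1 - y) - p.[y].
have df (y : R) : y < 1 -> is_derive y 1 f ((1 - y)^-1 - (p^`()).[y]).
  move=> y1; have h : 0 < 1 - y by rewrite subr_gt0.
  have l1 : is_derive y 1 (fun y : R => 1 - y) (0 - 1) by apply: is_deriveB.
  have l2 := is_derive1_ln h.
  have l3 : is_derive y 1 (fun y : R => ln (1 - y)) ((1 - y)^-1 * (0 - 1)).
    by apply: (@is_derive1_comp _ (@ln R) (fun y : R => 1 - y)).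
  have l4 : is_derive y 1 (fun y : R => - ln (1 - y)) (- ((1 - y)^-1 * (0 - 1))).
    exact: is_deriveN.
  have l5 := is_derive_poly p y.
  have -> : (1 - y)^-1 - (p^`()).[y] = - ((1 - y)^-1 * (0 - 1)) - (p^`()).[y] by ring.
  exact: is_deriveB.
have [||y] := @MVT R f (fun y => (1 - y)^-1 - (p^`()).[y]) 0 x x0.
- by move=> y; rewrite in_itv /= => /andP[_ yx]; apply: df; exact: lt_trans x1.
- apply: derivable_within_continuous => y; rewrite in_itv /= => /andP[_ yx].
  by have [] := df y (le_lt_trans yx x1).
rewrite in_itv /= => /andP[y0 yx] E0.
have y1 : y < 1 by apply: lt_trans x1.
have f0 : f 0 = 0.
  by rewrite /f subr0 ln1 oppr0 pE big1 ?subr0 // => j _; rewrite exprS !mul0r.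
have <- : f x = - ln (1 - x) - \sum_(j < n) x ^+ j.+1 / j.+1%:R by rewrite /f pE.
have fE : f x = ((1 - y)^-1 - (p^`()).[y]) * x by move: E0; rewrite f0 !subr0.
rewrite fE dpE.
have [-> _ _] := sum_pow_closed n (negbT (lt_eqF y1)).
have h : 0 < 1 - y by rewrite subr_gt0.
have hx : 0 < 1 - x by rewrite subr_gt0.
have -> : (1 - y)^-1 - (1 - y ^+ n) / (1 - y) = y ^+ n / (1 - y) by field; rewrite gt_eqF.
apply/andP; split; first by rewrite mulr_ge0 ?divr_ge0 ?exprn_ge0 // ltW.
rewrite -[leRHS]mulr1; apply: ler_pM; [|exact: ltW| |exact: ltW].
  by rewrite divr_ge0 ?exprn_ge0 // ltW.
apply: ler_pM; rewrite ?exprn_ge0 ?invr_ge0 ?(ltW y0) ?(ltW h) //.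
  by rewrite lerXn2r ?nnegrE ?(ltW y0) ?(ltW x0) ?(ltW yx).
by rewrite lef_pV2 ?posrE //; lra.
Qed.

End Series.

(** * Moments of the truncated laws, uniformly in the parameter *)

Section Moments.
Variable R : realType.

Definition good_moments (c C mu nu : R) (q : nat -> R) n :=
  [/\ (forall j, 0 <= q j), c <= q 1%N /\ c <= q 2%N,
      mom 0 q n <= 1 /\ `|mom 0 q n - 1| <= C / n%:R ^+ 2,
      `|mom 1 q n - mu| <= C / n%:R /\ `|mom 2 q n - nu| <= C / n%:R &
      mom 3 q n <= C].

Variables l0 l1 : R.
Hypothesis l00 : 0 < l0.

Definition mdom (t : R * nat) := [/\ l0 <= t.1, t.1 <= l1 & (3 < t.2)%N].
Definition mz (t : R * nat) : R := t.2%:R^-1.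

Lemma mz01 t : mdom t -> 0 < mz t <= 1.
Proof.
case=> _ _ n3; have n1 : (0 < t.2)%N by lia.
by rewrite /mz invr_gt0 ltr0n n1 invf_le1 ?ltr0n // ler1n.
Qed.

Local Notation O := (OO mdom mz).
Local Notation OM := (OO_Mw mz01).

Lemma Om_l : O 0 (fun t => t.1).
Proof.
apply: (OO_bnd (K := l1)) => t [a b _]; rewrite expr0z mulr1 ger0_norm //.
by apply: le_trans a; exact: ltW.
Qed.

Lemma Om_n : O (-1) (fun t => t.2%:R).
Proof.
apply: (OO_bnd (K := 1)) => t /mz01/andP[z0 _].
by rewrite mul1r ger0_norm // -invr_expz expr1z /mz invrK.
Qed.

Lemma good_momentsI (q : R -> nat -> R) (mu nu : R -> R) (c : R) :
  (forall t, mdom t -> forall j, 0 <= q t.1 j) ->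
  (forall t, mdom t -> c <= q t.1 1%N /\ c <= q t.1 2%N) ->
  (forall t, mdom t -> mom 0 (q t.1) t.2 <= 1) ->
  O 2 (fun t => mom 0 (q t.1) t.2 - 1) -> O 1 (fun t => mom 1 (q t.1) t.2 - mu t.1) ->
  O 1 (fun t => mom 2 (q t.1) t.2 - nu t.1) -> O 0 (fun t => mom 3 (q t.1) t.2) ->
  exists2 C, 0 < C & forall l n, l0 <= l -> l <= l1 -> (3 < n)%N ->
    good_moments c C (mu l) (nu l) (q l) n.
Proof.
move=> q0 qc m01 /(OO_pos mz01)[K0 K00 h0] /(OO_pos mz01)[K1 K10 h1].
move=> /(OO_pos mz01)[K2 K20 h2] /(OO_pos mz01)[K3 K30 h3].
exists (K0 + K1 + K2 + K3) => [|l n la lb n3]; first by rewrite !addr_gt0.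
have D : mdom (l, n) by split.
have n0 : 0 < n%:R :> R by rewrite ltr0n; lia.
have up K e : 0 < K -> K <= K0 + K1 + K2 + K3 -> forall x : R,
    `|x| <= K * mz (l, n) ^+ e -> `|x| <= (K0 + K1 + K2 + K3) / n%:R ^+ e.
  move=> _ KK x h; apply: le_trans h _; rewrite /mz /= exprVn.
  by apply: ler_wpM2r KK; rewrite invr_ge0 exprn_ge0.
split; first exact: (q0 _ D).
- exact: (qc _ D).
- split; first exact: (m01 _ D).
  by apply: (up K0 2%N) => //; [lra | exact: (h0 _ D)].
- have H1 := h1 _ D; have H2 := h2 _ D; rewrite expr1z in H1 H2.
  by split; rewrite -[n%:R]expr1; [apply: (up K1 1%N)|apply: (up K2 1%N)];
    rewrite ?expr1 //; lra.
- have := h3 _ D; rewrite expr0z mulr1 => h; apply: le_trans (ler_norm _) _.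
  by apply: le_trans h _; lra.
Qed.

(** [j^2 = j(j-1) + j] and [j^3 = j(j-1)(j-2) + 3j(j-1) + j]; a falling factorial of order r
    shortens the exponential sum by r terms. The shifts [N.+1] and [N.+2] avoid predecessors. *)
Lemma expq_mom (l D : R) N : D != 0 -> [/\
  mom 0 (expq l D) N = (exp_sum l N.+1 - 1) / D,
  mom 1 (expq l D) N = l * exp_sum l N / D,
  mom 2 (expq l D) N.+1 = (l ^+ 2 * exp_sum l N + l * exp_sum l N.+1) / D &
  mom 3 (expq l D) N.+2 = (l ^+ 3 * exp_sum l N + 3 * l ^+ 2 * exp_sum l N.+1 + l * exp_sum l N.+2) / D].
Proof.
move=> D0; have fn (j : nat) : (j`!%:R : R) != 0 by rewrite pnatr_eq0 -lt0n fact_gt0.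
have nz (m : nat) : 1 + m%:R != 0 :> R by rewrite nat1r pnatr_eq0.
have nz2 (m : nat) : 2 + m%:R != 0 :> R by rewrite -natrD pnatr_eq0.
have nz3 (m : nat) : 3 + m%:R != 0 :> R by rewrite -natrD pnatr_eq0.
elim: N => [|N [I0 I1 I2 I3]].
  rewrite /mom /exp_sum /= !big_ord_recr !big_ord0 /= !fact0 !factS !fact0.
  by split; field.
have ES k : exp_sum l k.+1 = exp_sum l k + l ^+ k / k`!%:R by rewrite /exp_sum big_ord_recr.
have mS e q k : mom e q k.+1 = mom e q k + k.+1%:R ^+ e * q k.+1 :> R by rewrite /mom big_ord_recr.
rewrite !mS in I2 I3 *; rewrite I0 I1 I2 I3 !ES /= !factS !natrM !exprS.
by split; field; rewrite ?D0 ?fn ?nz ?nz2 ?nz3.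
Qed.

Lemma exp_moments : exists2 c, 0 < c & exists2 C, 0 < C & forall l n, l0 <= l -> l <= l1 ->
  (3 < n)%N -> good_moments c C (l * expR l / (expR l - 1))
     (l * expR l / (expR l - 1) * (1 + l)) (expq l (expR l - 1)) n.
Proof.
have D0 t : mdom t -> l0 <= expR t.1 - 1.
  by case=> a _ _; have := expR_ge1Dx t.1; lra.
have Dp t : mdom t -> 0 < expR t.1 - 1 by move=> /D0; apply: lt_le_trans.
have lp t : mdom t -> 0 < t.1 by case=> a _ _; apply: lt_le_trans a.
have De t : mdom t -> expR t.1 - 1 <= expR l1.
  by case=> _ a _; rewrite -ler_expR in a; lra.
(* A common lower bound for [l/D] and [l^2/(2D)], from [D <= expR l1] and
   [l0^2/(1+l0) <= min(l0, l0^2)]. *)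
exists (l0 ^+ 2 / (2 * (1 + l0) * expR l1)).
  have k0 : 0 < 1 + l0 by rewrite addr_gt0.
  exact: divr_gt0 (exprn_gt0 2 l00) (mulr_gt0 (mulr_gt0 (ltr0Sn R 1) k0) (expR_gt0 l1)).
have oe : O 0 (fun t => expR t.1).
  apply: (OO_bnd (K := expR l1)) => t [_ b _].
  by rewrite expr0z mulr1 ger0_norm ?expR_ge0 // ler_expR.
have oD : O 0 (fun t => (expR t.1 - 1)^-1).
  by apply: (OO_inv mz01 (e := 0) l00) => t Dt; rewrite expr0z mulr1; exact: D0.
have ol := Om_l.
have oT : O 2 (fun t => expR t.1 - exp_sum t.1 t.2.-1).
  have o1 : O 2 (fun t => 4 * (t.1 * t.1) * expR t.1 * mz t ^ 2).
    apply: OM (OO_M mz01 (OO_M mz01 (OO_c mz01 4 (lexx 0)) (OO_M mz01 ol ol)) oe) (OO_z mz01 2) _ => //.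
  apply: (OO_le mz01 o1) => // t Dt; have [_ _ n3] := Dt.
  have /andP[a b] := expR_tail (ltW (lp _ Dt)) n3.
  rewrite (ger0_norm a); apply: le_trans b _; apply: le_trans (ler_norm _).
  by rewrite -exprnP /mz exprVn -expr2.
have Emono (x : R) k k' : 0 <= x -> (k <= k')%N -> exp_sum x k <= exp_sum x k'.
  move=> x0 kk; rewrite /exp_sum -!(big_mkord xpredT (fun j => x ^+ j / j`!%:R)).
  rewrite [leRHS](@big_cat_nat _ _ _ k) //= lerDl sumr_ge0 // => j _.
  by rewrite divr_ge0 // exprn_ge0.
have oT' (f : nat -> nat) : (forall n, (3 < n)%N -> (n.-1 <= f n)%N) ->
    O 2 (fun t => expR t.1 - exp_sum t.1 (f t.2)).
  move=> hf; apply: (OO_le mz01 oT) => // t Dt; have [_ _ n3] := Dt.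
  have x0 := ltW (lp _ Dt).
  rewrite !ger0_norm ?subr_ge0 ?exp_sum_le_expR // lerD2l lerN2.
  by apply: Emono => //; exact: hf.
have oTn : O 2 (fun t => expR t.1 - exp_sum t.1 t.2) by apply: (oT' id) => n _; exact: leq_pred.
have oTn1 : O 2 (fun t => expR t.1 - exp_sum t.1 t.2.+1).
  by apply: (oT' S) => n _; rewrite (leq_trans (leq_pred n)).
apply: good_momentsI.
- move=> t Dt [|j] //=; rewrite divr_ge0 ?exprn_ge0 ?(ltW (lp _ Dt)) //.
  by rewrite mulr_ge0 // ltW // Dp.
- move=> t Dt; rewrite /= (_ : 1`! = 1%N) // (_ : 2`! = 2%N) // expr1 mul1r.
  have [a _ _] := Dt; have Dpt := Dp _ Dt; have det := De _ Dt; have l0' := lp _ Dt.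
  have e1 := expR_gt0 l1.
  have k0 : 0 < 1 + l0 by rewrite addr_gt0.
  have b1 : (expR l1)^-1 <= (expR t.1 - 1)^-1 by rewrite lef_pV2.
  have b2 : l0 ^+ 2 / (1 + l0) <= l0 by rewrite ler_pdivrMr // expr2 ler_pM2l // lerDr.
  have b3 : l0 ^+ 2 / (1 + l0) <= l0 ^+ 2.
    by rewrite ler_pdivrMr // ler_peMr ?sqr_ge0 // lerDl ltW.
  have E1 : l0 ^+ 2 / (2 * (1 + l0) * expR l1) = l0 ^+ 2 / (1 + l0) / 2 * (expR l1)^-1.
    by field; rewrite (gt_eqF e1) (gt_eqF k0).
  have p0 : 0 <= l0 ^+ 2 / (1 + l0) by rewrite divr_ge0 ?sqr_ge0 // ltW.
  rewrite E1; split.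
    apply: ler_pM; [exact: divr_ge0|by rewrite invr_ge0 ltW| |exact: b1].
    by move: (l0 ^+ 2 / _) p0 b2 => x; lra.
  rewrite invfM mulrA; apply: ler_pM; [exact: divr_ge0|by rewrite invr_ge0 ltW| |exact: b1].
  rewrite ler_pM2r ?invr_gt0 //; apply: le_trans b3 _.
  by rewrite lerXn2r ?nnegrE // ltW.
- move=> t Dt; have Dpt := Dp _ Dt; have [-> _ _ _] := expq_mom t.1 t.2 (lt0r_neq0 Dpt).
  by rewrite ler_pdivrMr // mul1r lerD2r exp_sum_le_expR // ltW // lp.
- apply: (OO_eq mz01 (OO_N (OO_M mz01 oTn1 oD))) => t Dt; have Dpt := Dp _ Dt.
  have [-> _ _ _] := expq_mom t.1 t.2 (lt0r_neq0 Dpt).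
  by field; rewrite gt_eqF.
- have o1 : O 1 (fun t => t.1 * ((expR t.1 - exp_sum t.1 t.2) * (expR t.1 - 1)^-1)).
    by apply: OM ol (OO_M mz01 oTn oD) _.
  apply: (OO_eq mz01 (OO_N o1)) => t Dt; have Dpt := Dp _ Dt.
  have [_ -> _ _] := expq_mom t.1 t.2 (lt0r_neq0 Dpt).
  by field; rewrite gt_eqF.
- have o1 : O 1 (fun t => (t.1 * t.1) * ((expR t.1 - exp_sum t.1 t.2.-1) * (expR t.1 - 1)^-1)).
    by apply: OM (OO_M mz01 ol ol) (OO_M mz01 oT oD) _.
  have o2 : O 1 (fun t => t.1 * ((expR t.1 - exp_sum t.1 t.2) * (expR t.1 - 1)^-1)).
    by apply: OM ol (OO_M mz01 oTn oD) _.
  apply: (OO_eq mz01 (OO_N (OO_D o1 o2))) => -[l [|n]] Dt; first by case: Dt.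
  have Dpt := Dp _ Dt; have [_ _ /= -> _] := expq_mom l n (lt0r_neq0 Dpt).
  by rewrite /= in Dpt *; field; rewrite gt_eqF.
- have o1 : O 0 (fun t => (t.1 * (t.1 * t.1) + 3 * (t.1 * t.1) + t.1) * (expR t.1 * (expR t.1 - 1)^-1)).
    have a2 := OO_M mz01 ol ol.
    have a3 := OO_M mz01 ol a2.
    apply: OM (OO_D (OO_D a3 (OO_M mz01 (OO_c mz01 3 (lexx 0)) a2)) ol) (OO_M mz01 oe oD) _ => //.
  apply: (OO_le mz01 o1) => // -[l [|[|n]]] Dt; [by case: Dt|by case: Dt|].
  have Dpt := Dp _ Dt; have [_ _ _ /= ->] := expq_mom l n (lt0r_neq0 Dpt).
  have x0 := ltW (lp _ Dt); rewrite /= in Dpt x0 *.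
  have e0 k : 0 <= exp_sum l k by rewrite sumr_ge0 // => j _; rewrite divr_ge0 // exprn_ge0.
  have x3 : 0 <= l ^+ 3 by rewrite exprn_ge0.
  have x2 : 0 <= 3 * l ^+ 2 by rewrite mulr_ge0 // sqr_ge0.
  have s0 : 0 <= (l ^+ 3 * exp_sum l n + 3 * l ^+ 2 * exp_sum l n.+1 + l * exp_sum l n.+2) / (expR l - 1).
    by rewrite divr_ge0 ?(ltW Dpt) // !addr_ge0 // mulr_ge0.
  rewrite (ger0_norm s0); apply: le_trans (ler_norm _); rewrite [leRHS]mulrA.
  rewrite ler_pM2r ?invr_gt0 //.
  have -> : (l * (l * l) + 3 * (l * l) + l) * expR l =
     l ^+ 3 * expR l + 3 * l ^+ 2 * expR l + l * expR l by ring.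
  by rewrite !lerD // ler_wpM2l // exp_sum_le_expR.
Qed.

Hypothesis l11 : l1 < 1.

Lemma log_moments : exists2 c, 0 < c & exists2 C, 0 < C & forall l n, l0 <= l -> l <= l1 ->
  (3 < n)%N -> good_moments c C (l / (1 - l) / - ln (1 - l))
     (l / (1 - l) ^+ 2 / - ln (1 - l)) (logq l (- ln (1 - l))) n.
Proof.
have lp t : mdom t -> 0 < t.1 by case=> a _ _; apply: lt_le_trans a.
have g0 : 0 < 1 - l1 by rewrite subr_gt0.
have lg t : mdom t -> 1 - l1 <= 1 - t.1 by case=> _ b _; lra.
have lgp t : mdom t -> 0 < 1 - t.1 by move=> /lg; apply: lt_le_trans.
have Ll t : mdom t -> l0 <= - ln (1 - t.1).
  move=> Dt; have [a _ _] := Dt; apply: le_trans a _.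
  have := @le_ln1Dx R (- t.1); have := lgp _ Dt; have -> : 1 + - t.1 = 1 - t.1 by [].
  by move=> h1 h2; have := h2 ltac:(lra); lra.
have Lp t : mdom t -> 0 < - ln (1 - t.1) by move=> /Ll; apply: lt_le_trans.
have Lu t : mdom t -> - ln (1 - t.1) <= (1 - l1)^-1.
  move=> Dt; have h := lgp _ Dt; rewrite -lnV //.
  apply: (@le_trans _ _ (1 - t.1)^-1); last by rewrite lef_pV2 // lg.
  by apply: ltW; apply: ln_sublinear; rewrite invr_gt0.
(* The two masses are [l/L] and [l^2/(2L)], with [1/L >= 1 - l1] and [l0^2/2 <= l0]. *)
exists (l0 ^+ 2 / 2 * (1 - l1)); first by rewrite mulr_gt0 // divr_gt0 // exprn_gt0.
have ol := Om_l; have on := Om_n.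
have og : O 0 (fun t => (1 - t.1)^-1).
  by apply: (OO_inv mz01 (e := 0) g0) => t Dt; rewrite expr0z mulr1 lg.
have oL : O 0 (fun t => (- ln (1 - t.1))^-1).
  by apply: (OO_inv mz01 (e := 0) l00) => t Dt; rewrite expr0z mulr1 Ll.
have oP : O 3 (fun t => t.1 ^+ t.2).
  apply: (OO_bnd (K := 6 / (1 - l1) ^+ 3)) => t Dt; have [_ _ n3] := Dt.
  have n0 : (0 < t.2)%N by lia.
  have h := lgp _ Dt; have h' := lp _ Dt.
  rewrite ger0_norm ?exprn_ge0 ?(ltW h') //.
  apply: le_trans (pow_le_cube _ n0) _; first by rewrite h'; lra.
  rewrite -exprnP /mz exprVn exprMn invfM mulrA ler_wpM2r ?invr_ge0 ?exprn_ge0 //.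
  rewrite ler_wpM2l // lef_pV2 ?posrE ?exprn_gt0 //.
  by rewrite lerXn2r ?nnegrE ?(ltW g0) ?(ltW h) // lg.
(* Dividing [j^(e+1)] by j reduces to [sum_pow_closed]; [0^e] removes the term [j = 0], which is
   nonzero only for [e = 0]. *)
have mE (l L : R) n e : L != 0 -> mom e.+1 (logq l L) n =
   (\sum_(j < n.+1) j%:R ^+ e * l ^+ j - 0 ^+ e) / L.
  move=> L0; elim: n => [|n IH].
    by rewrite /mom !big_ord1 /= mulr0 expr0 mulr1 subrr mul0r.
  rewrite big_ord_recr /= [LHS](_ : _ = mom e.+1 (logq l L) n + n.+1%:R ^+ e.+1 * logq l L n.+1).
    by rewrite IH /= [n.+1%:R ^+ e.+1]exprSr; field; rewrite L0 nat1r pnatr_eq0.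
  by rewrite /mom big_ord_recr.
have m0E (l L : R) n : L != 0 -> mom 0 (logq l L) n = (\sum_(j < n) l ^+ j.+1 / j.+1%:R) / L.
  move=> L0; elim: n => [|n IH]; first by rewrite /mom big_ord1 big_ord0 /= mulr0 mul0r.
  rewrite big_ord_recr /= [LHS](_ : _ = mom 0 (logq l L) n + n.+1%:R ^+ 0 * logq l L n.+1).
    by rewrite IH /= expr0; field; rewrite L0 nat1r pnatr_eq0.
  by rewrite /mom big_ord_recr.
have nl t : mdom t -> t.1 != 1 by move=> /lgp h; rewrite lt_eqF // -subr_gt0.
have nL t : mdom t -> - ln (1 - t.1) != 0 by move=> /Lp h; rewrite gt_eqF.
apply: good_momentsI.
- move=> t Dt [|j] //=; rewrite divr_ge0 ?exprn_ge0 ?(ltW (lp _ Dt)) //.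
  by rewrite mulr_ge0 // ltW // Lp.
- move=> t Dt; rewrite /= expr1 mul1r; have [a b _] := Dt; have Lpt := Lp _ Dt.
  have h : 1 - l1 <= (- ln (1 - t.1))^-1.
    by rewrite -[leLHS]invrK lef_pV2 ?posrE ?invr_gt0 ?Lu.
  have hl : l0 ^+ 2 / 2 <= l0.
    have h2 : l0 ^+ 2 <= l0 by rewrite expr2 ler_piMr ?(ltW l00) //; lra.
    by have := l00; lra.
  have p0 : 0 <= l0 ^+ 2 / 2 by rewrite divr_ge0 // sqr_ge0.
  split; first by apply: ler_pM => //; [exact: ltW|exact: le_trans a].
  rewrite invfM mulrA; apply: ler_pM => //; first exact: ltW.
  by rewrite ler_pM2r ?invr_gt0 // lerXn2r ?nnegrE ?(ltW l00) ?(ltW (lp _ Dt)).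
- move=> t Dt; have h := lgp _ Dt; have h' := lp _ Dt.
  have /andP[a _] := @ln_tail R t.1 t.2 ltac:(by rewrite h'; lra).
  rewrite (m0E _ _ _ (nL _ Dt)).
  by rewrite ler_pdivrMr ?Lp // mul1r -subr_ge0.
- have o1 : O 2 (fun t => t.1 ^+ t.2 * ((1 - t.1)^-1 * (- ln (1 - t.1))^-1)).
    by apply: OM oP (OO_M mz01 og oL) _.
  apply: (OO_le mz01 o1) => // t Dt; have h := lgp _ Dt; have h' := lp _ Dt.
  have /andP[a b] := @ln_tail R t.1 t.2 ltac:(by rewrite h'; lra).
  rewrite (m0E _ _ _ (nL _ Dt)).
  have Lpt := Lp _ Dt; move: a b; set S := \sum_(_ < _) _; set L := - ln _ in Lpt * => a b.
  have -> : S / L - 1 = - ((L - S) / L) by field; rewrite gt_eqF.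
  rewrite normrN ger0_norm ?divr_ge0 ?(ltW Lpt) //; apply: le_trans (ler_norm _).
  by rewrite [leRHS]mulrA ler_pM2r ?invr_gt0.
- have o1 : O 1 (fun t => t.1 * (t.1 ^+ t.2 * ((1 - t.1)^-1 * (- ln (1 - t.1))^-1))).
    by apply: OM ol (OO_M mz01 oP (OO_M mz01 og oL)) _.
  apply: (OO_eq mz01 (OO_N o1)) => t Dt; rewrite (mE _ _ _ _ (nL _ Dt)).
  have [s1 _ _] := sum_pow_closed t.2.+1 (nl _ Dt).
  under eq_bigr do rewrite expr0 mul1r.
  rewrite s1 expr0 [t.1 ^+ t.2.+1]exprS; field.
  by rewrite (gt_eqF (lgp _ Dt)) -oppr_eq0 (gt_eqF (Lp _ Dt)).
- have o1 : O 1 (fun t => (t.1 * t.1 ^+ t.2) * (((t.2%:R + 1) * (1 - t.1)^-1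
      + t.1 * ((1 - t.1)^-1 * (1 - t.1)^-1)) * (- ln (1 - t.1))^-1)).
    have a1 : O (-1) (fun t => (t.2%:R + 1) * (1 - t.1)^-1).
      by apply: OM (OO_D on (OO_c mz01 1 _)) og _.
    have a2 : O (-1) (fun t => t.1 * ((1 - t.1)^-1 * (1 - t.1)^-1)).
      by apply: OM ol (OO_M mz01 og og) _.
    by apply: OM (OO_M mz01 ol oP) (OO_M mz01 (OO_D a1 a2) oL) _.
  apply: (OO_eq mz01 (OO_N o1)) => t Dt; rewrite (mE _ _ _ _ (nL _ Dt)).
  have [_ s1 _] := sum_pow_closed t.2.+1 (nl _ Dt).
  under eq_bigr do rewrite expr1.
  rewrite s1 expr1 [t.1 ^+ t.2.+1]exprS -[t.2.+1%:R]natr1; field.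
  by rewrite (gt_eqF (lgp _ Dt)) -oppr_eq0 (gt_eqF (Lp _ Dt)).
- have o1 : O 0 (fun t => (t.1 * (1 + t.1)) * (((1 - t.1)^-1 * ((1 - t.1)^-1 * (1 - t.1)^-1))
      * (- ln (1 - t.1))^-1)).
    have a1 : O 0 (fun t => 1 + t.1) by apply: OO_D ol; exact: OO_c mz01 _ _ _.
    by apply: OM (OO_M mz01 ol a1) (OO_M mz01 (OO_M mz01 og (OO_M mz01 og og)) oL) _.
  apply: (OO_le mz01 o1) => // t Dt; have h := ltW (lgp _ Dt); have h' := ltW (lp _ Dt).
  have Lpt := Lp _ Dt.
  have m0 : 0 <= mom 3 (logq t.1 (- ln (1 - t.1))) t.2.
    by apply: mom_ge0 => -[|j] //=; rewrite divr_ge0 ?exprn_ge0 // mulr_ge0 // ltW.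
  rewrite (ger0_norm m0); apply: le_trans (ler_norm _); rewrite (mE _ _ _ _ (nL _ Dt)).
  have [_ _ s1] := sum_pow_closed t.2.+1 (nl _ Dt).
  rewrite s1 expr0n subr0 !mulrA ler_pM2r ?invr_gt0 //.
  have -> : t.1 * (1 + t.1) / (1 - t.1) / (1 - t.1) / (1 - t.1) = t.1 * (1 + t.1) / (1 - t.1) ^+ 3.
    by field; rewrite gt_eqF // lgp.
  rewrite gerBl mulr_ge0 ?exprn_ge0 // !addr_ge0 // ?divr_ge0 ?exprn_ge0 ?mulr_ge0 // addr_ge0 //.
Qed.

End Moments.

(** * From the local limit theorem to [llt_error] *)

Section Assemble.
Variable R : realType.

(** Normalisations cancel: the weight is divided by its value at [k0], and the factor [K] disappears
    against the sum of [num]. *)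
Lemma assemble (c C e : R) : 0 < c -> 0 < e -> exists N, forall p (om num : nat -> R) (K M V : R),
  regular c C p -> (N <= dn p)%N -> 
  (forall k, (k <= dn p)%N -> 0 <= om k) -> 0 < om (dk0 p) ->
  (forall k, (k < dn p)%N -> om k.+1 * k.+1%:R = om k * (dm p + db p * (dm p - k%:R))) ->
  (forall k, (k <= dn p)%N -> om k * (dQ p ^+ k)`_(dn p) = K * num k) ->
  dm p = M * (dn p)%:R -> dV p = V * (dn p)%:R ->
  llt_error (fun k => num k / \sum_(j < (dn p).+1) num j) (gauss M V (dn p)) (dn p) <= e.
Proof.
move=> c0 e0; have [N HN] := llt C c0 e0.
exists N => p om num K M V rp Np om0 omk0 omr omK mE VE.
pose w k := om k / om (dk0 p).
have wp : weight p w.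
  split; first by move=> k kn; exact: divr_ge0 (om0 _ kn) (ltW omk0).
    by move=> k kn; rewrite /w mulrAC omr // mulrAC.
  by rewrite /w divff // gt_eqF.
have [Z0 H] := HN p w rp wp Np.
have UE k : (k <= dn p)%N -> dU p w k = K / om (dk0 p) * num k.
  by move=> kn; rewrite /dU /w mulrAC omK // mulrAC.
have ZE : \sum_(k < (dn p).+1) dU p w k = K / om (dk0 p) * \sum_(j < (dn p).+1) num j.
  by rewrite mulr_sumr; apply: eq_bigr => k _; rewrite UE // -ltnS ltn_ord.
have K0 : K / om (dk0 p) != 0.
  by apply/eqP => E; move: Z0; rewrite ZE E mul0r ltxx.
have n0 := dn_gt0 rp; have s0 : 0 < Num.sqrt (dn p)%:R :> R by rewrite sqrtr_gt0.
rewrite /llt_error mulrC -ler_pdivlMr //.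
apply: bigmax_le; first by rewrite divr_ge0 // ltW.
move=> k _; have kn : (k <= dn p)%N by rewrite -ltnS ltn_ord.
have := H k kn; rewrite UE // ZE invfM mulrACA mulfV // mul1r.
have V0 := dV_gt0 c0 rp.
have Vp : 0 < V by move: V0; rewrite VE pmulr_lgt0.
suff -> : dphi p k / Num.sqrt (2 * pi * dV p) = gauss M V (dn p) k by [].
rewrite /dphi /gauss mE VE mulrC; congr (_ * _); last by rewrite mulrA.
congr (_^-1); rewrite -sqrtrM; last by rewrite !mulr_ge0 ?pi_ge0.
by congr Num.sqrt; ring.
Qed.

End Assemble.

(** * The three families *)

Section Instances.
Variable R : realType.

Lemma good_momentsW (c C C' mu nu : R) q n : C <= C' ->
  good_moments c C mu nu q n -> good_moments c C' mu nu q n.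
Proof.
move=> CC [q0 qc [h0 h0'] [h1 h2] h3].
have up (x : R) e : `|x| <= C / n%:R ^+ e -> `|x| <= C' / n%:R ^+ e.
  by move=> h; apply: le_trans h _; apply: ler_wpM2r CC; rewrite invr_ge0 exprn_ge0.
split=> //; last exact: le_trans CC.
  by split=> //; exact: up.
by split; have := up _ 1%N; rewrite expr1; apply.
Qed.

Lemma dVE (c C : R) p : 0 < c -> regular c C p ->
  dV p = dm p * dvar p / ((1 + db p) * dvar p + dmu p ^+ 2).
Proof.
move=> c0 rp; have m0 := dm_gt0 c0 rp; have /andP[b0 _] := reg_b rp.
have v0 : 0 < dvar p by apply: lt_le_trans (reg_var rp).
have d0 : 0 < (1 + db p) * dvar p + dmu p ^+ 2.
  by rewrite ltr_pwDl ?sqr_ge0 // mulr_gt0 // ltr_pwDl.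
have -> : dm p * dvar p / ((1 + db p) * dvar p + dmu p ^+ 2) =
   (((1 + db p) * dvar p + dmu p ^+ 2) / (dm p * dvar p))^-1 by rewrite invf_div.
by rewrite /dV /dVi; congr (_^-1); field; rewrite (gt_eqF m0) (gt_eqF v0).
Qed.

(** The hypothesis relating [V] to the moments is the formula for [dV] cleared of denominators, so
    each family below only has to verify rational identities. *)
Lemma drive (c' C' e : R) : 0 < c' -> 0 < C' -> 0 < e -> exists N,
  forall n (q : nat -> R) (mu nu m b K M V : R) (om num : nat -> R), (N <= n)%N ->
  good_moments c' C' mu nu q n -> q 0%N = 0 -> m * mu = n%:R -> 0 <= b <= C' ->
  (forall k, (k <= n)%N -> 0 < om k) ->
  (forall k, (k < n)%N -> om k.+1 * k.+1%:R = om k * (m + b * (m - k%:R))) ->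
  (forall k, (k <= n)%N -> om k * ((\poly_(j < n.+1) q j) ^+ k)`_n = K * num k) ->
  m = M * n%:R ->
  m * (nu - mu ^+ 2) = V * n%:R * ((1 + b) * (nu - mu ^+ 2) + mu ^+ 2) ->
  llt_error (fun k => num k / \sum_(j < n.+1) num j) (gauss M V n) n <= e.
Proof.
move=> c'0 C'0 e0; have [c c0 [C [N1 reg]]] := regularI c'0 C'0.
have [N2 asm] := assemble C c0 e0.
exists (maxn N1 N2) => n q mu nu m b K M V om num.
rewrite geq_max => /andP[n1 n2] [q0 [q1 q2] [h0 h0'] [h1 h2] h3] q00 mmu bb om0 omr omK mM mV.
pose p := LLTData n q mu nu m b.
have rp : regular c C p by apply: reg.
apply: (asm p om num K M V rp) => //.
- by move=> k kn; exact: ltW (om0 _ kn).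
- by apply: om0; exact: (dk0_len c0 rp).
- have v0 : 0 < dvar p by apply: lt_le_trans (reg_var rp).
  have /andP[b0 _] := bb.
  have d0 : 0 < (1 + db p) * dvar p + dmu p ^+ 2.
    by rewrite ltr_pwDl ?sqr_ge0 // mulr_gt0 // ltr_pwDl.
  rewrite (dVE c0 rp); apply: (@mulIf _ ((1 + db p) * dvar p + dmu p ^+ 2)).
    by rewrite gt_eqF.
  by rewrite divfK ?gt_eqF.
Qed.

Lemma fact_neq0 j : (j`!%:R : R) != 0.
Proof. by rewrite pnatr_eq0 -lt0n fact_gt0. Qed.

Lemma poisson_rec (m : R) k : m ^+ k.+1 / k.+1`!%:R * k.+1%:R =
  m ^+ k / k`!%:R * (m + 0 * (m - k%:R)).
Proof.
rewrite factS natrM exprS mul0r addr0; field.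
by rewrite fact_neq0 nat1r pnatr_eq0.
Qed.

(** With [l = 1/(1+t)] one has [l/(1-l) = 1/t], so [m = t n L] satisfies [m mu = n]. The weight
    [m^k/k!] cancels the [k!/L^k] of [stirling1_coef], leaving the constant [l^n/n!]. *)
Lemma unif1 (a b e : R) : 0 < a -> 0 < b -> 0 < e ->
  exists N, forall n t, (N <= n)%N -> a <= t -> t <= b -> error1 n t <= e.
Proof.
move=> a0 b0 e0.
have l00 : 0 < (1 + b)^-1 by rewrite invr_gt0 addr_gt0.
have l11 : (1 + a)^-1 < 1 by rewrite invf_lt1 ?addr_gt0 // ltrDl.
have [c c0 [C C0 gm]] := log_moments l00 l11.
have [N HN] := drive c0 C0 e0.
exists (maxn N 4) => n t; rewrite geq_max => /andP[Nn n3] at_ tb.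
have t0 : 0 < t by apply: lt_le_trans at_.
have t1 : 0 < 1 + t by rewrite addr_gt0.
pose l := (1 + t)^-1; have El : 1 - l = t / (1 + t) by rewrite /l; field; rewrite gt_eqF.
have la : (1 + b)^-1 <= l by rewrite lef_pV2 ?posrE ?addr_gt0 // lerD2l.
have lb : l <= (1 + a)^-1 by rewrite lef_pV2 ?posrE ?addr_gt0 // lerD2l.
have := gm l n la lb n3; rewrite El.
have EL : - ln (t / (1 + t)) = ln (1 + t^-1).
  rewrite -lnV ?posrE ?divr_gt0 // invf_div; congr ln.
  by field; rewrite gt_eqF.
rewrite EL; set L := ln _ => g.
have L0 : 0 < L by rewrite ln_gt0 // ltrDl invr_gt0.
have n0 : 0 < n%:R :> R by rewrite ltr0n; apply: leq_trans n3.
have m0 : 0 < t * n%:R * L by rewrite !mulr_gt0.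
have -> : error1 n t = llt_error (fun k => (stirling1 n k)%:R * (t * n%:R) ^+ k /
   \sum_(j < n.+1) (stirling1 n j)%:R * (t * n%:R) ^+ j) (gauss (mu1 t) (var1 t) n) n.
  by rewrite /error1 /pmf1 risingE_ord.
apply: (HN n _ _ _ (t * n%:R * L) 0 (l ^+ n / n`!%:R) _ _
  (fun k => (t * n%:R * L) ^+ k / k`!%:R) _ Nn g) => //.
- by rewrite /l; field; rewrite !gt_eqF // addrC.
- by rewrite lexx ltW.
- by move=> k _; rewrite divr_gt0 ?exprn_gt0 // ltr0n fact_gt0.
- by move=> k _; exact: poisson_rec.
- move=> k kn; rewrite stirling1_coef ?gt_eqF // exprMn; field.
  by rewrite !fact_neq0 expf_neq0 // gt_eqF.
- by rewrite /mu1 -/L; ring.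
- by rewrite /var1 -/L /l; field; rewrite !gt_eqF // addrC.
Qed.

(** Here [m = t n (e^l - 1)] and [mu = l e^l/(e^l - 1)], so [m mu = n] says [l e^l = 1/t]: this is
    how the Lambert function enters. *)
Lemma unif2 (a b e : R) : 0 < a -> 0 < b -> 0 < e ->
  exists N, forall n t, (N <= n)%N -> a <= t -> t <= b -> error2 n t <= e.
Proof.
move=> a0 b0 e0.
(* The parameter ranges over a compact interval: [l <= l e^l = 1/t <= 1/a], hence
   [l = e^(-l)/t >= e^(-1/a)/b]. *)
have l00 : 0 < expR (- a^-1) / b by rewrite divr_gt0 // expR_gt0.
have [c c0 [C C0 gm]] := exp_moments a^-1 l00.
have [N HN] := drive c0 C0 e0.
exists (maxn N 4) => n t; rewrite geq_max => /andP[Nn n3] at_ tb.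
have t0 : 0 < t by apply: lt_le_trans at_.
have [_ lE] : -1 < lambertW0 t^-1 /\ lambertW0 t^-1 * expR (lambertW0 t^-1) = t^-1.
  by apply: lambertW0P; rewrite invr_gt0.
rewrite /error2 /mu2 /var2; move: (lambertW0 _) lE => l lE.
have l0 : 0 < l.
  by rewrite -(pmulr_lgt0 _ (expR_gt0 l)) lE invr_gt0.
have e1 : 1 <= expR l by have := expR_ge1Dx l; lra.
have ta : t^-1 <= a^-1 by rewrite lef_pV2.
have lb : l <= a^-1 by apply: le_trans ta; rewrite -lE ler_peMr // ltW.
have le : l = expR (- l) / t.
  by rewrite -lE mulrC -mulrA expRxMexpNx_1 mulr1.
have la : expR (- a^-1) / b <= l.
  rewrite [leRHS]le; apply: ler_pM; rewrite ?expR_ge0 ?invr_ge0 ?(ltW b0) //.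
    by rewrite ler_expR lerN2.
  by rewrite lef_pV2.
have g := gm l n la lb n3.
have D0 : 0 < expR l - 1 by have := expR_ge1Dx l; lra.
have n0 : 0 < n%:R :> R by rewrite ltr0n; apply: leq_trans n3.
have x0 : 0 < t * n%:R by rewrite mulr_gt0.
have tE : t = (l * expR l)^-1 by rewrite lE invrK.
have E0 := expR_gt0 l; have l1 : 0 < 1 + l by rewrite addr_gt0.
have -> : pmf2 t n = fun k => (stirling2 n k)%:R * (t * n%:R) ^+ k /
   \sum_(j < n.+1) (stirling2 n j)%:R * (t * n%:R) ^+ j.
  rewrite /pmf2 /touchard; apply/funext => k; congr (_ / _).
  rewrite -(big_mkord xpredT (fun j => (stirling2 n j)%:R * (t * n%:R) ^+ j)) [RHS]big_ltn //.
  by case: (n) n3 => [|n'] // _; rewrite /= mul0r add0r.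
apply: (HN n _ _ _ (t * n%:R * (expR l - 1)) 0 (l ^+ n / n`!%:R) _ _
  (fun k => (t * n%:R * (expR l - 1)) ^+ k / k`!%:R) _ Nn g) => //.
- by rewrite tE; field; rewrite !gt_eqF.
- by rewrite lexx ltW.
- by move=> k _; rewrite divr_gt0 ?exprn_gt0 ?mulr_gt0 // ltr0n fact_gt0.
- by move=> k _; exact: poisson_rec.
- move=> k kn; rewrite stirling2_coef ?gt_eqF // exprMn; field.
  by rewrite !fact_neq0 expf_neq0 // gt_eqF.
- by rewrite tE; field; rewrite !gt_eqF.
- by rewrite tE; field; rewrite !gt_eqF.
Qed.

(** With [b = e^l - 1] and [m = t n (1 - e^(-l))], [m + b (m - k) = b (t n - k)], the ratio of
    falling factorials. Since [k <= n <= t n] these are positive, and by [exprn_falling] their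
    weighted sum is the denominator [(t n)^n]. *)
Lemma unif3 (b e : R) : 1 <= b -> 0 < e ->
  exists N, forall n t, (N <= n)%N -> 1 <= t -> t <= b -> error3 n t <= e.
Proof.
move=> b1 e0; have b0 : 0 < b by apply: lt_le_trans b1.
have l00 : 0 < b^-1 by rewrite invr_gt0.
have [c c0 [C C0 gm]] := exp_moments 1 l00.
have C'0 : 0 < C + expR 1 by rewrite addr_gt0 // expR_gt0.
have [N HN] := drive c0 C'0 e0.
exists (maxn N 4) => n t; rewrite geq_max => /andP[Nn n3] t1 tb.
have t0 : 0 < t by apply: lt_le_trans t1.
pose l := t^-1.
have l0 : 0 < l by rewrite invr_gt0.
have la : b^-1 <= l by rewrite lef_pV2.
have lb : l <= 1 by rewrite invf_le1.
have g0 := gm l n la lb n3.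
have g : good_moments c (C + expR 1) (l * expR l / (expR l - 1))
     (l * expR l / (expR l - 1) * (1 + l)) (expq l (expR l - 1)) n.
  by apply: good_momentsW g0; rewrite lerDl expR_ge0.
have D0 : 0 < expR l - 1 by have := expR_ge1Dx l; lra.
have E0 := expR_gt0 l.
have n0 : 0 < n%:R :> R by rewrite ltr0n; apply: leq_trans n3.
have x0 : 0 < t * n%:R by rewrite mulr_gt0.
have nx : n%:R <= t * n%:R by rewrite ler_peMl // ltW.
have fall k : (k <= n)%N -> 0 < falling (t * n%:R) k.
  move=> kn; apply: prodr_gt0 => i _; rewrite subr_gt0; apply: lt_le_trans nx.
  by rewrite ltr_nat (leq_trans (ltn_ord i)).
have -> : error3 n t = llt_error (fun k => (stirling2 n k)%:R * falling (t * n%:R) k /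
   \sum_(j < n.+1) (stirling2 n j)%:R * falling (t * n%:R) j) (gauss (mu3 t) (var3 t) n) n.
  rewrite /error3 -exprn_falling; congr (llt_error _ _ _).
  by apply/funext => k; rewrite /pmf3 mulrA.
have tE : t = l^-1 by rewrite /l invrK.
have eN : expR (- l) = (expR l)^-1 by rewrite expRN.
apply: (HN n _ _ _ (t * n%:R * (expR l - 1) / expR l) (expR l - 1) (l ^+ n / n`!%:R) _ _
  (fun k => (expR l - 1) ^+ k * falling (t * n%:R) k / k`!%:R) _ Nn g) => //.
- by rewrite tE; field; rewrite !gt_eqF.
- rewrite (ltW D0) /=; have : expR l <= expR 1 by rewrite ler_expR.
  by move: C0; lra.
- by move=> k kn; rewrite divr_gt0 ?mulr_gt0 ?exprn_gt0 ?fall // ltr0n fact_gt0.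
- move=> k kn; have -> : falling (t * n%:R) k.+1 = falling (t * n%:R) k * (t * n%:R - k%:R).
    by rewrite /falling big_ord_recr.
  rewrite factS natrM exprS; field.
  by rewrite ?fact_neq0 ?nat1r ?pnatr_eq0 ?(gt_eqF E0).
- move=> k kn; rewrite stirling2_coef ?gt_eqF //; field.
  by rewrite !fact_neq0 expf_neq0 // gt_eqF.
- by rewrite /mu3 -/l eN; field; rewrite !gt_eqF.
- by rewrite /var3 -/l eN tE; field; rewrite !gt_eqF.
Qed.

Lemma llt_error_ge0 (p q : nat -> R) n : 0 <= llt_error p q n.
Proof. by rewrite mulr_ge0 ?sqrtr_ge0 // bigmax_ge_id. Qed.

Lemma compact_ub (K : set R) : compact K -> exists2 b, 1 <= b & forall t, K t -> t <= b.
Proof.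
move=> /compact_bounded [M [_ HM]]; exists (`|M| + 1); first by rewrite lerDr.
move=> t Kt; apply: le_trans (ler_norm t) _; apply: HM => //.
by apply: (le_lt_trans (ler_norm M)); rewrite ltrDl.
Qed.

(** The image under inversion is compact, hence bounded above. *)
Lemma compact_lb (K : set R) : compact K -> K `<=` [set t | 0 < t] ->
  exists2 a, 0 < a & forall t, K t -> a <= t.
Proof.
move=> cK K0.
have cV : compact ((@GRing.inv R) @` K).
  apply: continuous_compact cK; apply: continuous_in_subspaceT => t.
  by rewrite inE => /K0 /= t0; apply: inv_continuous; rewrite gt_eqF.
have [b b1 Kb] := compact_ub cV.
have b0 : 0 < b by apply: lt_le_trans b1.
exists b^-1; first by rewrite invr_gt0.
move=> t Kt; have t0 : 0 < t := K0 t Kt.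
by rewrite -[leRHS]invrK lef_pV2 ?posrE ?invr_gt0 //; apply: Kb; exists t.
Qed.

Lemma pointwise_of_unif (F : nat -> R -> R) t : (forall n, 0 <= F n t) ->
  (forall e, 0 < e -> exists N, forall n, (N <= n)%N -> F n t <= e) ->
  F n t @[n --> \oo] --> (0 : R).
Proof.
move=> F0 H; apply/cvgrPdist_le => e e0; have [N HN] := H e e0.
by exists N => // n /= Nn; rewrite sub0r normrN ger0_norm ?HN.
Qed.

Lemma uniform_of_unif (F : nat -> R -> R) (K : set R) : (forall n t, 0 <= F n t) ->
  (forall e, 0 < e -> exists N, forall n t, (N <= n)%N -> K t -> F n t <= e) ->
  {uniform K, F @ \oo --> (fun=> 0 : R)}.
Proof.
move=> F0 H P /uniform_nbhs [E [entE EP]].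
have [e /= e0 eE] : exists2 e : R, 0 < e & forall x y : R, ball x e y -> E (x, y).
  move: entE; rewrite -entourage_ballE => -[e /= e0 h].
  by exists e => // x y bxy; apply: h.
have [N HN] := H (e / 2) ltac:(by rewrite divr_gt0).
exists N => // n /= Nn; apply: EP => t Kt; apply: eE.
rewrite /ball /= sub0r normrN ger0_norm //; apply: (le_lt_trans (HN n t Nn Kt)).
by rewrite ltr_pdivrMr // ltr_pMr // ltr1n.
Qed.

End Instances.

Theorem theorem2p8 (R : realType) :
  [/\ (forall t : R, 0 < t -> error1 n t @[n --> \oo] --> (0 : R)),
      (forall t : R, 0 < t -> error2 n t @[n --> \oo] --> (0 : R)) &
      (forall t : R, 1 <= t -> error3 n t @[n --> \oo] --> (0 : R))] /\
  [/\ (forall K : set R, compact K -> K `<=` [set t | 0 < t] ->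
         {uniform K, (@error1 R) @ \oo --> (fun=> 0 : R)}),
      (forall K : set R, compact K -> K `<=` [set t | 0 < t] ->
         {uniform K, (@error2 R) @ \oo --> (fun=> 0 : R)}) &
      (forall K : set R, compact K -> K `<=` [set t | 1 <= t] ->
         {uniform K, (@error3 R) @ \oo --> (fun=> 0 : R)})].
Proof.
split; split.
(* Pointwise convergence is the uniform bound on the degenerate interval [[t, t]], and on [[1, t]]
   in the third case. *)
- move=> t t0; apply: pointwise_of_unif => [n|e e0]; first exact: llt_error_ge0.
  by have [N HN] := unif1 t0 t0 e0; exists N => n Nn; exact: HN.
- move=> t t0; apply: pointwise_of_unif => [n|e e0]; first exact: llt_error_ge0.
  by have [N HN] := unif2 t0 t0 e0; exists N => n Nn; exact: HN.
- move=> t t1; apply: pointwise_of_unif => [n|e e0]; first exact: llt_error_ge0.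
  by have [N HN] := unif3 t1 e0; exists N => n Nn; exact: HN.
- move=> K cK K0; apply: uniform_of_unif => [n t|e e0]; first exact: llt_error_ge0.
  have [a a0 Ka] := compact_lb cK K0; have [b b1 Kb] := compact_ub cK.
  have [N HN] := unif1 a0 (lt_le_trans ltr01 b1) e0.
  by exists N => n t Nn Kt; apply: HN => //; [exact: Ka|exact: Kb].
- move=> K cK K0; apply: uniform_of_unif => [n t|e e0]; first exact: llt_error_ge0.
  have [a a0 Ka] := compact_lb cK K0; have [b b1 Kb] := compact_ub cK.
  have [N HN] := unif2 a0 (lt_le_trans ltr01 b1) e0.
  by exists N => n t Nn Kt; apply: HN => //; [exact: Ka|exact: Kb].
- move=> K cK K1; apply: uniform_of_unif => [n t|e e0]; first exact: llt_error_ge0.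
  have [b b1 Kb] := compact_ub cK; have [N HN] := unif3 b1 e0.
  by exists N => n t Nn Kt; apply: HN => //; [exact: K1|exact: Kb].
Qed.
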